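(* For every $\varepsilon\in\left(0,\frac{1}{3}\right)$ there exist positive constants $b$ and $n_0$ such that the following holds. Let $T_n$ be a tree on $n\geq n_0$ vertices with maximum degree $\Delta(T_n)<\left(\frac13-\varepsilon\right)n$. Then Waiter has a winning strategy in the game $\mathrm{WC}(n,T_n)$. Furthermore, she can achieve her goal within at most $n+b\sqrt n$ rounds.
   Context: The unbiased Waiter-Client game $\mathrm{WC}(n,T_n)$ is played on the edge set of the complete graph $K_n$. In each round Waiter offers Client two previously unclaimed edges; Client chooses one of them, which he keeps (colored red), and the other goes to Waiter (colored blue). If in the final round only one unclaimed edge remains, it goes to Waiter. Waiter wins if at the end Client's (red) graph contains a copy of the tree $T_n$; otherwise Client wins. ''Waiter achieves her goal within $t$ rounds'' means she has a strategy such that after at most $t$ rounds Client's graph contains a copy of $T_n$. *)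

(* Defs.v *)
From HB Require Import structures.
From mathcomp Require Import all_boot all_order all_algebra.
From mathcomp Require Import reals.
Set Implicit Arguments. Unset Strict Implicit. Unset Printing Implicit Defensive.
Import Order.TTheory GRing.Theory Num.Theory.

(* Graphs on the vertex set 'I_n are sets of edges; an edge is a 2-element
   subset of 'I_n. *)
Definition graph (n : nat) := {set {set 'I_n}}.

Definition Kn (n : nat) : graph n := [set e : {set 'I_n} | #|e| == 2].

Definition adj n (G : graph n) : rel 'I_n := fun x y => [set x; y] \in G.

(* A tree on vertex set 'I_n: a nonempty, connected graph in which every
   edge is a bridge (i.e. connected and acyclic). *)
Definition is_tree n (T : graph n) : Prop :=
  0 < n /\ T \subset Kn n /\
  (forall x y : 'I_n, connect (adj T) x y) /\
  (forall x y : 'I_n, [set x; y] \in T -> ~~ connect (adj (T :\ [set x; y])) x y).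

Definition deg n (G : graph n) (v : 'I_n) : nat := #|[set u | [set u; v] \in G]|.
Definition maxdeg n (G : graph n) : nat := \max_(v : 'I_n) deg G v.

Definition contains_copy n (T G : graph n) : Prop :=
  exists f : 'I_n -> 'I_n, injective f /\ forall e, e \in T -> f @: e \in G.

(* waiter_wins_from T t Rd U: from the position where Client's (red) edges
   are Rd and the unclaimed edges are U, Waiter can force Client's graph to
   contain a copy of T within at most t further rounds.  In each round
   Waiter offers two distinct unclaimed edges; Client keeps one (red) and the
   other goes to Waiter (blue, i.e. it is just removed from U). *)
Fixpoint waiter_wins_from n (T : graph n) (t : nat) (Rd U : graph n) : Prop :=
  match t with
  | 0 => contains_copy T Rd
  | t'.+1 => contains_copy T Rd \/
      exists e1 e2, [/\ e1 \in U, e2 \in U, e1 != e2 &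
        forall c, (c = e1 \/ c = e2) ->
          waiter_wins_from T t' (c |: Rd) (U :\ e1 :\ e2)]
  end.

Definition waiter_wins_within n (T : graph n) (t : nat) : Prop :=
  waiter_wins_from T t set0 (Kn n).

(* Waiter wins the (full) game WC(n,T): the game lasts floor(C(n,2)/2)
   rounds (a last single edge goes to Waiter and does not affect Client). *)
Definition waiter_wins n (T : graph n) : Prop :=
  waiter_wins_within T (#|Kn n| %/ 2).

(* Main.v *)
Require Import Defs.
From HB Require Import structures.
From mathcomp Require Import all_boot all_order all_algebra.
From mathcomp Require Import reals.
From mathcomp Require Import zify.
Set Implicit Arguments. Unset Strict Implicit. Unset Printing Implicit Defensive.
Import Order.TTheory GRing.Theory Num.Theory.

(** Root the tree, and call the tree vertices roles.  Both edges offered in a round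
    share an end: Waiter either offers two unused vertices to a placed vertex [p], so
    that Client picks a child of [p], or offers one unused vertex to two placed ones, so
    that Client picks its parent.  A skeleton of O(sqrt n) roles is placed first; it
    contains the hubs, i.e. the roles with more than about [sqrt n / N] children.  The
    children of hubs are then placed in such a way that every unused vertex loses at
    most two edges to hubs; this is possible as long as one, two, three hubs never
    require more than 1/3, 2/3, 1 of the unused vertices, and it is here that the bound
    on the maximum degree is used.  All other roles are placed greedily, except for a
    reserved set [Z] of O(sqrt n) roles.

    If no three vertices carry almost all the leaves, [Z] consists of leaves below hubs.
    Trading an unplaced leaf for an already placed one of another hub (the leaves [Src],
    which have lost no edge so far, serve this purpose) creates alternatives at
    four hubs for the same unused vertex, which is joined to two of them.
    Otherwise all but O(sqrt n) leaves hang from three vertices, the tree has a long path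
    whose inner vertices have one child each, and [Z] is taken on it: the unused vertices
    are threaded into a path between two given ends, closed by a rotation. *)

(** * The game *)

(** The [sqrt n] is a balance. If hubs are the roles with more than [q] children, there are at most
    [n / q] of them, and each skeleton role costs a bounded number of extra rounds. Hence [q] of
    order [sqrt n]. The third is a matter of pace: a cycle of offers that uses up three untouched
    vertices assures the largest demand of only one new child. The obstacle to placing a skeleton in
    advance is a role directly above it. It needs red edges to a child placed before it and to a
    parent placed after it, and Client could refuse the second edge. Such a link therefore gets two
    candidate vertices, both joined to the child; once the parent is placed, Waiter offers it both.
    Closing the skeleton under branching ensures that a link has only one child that matters. *)

Section Game.
Variable n : nat.
Implicit Types (Rd U : graph n) (G : graph n -> graph n -> Prop).

(** The goal is a predicate on the whole position, unclaimed edges included, so that one phase can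
    hand its invariant to the next ([force_bind]). Waiter may stop as soon as the goal holds, so [t]
    is only an upper bound. *)
Fixpoint force (t : nat) G Rd U : Prop :=
  match t with
  | 0 => G Rd U
  | t'.+1 => G Rd U \/ exists e1 e2, [/\ e1 \in U, e2 \in U, e1 != e2 &
      forall c, (c = e1 \/ c = e2) -> force t' G (c |: Rd) (U :\ e1 :\ e2)]
  end.

Lemma force_now t G Rd U : G Rd U -> force t G Rd U.
Proof. by case: t => //= t; left. Qed.

Lemma force_bind t s G G' Rd U : force t G Rd U ->
  (forall Rd' U', G Rd' U' -> force s G' Rd' U') -> force (t + s) G' Rd U.
Proof.
move=> + GG'; elim: t Rd U => [|t IH] Rd U /=; first exact: GG'.
case=> [g|[e1 [e2 [u1 u2 ne Fc]]]].
  suff mono k Rd1 U1 : force k G' Rd1 U1 -> force k.+1 G' Rd1 U1.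
    have := GG' _ _ g; change (force s G' Rd U -> force (t.+1 + s) G' Rd U).
    by elim: (t.+1) => // k IHk /IHk; apply: mono.
  elim: k Rd1 U1 => [|k IHk] Rd1 U1; first by move=> h; left.
  case=> [h|[e1 [e2 [u1 u2 ne Fc]]]]; first by left.
  by right; exists e1, e2; split=> // c /Fc; apply: IHk.
by right; exists e1, e2; split=> // c /Fc; apply: IH.
Qed.

Lemma force_imp t G G' Rd U : (forall Rd' U', G Rd' U' -> G' Rd' U') ->
  force t G Rd U -> force t G' Rd U.
Proof.
by move=> GG' /force_bind F; rewrite -[t]addn0; apply: F => Rd' U' /GG'.
Qed.

Lemma force_leq s t G Rd U : s <= t -> force s G Rd U -> force t G Rd U.
Proof.
by move=> st F; rewrite -(subnKC st); apply: (force_bind F) => Rd' U'; apply: force_now.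
Qed.

Definition same (a b c d : 'I_n) := ((a == c) && (b == d)) || ((a == d) && (b == c)).

Lemma set2_eq (a b c d : 'I_n) : ([set a; b] == [set c; d]) = same a b c d.
Proof.
apply/eqP/idP => [E|]; last first.
  by case/orP=> /andP[/eqP-> /eqP->] //; rewrite setUC.
have : d \in [set a; b] by rewrite E set22.
have : c \in [set a; b] by rewrite E set21.
have : b \in [set c; d] by rewrite -E set22.
have : a \in [set c; d] by rewrite -E set21.
rewrite !inE /same => /orP[]/eqP-> /orP[]/eqP->; rewrite !eqxx ?orbT //= orbb.
  by move=> _ /eqP->; rewrite eqxx.
by move=> /eqP-> _; rewrite eqxx.
Qed.

Definition unclaimed U (x y : 'I_n) := [set x; y] \in U.
Definition red_edge Rd (x y : 'I_n) := [set x; y] \in Rd.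

Lemma frC U x y : unclaimed U x y = unclaimed U y x.
Proof. by rewrite /unclaimed setUC. Qed.
Lemma rdC Rd x y : red_edge Rd x y = red_edge Rd y x.
Proof. by rewrite /red_edge setUC. Qed.
(* The position after Waiter offers [p z] and [p w] and Client keeps [p z]. *)
Definition upd U (p z w : 'I_n) U' :=
  forall a b, unclaimed U' a b = [&& unclaimed U a b, ~~ same a b p z & ~~ same a b p w].

Definition updR Rd (p z : 'I_n) Rd' := forall a b, red_edge Rd' a b = red_edge Rd a b || same a b p z.

Lemma force_offer t G Rd U p x y : unclaimed U p x -> unclaimed U p y -> x != y ->
  (forall z w Rd' U', (z = x /\ w = y) \/ (z = y /\ w = x) ->
     upd U p z w U' -> updR Rd p z Rd' -> force t G Rd' U') ->
  force t.+1 G Rd U.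
Proof.
move=> px py xy K; right; exists [set p; x], [set p; y]; split=> //.
  rewrite set2_eq /same eqxx (negPf xy) /=; apply: contra xy.
  by case/andP=> /eqP-> /eqP->.
move=> c [] ->.
  apply: (K x y); first by left.
    by move=> a b; rewrite /unclaimed !inE !set2_eq; case: same; case: same; rewrite ?andbF ?andbT.
  by move=> a b; rewrite /red_edge !inE !set2_eq orbC.
apply: (K y x); first by right.
  by move=> a b; rewrite /unclaimed !inE !set2_eq; case: same; case: same; rewrite ?andbF ?andbT.
by move=> a b; rewrite /red_edge !inE !set2_eq orbC.
Qed.

Section Upd.
Variables (U U' : graph n) (p z w : 'I_n).
Hypothesis u : upd U p z w U'.

Lemma upd_np a b : a != p -> b != p -> unclaimed U' a b = unclaimed U a b.
Proof. by move=> /negPf ap /negPf bp; rewrite u /same ap bp !andbF !andbT. Qed.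

Lemma upd_nzw a b : a != z -> a != w -> b != z -> b != w -> unclaimed U' a b = unclaimed U a b.
Proof.
by move=> /negPf az /negPf aw /negPf bz /negPf bw; rewrite u /same az bz aw bw !andbF !andbT.
Qed.

Lemma upd_n a b : b != p -> b != z -> b != w -> unclaimed U' a b = unclaimed U a b.
Proof. by move=> /negPf az /negPf aw /negPf bz; rewrite u /same az bz aw !andbF !andbT. Qed.

Lemma upd_p a : a != z -> a != w -> unclaimed U' p a = unclaimed U p a.
Proof.
move=> /negPf az /negPf aw; rewrite u /same az aw eqxx /=.
case: (eqVneq a p) => [E|ap]; last by rewrite !andbF !andbT.
by rewrite E in az aw *; rewrite az aw !andbT.
Qed.
End Upd.

Lemma updR_sub Rd Rd' p z a b : updR Rd p z Rd' -> red_edge Rd a b -> red_edge Rd' a b.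
Proof. by move=> u; rewrite u => ->. Qed.

Lemma updR_new Rd Rd' p z : updR Rd p z Rd' -> red_edge Rd' p z.
Proof. by move=> u; rewrite u /same !eqxx orbT. Qed.

Lemma force_waiter (T : graph n) t Rd U :
  force t (fun Rd' _ => contains_copy T Rd') Rd U -> waiter_wins_from T t Rd U.
Proof.
elim: t Rd U => //= t IH Rd U [c|[e1 [e2 [u1 u2 ne Fc]]]]; first by left.
by right; exists e1, e2; split=> // c /Fc /IH.
Qed.

End Game.
Arguments force : simpl never.

(** * Rooting the tree *)

Record rooting n (T : graph n) := Rooting {
  rt_root : 'I_n; rt_par : 'I_n -> 'I_n; rt_rk : 'I_n -> nat;
  rt_rkP : forall v, v != rt_root -> rt_rk (rt_par v) < rt_rk v;
  rt_edge : forall v, v != rt_root -> [set v; rt_par v] \in T;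
  rt_all : forall e, e \in T -> exists2 v, v != rt_root & e = [set v; rt_par v] }.

(** The parents come from shortest paths to vertex 0, with the distance as rank. If a tree edge were
    not a parent edge, both its ends would still reach the root along parents after its deletion, so
    it would not be a bridge. Thus the parent edges are all that has to be embedded. *)
Lemma tree_rooting n (T : graph n) : is_tree T -> inhabited (rooting T).
Proof.
case=> n_gt0 [TK [conn bridge]].
pose r : 'I_n := Ordinal n_gt0.
have dist_ex v : exists k, [exists s : k.-tuple 'I_n, path (adj T) r s && (last r s == v)].
  have /connectP[s ps ->] := conn r v.
  by exists (size s); apply/existsP; exists (in_tuple s); rewrite ps eqxx.
pose rk v := ex_minn (dist_ex v).
have rkE v : exists2 s : seq 'I_n, path (adj T) r s & last r s = v /\ size s = rk v.
  rewrite /rk; case: ex_minnP => k /existsP[s /andP[ps /eqP ls]] _.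
  by exists s => //; rewrite size_tuple.
have rk_le v (s : seq 'I_n) : path (adj T) r s -> last r s = v -> rk v <= size s.
  rewrite /rk; case: ex_minnP => k _ min ps ls; apply: min.
  by apply/existsP; exists (in_tuple s); rewrite ps ls eqxx.
have parE v : exists p, (v != r) ==> (([set v; p] \in T) && (rk p < rk v)).
  case: (eqVneq v r) => [->|vr]; first by exists r.
  have [s] := rkE v; case/lastP: s => [|s x]; first by move=> _ [/= /esym/eqP]; rewrite (negPf vr).
  rewrite rcons_path last_rcons size_rcons => /andP[ps ax] [<- <-] /=.
  exists (last r s); rewrite setUC; apply/andP; split; first exact: ax.
  by rewrite ltnS; apply: rk_le.
pose par v := xchoose (parE v).
have parP v : v != r -> ([set v; par v] \in T) && (rk (par v) < rk v).
  by move=> vr; apply: (implyP (xchooseP (parE v))).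
have all e : e \in T -> exists2 v, v != r & e = [set v; par v].
  move=> eT; have := subsetP TK _ eT; rewrite inE => /cards2P[x [y [xy eE]]].
  case: (pickP (fun v => (v != r) && (e == [set v; par v]))) => [v /andP[vr /eqP ->]|none].
    by exists v.
  have up v : connect (adj (T :\ e)) v r.
    have [m] := ubnP (rk v); elim: m v => // m IH v; rewrite ltnS => le.
    case: (eqVneq v r) => [->|vr]; first exact: connect0.
    have /andP[pT lt] := parP _ vr.
    apply: connect_trans (IH (par v) _); last exact: leq_trans lt le.
    apply: connect1; rewrite /adj !inE pT andbT eq_sym.
    by have := none v; rewrite vr /= => ->.
  have sym : connect_sym (adj (T :\ e)) by apply: sym_connect_sym => a b; rewrite /adj setUC.
  have := bridge x y; rewrite -eE => /(_ eT) /negP[].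
  by rewrite (connect_trans (up x)) // sym.
by constructor; exists r par rk => // v /parP/andP[].
Qed.

(** * Serving demands on the hubs *)

(** The bookkeeping of one cycle: [d] before it, [D] after the two largest demands [h1] and [h2]
    have been served, [d'] after [t], chosen by Client between [a] and [b], the largest demands left
    outside [j]. Three untouched vertices are spent, so the supply drops from [f.+3] to [f]. Hubs
    that were served lose their share. For the others the cap on larger sets helps: if [h] is
    neither [h1] nor [h2], then [6 * d h <= 3 * (d h1 + d h2) <= 2 * f] by the slack 6, and the
    slack 8 plays the same part for pairs. A triple that is not served three times is controlled by
    the bound on four demands. *)
Lemma cap_step (K : finType) (d D d' : K -> nat) f (h1 h2 i j t a b : K) :
  (forall h, 3 * d h <= f.+3) ->
  (forall h k, h != k -> 3 * (d h + d k) + 6 <= 2 * f.+3) ->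
  (forall h k l, h != k -> h != l -> k != l -> d h + d k + d l + 8 <= f.+3) ->
  (forall h k l m, h != k -> h != l -> h != m -> k != l -> k != m -> l != m ->
     d h + d k + d l + d m + 60 <= f.+3) ->
  h2 != h1 -> (forall h, d h <= d h1) -> (forall h, h != h1 -> d h <= d h2) ->
  (forall h, D h + (h == h1) + (h == h2) = d h) ->
  (forall h, d' h + (h == t) = D h) ->
  ((i == h1) && (j == h2)) || ((i == h2) && (j == h1)) ->
  (t == a) || (t == b) -> a != j -> b != j -> b != a ->
  (forall h, h != j -> D h <= D a) -> (forall h, h != j -> h != a -> D h <= D b) ->
  [/\ forall h, 3 * d' h <= f,
  forall h k, h != k -> 3 * (d' h + d' k) + 6 <= 2 * f &
  forall h k l, h != k -> h != l -> k != l -> d' h + d' k + d' l + 8 <= f].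
Proof.
move=> cap1 cap2 cap3 cap4 h21 max1 max2 DE dE ij tab aj bj ba maxa maxb.
have h12 : h1 != h2 by rewrite eq_sym.
have D2 h : d' h + (h == t) + (h == h1) + (h == h2) = d h by rewrite dE DE.
have miss v h k l : (v == h1) || (v == h2) -> h != k -> h != l -> k != l ->
    v != h -> v != k -> v != l -> d' h + d' k + d' l + 8 <= f.
  move=> v12 hk hl kl vh vk vl.
  have S4 := cap4 _ _ _ _ vh vk vl hk hl kl.
  suff two : d h <= d v /\ d k <= d v \/ d h <= d v /\ d l <= d v \/ d k <= d v /\ d l <= d v.
    by have := D2 h; have := D2 k; have := D2 l; move: S4 two (cap1 h) (cap1 k) (cap1 l);
      clear; lia.
  case/orP: v12 => /eqP E; subst v; first by left; rewrite !max1.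
  have [E|hh] := eqVneq h h1; first by right; right; rewrite !max2 // -E eq_sym.
  have [E|kk] := eqVneq k h1; first by right; left; rewrite !max2 // -E eq_sym.
  by left; rewrite !max2.
have both s : s != h1 -> s != h2 -> d' h1 + d' h2 + d' s + 8 <= f.
  move=> s1 s2.
  have := D2 h1; have := D2 h2; have := D2 s; have C3 := cap3 _ _ _ h12 _ _.
  have {}C3 := C3 s; rewrite ![_ == s]eq_sym s1 s2 in C3; have {C3} := C3 isT isT.
  rewrite !eqxx (negPf h12) (negPf h21) (negPf s1) (negPf s2).
  have [tE|t1] := eqVneq h1 t; first by clear; lia.
  have [tE|t2] := eqVneq h2 t; first by clear; lia.
  have [tE|ts] := eqVneq s t; first by clear; lia.
  have S4 := cap4 _ _ _ _ h12 _ t1 _ t2 ts.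
  rewrite ![_ == s]eq_sym s1 s2 in S4; have {}S4 := S4 isT isT.
  suff : d s <= d t \/ (d h2 <= (d t).+1 /\ d h2 <= (d s).+1).
    by have := cap2 _ _ h12; move: S4 (max2 s s1) (max1 s); clear; lia.
  have Dt := DE t; rewrite eq_sym (negPf t1) eq_sym (negPf t2) !addn0 in Dt.
  have Ds := DE s; rewrite (negPf s1) (negPf s2) !addn0 in Ds.
  rewrite -Dt -Ds.
  have sj : s != j by case/orP: ij => /andP[_ /eqP->].
  have tj : t != j by case/orP: ij => /andP[_ /eqP->]; rewrite eq_sym.
  have [ea|sa] := eqVneq s a; last first.
    have [eb|sb] := eqVneq s b; last first.
      left; have := maxb _ sj sa; case/orP: tab => /eqP->; last by [].
      by move=> le; apply: leq_trans le (maxa _ bj).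
    case/orP: tab => /eqP ta; last by rewrite -eb in ta; rewrite ta eqxx in ts.
    by left; rewrite ta; apply: maxa.
  right; case/orP: tab => /eqP tb; first by rewrite -ea in tb; rewrite tb eqxx in ts.
  have [i_j [i_a i_b]] : i != j /\ (i != a /\ i != b).
    by rewrite -ea -tb; case/orP: ij => /andP[/eqP-> /eqP->]; rewrite ?h12 ?h21 ?t1 ?t2 ![_ == s]eq_sym ?s1 ?s2.
  have := maxb _ i_j i_a; have := maxa _ bj; rewrite -ea -tb.
  suff : d h2 <= (D i).+1 by clear; lia.
  case/orP: ij => /andP[/eqP-> _].
    by have := DE h1; rewrite eqxx (negPf h12); have := max1 h2; clear; lia.
  by have := DE h2; rewrite eqxx (negPf h21); clear; lia.
split.
- move=> h; have := D2 h; have := cap1 h; have := max1 h2; have := cap2 _ _ h21; have := max2 h.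
  case: (eqVneq h h1) => [E|hh1] /=; first by clear; lia.
  by move=> /(_ isT); clear; case: eqVneq => [->|_]; lia.
- move=> h k hk; have := D2 h; have := D2 k; have := cap2 _ _ hk.
  have [E|hh1] := eqVneq h h1.
    subst h; have [E|kh2] := eqVneq k h2; first by subst k; rewrite (negPf h12); clear; lia.
    have := max2 k; rewrite eq_sym hk; have := cap3 h1 h2 k; rewrite h12 hk [h2 == k]eq_sym kh2.
    by move=> /(_ isT isT isT) + /(_ isT); move: (cap1 h1); clear; lia.
  have [E|kh1] := eqVneq k h1.
    subst k; have [E|hh2] := eqVneq h h2; first by subst h; rewrite (negPf h12); clear; lia.
    have := max2 h; rewrite hk; have := cap3 h1 h2 h; rewrite h12 [h1 == h]eq_sym hk [h2 == h]eq_sym hh2.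
    by move=> /(_ isT isT isT) + /(_ isT); move: (cap1 h1); clear; lia.
  have := cap3 h1 h k; rewrite [h1 == h]eq_sym hh1 [h1 == k]eq_sym kh1 hk => /(_ isT isT isT).
  by move: (max1 h) (max1 k) (cap1 h) (cap1 k); clear; lia.
- move=> h k l hk hl kl.
  have [in1|] := boolP [|| h == h1, k == h1 | l == h1]; last first.
    rewrite !negb_or => /and3P[n1 n2 n3].
    by apply: (miss h1); rewrite ?eqxx // eq_sym.
  have [in2|] := boolP [|| h == h2, k == h2 | l == h2]; last first.
    rewrite !negb_or => /and3P[n1 n2 n3].
    by apply: (miss h2); rewrite ?eqxx ?orbT // eq_sym.
  have kh : k != h by rewrite eq_sym.
  have lh : l != h by rewrite eq_sym.
  have lk : l != k by rewrite eq_sym.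
  case/or3P: in1 => /eqP E1; case/or3P: in2 => /eqP E2; subst; try by rewrite eqxx in h12.
  - by have := both l lh lk; clear; lia.
  - by have := both k kh kl; clear; lia.
  - by have := both l lk lh; clear; lia.
  - by have := both h hk hl; clear; lia.
  - by have := both k kl kh; clear; lia.
  - by have := both h hl hk; clear; lia.
Qed.

Section Good.
Variables (V K : finType) (key : V -> K).
Implicit Type O : {set V}.

(* The ways to place a role of [O], to be joined to the hub [key v], and the number of
   untouched vertices they use up: one vertex is offered to two hubs; two vertices are
   offered to one hub; the latter, followed by offering the losing vertex to two other hubs. *)
Inductive good : {set V} -> nat -> Prop :=
| good0 f : good set0 f
| goodT1 O f v1 v2 : v1 \in O -> v2 \in O -> key v1 != key v2 ->
    good (O :\ v1) f -> good (O :\ v2) f -> good O f.+1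
| goodT2 O f v : v \in O -> good (O :\ v) f -> good O f.+2
| goodP O f v a b : v \in O -> a \in O -> b \in O ->
    key a != key v -> key b != key v -> key a != key b ->
    good (O :\ v :\ a) f -> good (O :\ v :\ b) f -> good O f.+2.

Definition demand O h := #|[set v in O | key v == h]|.

Lemma dm_sum O : \sum_h demand O h = #|O|.
Proof.
rewrite -sum1_card (partition_big key predT) //=.
by apply: eq_bigr => h _; rewrite sum1dep_card.
Qed.

Lemma dm_rem O v h : v \in O -> demand (O :\ v) h + (h == key v) = demand O h.
Proof.
move=> vO; rewrite /demand [RHS](cardsD1 v) inE vO /= addnC eq_sym; congr (_ + _).
by apply: eq_card => u; rewrite !inE andbA.
Qed.

Lemma dm_gt0 O v : v \in O -> 0 < demand O (key v).
Proof. by move=> vO; rewrite card_gt0; apply/set0Pn; exists v; rewrite !inE vO eqxx. Qed.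

Lemma dm_pos O h : 0 < demand O h -> exists2 v, v \in O & key v = h.
Proof. by rewrite card_gt0 => /set0Pn[v]; rewrite !inE => /andP[vO /eqP]; exists v. Qed.

Lemma dm4 O h k l m : h != k -> h != l -> h != m -> k != l -> k != m -> l != m ->
  demand O h + demand O k + demand O l + demand O m <= #|O|.
Proof.
move=> hk hl hm kl km lm; rewrite -dm_sum.
rewrite (bigD1 h) //= (bigD1 k) 1?eq_sym //= (bigD1 l) /=; last by rewrite ![l == _]eq_sym hl kl.
rewrite (bigD1 m) /=; last by rewrite ![m == _]eq_sym hm km lm.
lia.
Qed.

(** With two hubs left, one vertex is offered to both, then two vertices to the hub that Client
    refused: each hub gains a child and three vertices are spent. With a single hub, a role costs
    two vertices. *)
Lemma good_two O f h1 h2 : (forall v, v \in O -> (key v == h1) || (key v == h2)) ->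
  (forall h, 3 * demand O h <= f) -> good O f.
Proof.
have [m] := ubnP #|O|; elim: m O f => // m IH O f; rewrite ltnS => le k12 b3.
have [->|[v vO]] := set_0Vmem O; first exact: good0.
have cv := cardsD1 v O; rewrite vO in cv.
have [/existsP[w /andP[wO kw]]|] := boolP [exists w, (w \in O) && (key w != key v)]; last first.
  rewrite negb_exists => /forallP same_key.
  have ekey u : u \in O -> key u = key v.
    by move=> uO; have := same_key u; rewrite uO negbK => /eqP.
  have := b3 (key v); have := dm_gt0 vO => d0 dv.
  case: f b3 dv => [|[|f]] b3 dv; try lia.
  apply: (goodT2 vO); apply: IH; first lia.
    by move=> u /setD1P[_ uO]; apply: k12.
  move=> h; have := dm_rem h vO; have := b3 h; case: eqVneq => [->|hn]; first lia.
  suff -> : demand O h = 0 by lia.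
  apply: eq_card0 => u; rewrite !inE; apply/negP => /andP[/ekey -> /eqP e].
  by rewrite e eqxx in hn.
have := b3 (key v); have := dm_gt0 vO => d0 dv.
case: f b3 dv => [|[|[|f]]] b3 dv; try lia.
have P (a b : V) : a \in O -> b \in O -> key a != key b -> good (O :\ a) f.+2.
  move=> aO bO ab.
  have ba : b \in O :\ a by rewrite !inE bO andbT; apply: contra ab => /eqP->.
  have c1 := cardsD1 a O; rewrite aO in c1; have c2 := cardsD1 b (O :\ a); rewrite ba in c2.
  apply: (goodT2 ba); apply: IH; first lia.
    by move=> u /setD1P[_ /setD1P[_ uO]]; apply: k12.
  move=> h; have := dm_rem h aO; have := dm_rem h ba; have := b3 h.
  case: (eqVneq h (key a)) => [->|ha]; case: (eqVneq h (key b)) => [E|hb]; try lia.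
  suff -> : demand O h = 0 by lia.
  apply: eq_card0 => u; rewrite !inE; apply/negP => /andP[uO /eqP hu].
  have := k12 _ aO; have := k12 _ bO; have := k12 _ uO; rewrite hu.
  by move=> /orP[]/eqP E1 /orP[]/eqP E2 /orP[]/eqP E3;
     move: ab ha hb; rewrite E1 E2 E3 ?eqxx.
by apply: (goodT1 wO vO kw); [apply: (P w v)|apply: (P v w) => //; rewrite eq_sym].
Qed.

Definition caps O f := [/\ forall h, 3 * demand O h <= f,
  forall h k, h != k -> 3 * (demand O h + demand O k) + 6 <= 2 * f,
  forall h k l, h != k -> h != l -> k != l -> demand O h + demand O k + demand O l + 8 <= f
  & #|O| + 60 <= f].

(* Waiter always plays on the two currently largest demands; the caps say that
   one, two, three demands never exceed 1/3, 2/3, 1 of the supply [f]. *)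
Lemma caps_good O f : caps O f -> good O f.
Proof.
have [m] := ubnP #|O|; elim: m O f => // m IH O f; rewrite ltnS => le [cap1 cap2 cap3 cap4].
have [->|[v0 v0O]] := set_0Vmem O; first exact: good0.
case: (arg_maxnP (fun h => demand O h) (P := predT) (i0 := key v0)) => // h1 _ max1.
have [/existsP[w /andP[wO kw]]|] := boolP [exists w, (w \in O) && (key w != h1)]; last first.
  rewrite negb_exists => /forallP sk; apply: (@good_two O f h1 h1) => // v vO.
  by have := sk v; rewrite vO /= negbK => ->.
case: (arg_maxnP (fun h => demand O h) (P := fun h => h != h1) (i0 := key w)) => // h2 h21 max2.
have {}max1 h : demand O h <= demand O h1 by apply: max1.
have d2 : 0 < demand O h2 by apply: leq_trans (max2 _ kw); apply: dm_gt0.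
have [v2 v2O k2] := dm_pos d2.
have [v1 v1O k1] : exists2 v, v \in O & key v = h1 by apply: dm_pos; apply: leq_trans d2 (max1 _).
have f4 : 60 <= f by lia.
case: f f4 cap1 cap2 cap3 cap4 => [|[|[|f]]] // _ cap1 cap2 cap3 cap4.
(* [vi] is the role that Client grants in the first offer. Then [vj], of the other hub, is served
   with two vertices, and the losing vertex goes to the two largest remaining demands other than the
   hub it has just lost. *)
have P (vi vj : V) : vi \in O -> vj \in O ->
    ((key vi == h1) && (key vj == h2)) || ((key vi == h2) && (key vj == h1)) ->
    good (O :\ vi) f.+2.
  move=> viO vjO kij.
  have kne : key vi != key vj by case/orP: kij => /andP[/eqP-> /eqP->] //; rewrite eq_sym.
  have ji : vj \in O :\ vi by rewrite !inE vjO andbT; apply: contra kne => /eqP->.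
  set O1 := O :\ vi :\ vj.
  have c1 := cardsD1 vi O; rewrite viO in c1; have c2 := cardsD1 vj (O :\ vi); rewrite ji in c2.
  have D1 h : demand O1 h + (h == h1) + (h == h2) = demand O h.
    have := dm_rem h viO; have := dm_rem h ji; rewrite -/O1.
    by case/orP: kij => /andP[/eqP-> /eqP->]; clear; lia.
  have cap1' h : 3 * demand O1 h <= f.
    have := D1 h; have := cap1 h; have := max1 h2; have := cap2 _ _ h21; have := max2 h.
    case: (eqVneq h h1) => [E|hh1] /=; first by clear; lia.
    by move=> /(_ isT); clear; case: eqVneq => [->|_]; lia.
  (* If there are not two further hubs for the losing vertex, at most two hubs remain and [good_two]
     takes over. *)
  have [/existsP[va0 /andP[va0O kva0]]|] := boolP [exists w, (w \in O1) && (key w != key vj)]; last first.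
    rewrite negb_exists => /forallP sk.
    apply: (goodT2 ji); apply: (@good_two _ f (key vj) (key vj)) => // v vO.
    by have := sk v; rewrite vO /= negbK => ->.
  case: (arg_maxnP (fun h => demand O1 h) (P := fun h => h != key vj) (i0 := key va0)) => // a aj maxa.
  have [va vaO ka] : exists2 v, v \in O1 & key v = a.
    by apply: dm_pos; apply: leq_trans (maxa _ kva0); apply: dm_gt0.
  have [/existsP[vb0 /and3P[vb0O kvb0 kvb0']]|] :=
    boolP [exists w, [&& w \in O1, key w != key vj & key w != a]]; last first.
    rewrite negb_exists => /forallP sk.
    apply: (goodT2 ji); apply: (@good_two _ f (key vj) a) => // v vO.
    by have := sk v; rewrite vO /= -negb_or negbK.
  case: (arg_maxnP (fun h => demand O1 h) (P := fun h => (h != key vj) && (h != a)) (i0 := key vb0)) => //.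
    by rewrite kvb0.
  move=> b /andP[bj ba] maxb.
  have [vb vbO kb] : exists2 v, v \in O1 & key v = b.
    by apply: dm_pos; apply: leq_trans (maxb (key vb0) _); [apply: dm_gt0|rewrite kvb0].
  have fin vt : vt \in O1 -> (key vt == a) || (key vt == b) -> good (O1 :\ vt) f.
    move=> vtO kt; have c3 := cardsD1 vt O1; rewrite vtO in c3.
    apply: IH; first by move: c1 c2 c3 le; rewrite -/O1; clear; lia.
    have cap4' h k l m' : h != k -> h != l -> h != m' -> k != l -> k != m' -> l != m' ->
        demand O h + demand O k + demand O l + demand O m' + 60 <= f.+3.
      by move=> hk hl hm kl km lm; apply: leq_trans cap4; rewrite leq_add2r; apply: dm4.
    have maxb' h : h != key vj -> h != a -> demand O1 h <= demand O1 b.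
      by move=> hj ha; apply: maxb; rewrite hj.
    have [C1 C2 C3] := cap_step cap1 cap2 cap3 cap4' h21 max1 max2 D1
      (fun h => dm_rem h vtO) kij kt aj bj ba maxa maxb'.
    split=> //; move: cap4 c1 c2 c3; rewrite -/O1; clear; lia.
  have vaO' : va \in O by move: vaO; rewrite !inE => /and3P[].
  have vbO' : vb \in O by move: vbO; rewrite !inE => /and3P[].
  apply: (@goodP _ f vj va vb) => //; rewrite -/O1 ?ka ?kb //.
  - by move: vaO; rewrite !inE => /and3P[_ -> ->].
  - by move: vbO; rewrite !inE => /and3P[_ -> ->].
  - by rewrite eq_sym.
  - by apply: fin => //; rewrite ka eqxx.
  - by apply: fin => //; rewrite kb eqxx orbT.
apply: (goodT1 v1O v2O); first by rewrite k1 k2 eq_sym.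
  by apply: (P v1 v2) => //; rewrite k1 k2 !eqxx.
by apply: (P v2 v1) => //; rewrite k1 k2 !eqxx orbT.
Qed.
End Good.

(** * Positions and moves *)

Section Machine.
Variable n : nat.
Variables (V : finType) (r : V) (par : V -> V) (rk : V -> nat).
Hypothesis rkP : forall v, v != r -> rk (par v) < rk v.
Variables H S L Z Src : {set V}.

Definition child (v u : V) := (v != r) && (par v == u).

Lemma kid_neq v u : child v u -> v != u.
Proof. by case/andP=> /rkP + /eqP <-; apply: contraTneq => <-; rewrite ltnn. Qed.

Hypothesis rS : r \in S.
Hypothesis HS : H \subset S.
Hypothesis LS : forall v, v \in L -> v \notin S.
Hypothesis SrcL : forall v, v \in L -> v \notin Src.
Hypothesis LH1 : forall v, v \in L -> #|[set b in H | child b v]| <= 1.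
Hypothesis Ladj : forall v u, v \in L -> child v u -> u \notin L.
Hypothesis Srcleaf : forall y v, y \in Src -> ~~ child v y.
Hypothesis SrcH : forall y, y \in Src -> par y \in H.
Hypothesis SrcS : forall y, y \in Src -> y \notin S.

Implicit Types (P W : {set V}) (f alt : V -> 'I_n) (F : {set 'I_n}) (Rd U : graph n).

Definition hub_losses P f U x := #|[set h in H :&: P | ~~ unclaimed U (f h) x]|.
Definition losses P f U w := #|[set x | (x \notin f @: P) && ~~ unclaimed U (f w) x]|.
Definition placed_kids P W w := #|[set v in P | child v w && (v \notin W)]|.

(* [P]: roles already placed (by [f]); [W]: placed roles whose edge to the parent is
   still pending, [alt] being a second candidate for them; [F]: untouched vertices.
   The 3 in [icl] comes from producing the two candidates for the parent of [w]: two
   losing vertices and the second candidate. *)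
Record Inv P W f alt F Rd U : Prop := MkInv {
  iWP : W \subset P;
  iWL : W \subset L;
  iinj : {in P &, injective f};
  iainj : {in W &, injective alt};
  iaun : forall v, v \in W -> alt v \notin f @: P;
  iF : forall x, x \in F ->
    [/\ x \notin f @: P, x \notin alt @: W & forall u, u != x -> unclaimed U u x];
  ired : forall v, v \in P -> v != r -> par v \in P -> v \notin W -> red_edge Rd (f v) (f (par v));
  iared : forall v b, v \in W -> b \in P -> child b v -> red_edge Rd (alt v) (f b);
  ird : forall a b, red_edge Rd a b -> ~~ unclaimed U a b;
  iuu : forall x y, x \notin f @: P -> y \notin f @: P -> x != y -> unclaimed U x y;
  ihub : forall x, x \notin f @: P -> hub_losses P f U x <= 2;
  iW : forall v u, v \in W -> (forall b, b \in P -> child b v -> u != f b) ->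
    (u != f v -> unclaimed U u (f v)) /\ (u != alt v -> unclaimed U u (alt v));
  icl : forall w, w \in P -> w \notin H ->
    losses P f U w <= placed_kids P W w + 3 * ((w \in S) && ((w == r) || (par w \in P)));
  iSrc : forall y u, y \in Src -> y \in P -> u != f y -> u != f (par y) -> unclaimed U u (f y) }.

Definition updf (T : Type) (f : V -> T) u z := fun v => if v == u then z else f v.

Lemma updf_eq (T : Type) (f : V -> T) u z : updf f u z u = z.
Proof. by rewrite /updf eqxx. Qed.

Lemma updf_neq (T : Type) (f : V -> T) u z v : v != u -> updf f u z v = f v.
Proof. by rewrite /updf => /negPf->. Qed.

Lemma updf_in (T : Type) (f : V -> T) (P : {set V}) u z v : u \notin P -> v \in P -> updf f u z v = f v.
Proof. by move=> uP vP; apply: updf_neq; apply: contraNneq uP => <-. Qed.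

Lemma imset_updf (T : finType) (f : V -> T) P u z : u \notin P -> updf f u z @: (u |: P) = z |: f @: P.
Proof.
move=> uP; rewrite imsetU1 updf_eq; congr (_ |: _).
by apply: eq_in_imset => v vP; apply: (updf_in _ _ uP).
Qed.

(** * Effect of placing a role below its placed parent *)

Section Place.
Variables (P W : {set V}) (f alt : V -> 'I_n) (F : {set 'I_n}) (Rd U : graph n).
Hypothesis I : Inv P W f alt F Rd U.
Variables (u w : V) (z e1 e2 : 'I_n) (Rd' U' : graph n).
Hypotheses (uP : u \notin P) (uw : child u w) (wP : w \in P) (wW : w \notin W).
Hypothesis kidsW : forall v, v \in P -> child v u -> v \in W.
Hypotheses (zP : z \notin f @: P) (zW : z \notin alt @: W).
Hypothesis extra :
  [/\ e1 = f w, e2 \notin f @: P, e2 \notin alt @: W, e2 != z & (w \in H -> hub_losses P f U e2 <= 1)]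
  \/ [/\ w \in H, e1 = z & exists2 h, (h \in H) && (h \in P) & e2 = f h].
Hypothesis uSrc : u \in Src -> e1 = f w /\ forall a, a != z -> unclaimed U a z.
Hypothesis HU : forall a b, unclaimed U' a b = [&& unclaimed U a b, ~~ same a b (f w) z & ~~ same a b e1 e2].
Hypothesis HR : updR Rd (f w) z Rd'.

Let fP v : v \in P -> f v \in f @: P. Proof. exact: imset_f. Qed.
Let neq_fz v : v \in P -> f v != z.
Proof. by move=> vP; apply: contraNneq zP => <-; apply: fP. Qed.
Let neq_img x v : x \notin f @: P -> v \in P -> x != f v.
Proof. by move=> xP vP; apply: contraNneq xP => ->; apply: fP. Qed.
Let finj v v' : v \in P -> v' \in P -> v != v' -> f v != f v'.
Proof. by move=> vP v'P; apply: contraNneq => /(iinj I)->. Qed.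

Let keep a b : b != f w -> b != z -> b != e1 -> b != e2 -> unclaimed U' a b = unclaimed U a b.
Proof.
by rewrite HU /same => /negPf-> /negPf-> /negPf-> /negPf->; rewrite !andbF !andbT.
Qed.

Let keep_un a b : a \notin f @: P -> b \notin f @: P -> a != z -> b != z -> unclaimed U' a b = unclaimed U a b.
Proof.
move=> aP bP az bz; rewrite HU /same (negPf az) (negPf bz) !andbF !orbF /=.
have aw := neq_img aP wP; have bw := neq_img bP wP.
case: extra => [[-> _ _ _ _]|[_ -> [h _ _]]].
  by rewrite (negPf aw) (negPf bw) !andbF !andbT.
by rewrite (negPf az) (negPf bz) !andbF !andbT.
Qed.

Let imgE : updf f u z @: (u |: P) = z |: f @: P.
Proof. exact: imset_updf. Qed.

Let fE v : v \in P -> updf f u z v = f v.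
Proof. exact: updf_in. Qed.

Let keep_out v b : v \in P -> b \notin f @: P -> b != z ->
  unclaimed U (f v) b -> (v != w) || (b != e2) -> unclaimed U' (f v) b.
Proof.
move=> vP bP bz Fvb vw; rewrite HU Fvb /= /same (negPf bz) (negPf (neq_fz vP)) !andbF /=.
have bw := neq_img bP wP.
case: extra => [[-> e2P _ _ _]|[_ -> [h hP ->]]].
  rewrite (negPf bw) !andbF orbF; case/orP: vw => [vw|/negPf->]; last by rewrite andbF.
  by rewrite (negPf (finj vP wP vw)).
by rewrite (negPf (neq_fz vP)) (negPf bz) !andbF.
Qed.

Let special v : v \in P -> v != w -> ((v \in W) || (v \in Src)) -> f v \notin [:: f w; z; e1; e2].
Proof.
move=> vP vw vS; rewrite !inE !negb_or (finj vP wP vw) neq_fz //=.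
case: extra => [[-> e2P _ _ _]|[_ -> [h /andP[hH hP] ->]]].
  by rewrite finj // eq_sym neq_img.
rewrite neq_fz // finj //; case/orP: vS => [vW|vS]; last first.
  by apply: contraNneq (SrcS vS) => ->; apply: (subsetP HS).
by apply: contraTneq hH => <-; apply: contra (LS (subsetP (iWL I) _ vW)); apply: (subsetP HS).
Qed.

Let keep4 a b : b \notin [:: f w; z; e1; e2] -> unclaimed U' a b = unclaimed U a b.
Proof. by rewrite !inE !negb_or => /and4P[? ? ? ?]; apply: keep. Qed.

Lemma place_step : Inv (u |: P) W (updf f u z) alt (F :\ z :\ e2) Rd' U'.
Proof.
have uW : u \notin W by apply: contra uP; apply: (subsetP (iWP I)).
have wu : w != u by apply: contraNneq uP => <-.
have [ur pu] : u != r /\ par u = w by case/andP: uw => -> /eqP.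
have altz v : v \in W -> alt v != z by move=> vW; apply: contraNneq zW => <-; apply: imset_f.
have alt4 v : v \in W -> alt v \notin [:: f w; z; e1; e2].
  move=> vW; rewrite !inE !negb_or altz // (neq_img (iaun I vW) wP) /=.
  case: extra => [[-> _ e2W _ _]|[_ -> [h /andP[hH hP] ->]]].
    by rewrite (neq_img (iaun I vW) wP) /=; apply: contraNneq e2W => <-; apply: imset_f.
  by rewrite altz // (neq_img (iaun I vW) hP).
have wSrc : w \notin Src by apply: contraTN uw => /Srcleaf.
constructor.
- by apply: subset_trans (iWP I) (subsetUr _ _).
- exact: iWL I.
- move=> a b; rewrite !in_setU1 => /orP[/eqP->|aP] /orP[/eqP->|bP] //; rewrite ?updf_eq ?fE //.
  + by move=> E; move: (neq_fz bP); rewrite E eqxx.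
  + by move=> E; move: (neq_fz aP); rewrite E eqxx.
  + exact: (iinj I).
- exact: iainj I.
- by move=> v vW; rewrite imgE in_setU1 negb_or (iaun I vW) altz.
- move=> x; rewrite !inE => /and3P[xe xz xF]; have [xP xW fx] := iF I xF.
  rewrite imgE in_setU1 negb_or xz xP; split=> // a ax.
  have xw := neq_img xP wP.
  rewrite HU fx //= /same (negPf xz) (negPf xw) (negPf xe) !andbF /=.
  case: extra => [[-> _ _ _ _]|[_ -> _]]; first by rewrite (negPf xw) andbF.
  by rewrite (negPf xz) andbF.
- move=> v; rewrite !in_setU1 => /orP[/eqP->|vP] vr pvP vW.
    rewrite updf_eq pu fE //; rewrite rdC; exact: updR_new HR.
  have [E|pvu] := eqVneq (par v) u.
    by rewrite (kidsW vP) // /child vr E eqxx in vW.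
  rewrite (negPf pvu) /= in pvP; rewrite !fE //; apply: (updR_sub HR).
  by apply: (ired I).
- move=> v b vW; rewrite in_setU1 => /orP[/eqP->|bP] kb.
    by case/andP: kb => _; rewrite pu => /eqP E; move: wW; rewrite E vW.
  by rewrite fE //; apply: (updR_sub HR); apply: (iared I vW bP kb).
- move=> a b; rewrite HR => /orP[/(ird I) nf|s]; first by rewrite HU (negPf nf).
  by rewrite HU s andbF.
- move=> a b; rewrite imgE !in_setU1 !negb_or => /andP[az aP] /andP[bz bP] ab.
  by rewrite keep_un //; apply: (iuu I).
- move=> x; rewrite imgE in_setU1 negb_or => /andP[xz xP].
  have zx : unclaimed U' z x.
    rewrite HU (iuu I) 1?eq_sym //= /same (negPf xz) (negPf (neq_img xP wP)) !andbF /=.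
    have zw : z != f w by rewrite eq_sym neq_fz.
    case: extra => [[-> _ _ _ _]|[_ -> [h /andP[hH hP] ->]]].
      by rewrite (negPf zw) (negPf (neq_img xP wP)) andbF.
    by rewrite (negPf (neq_img xP hP)) (negPf xz) !andbF.
  have sub (Y : {set V}) : (forall h, h \in H -> h \in P -> ~~ unclaimed U' (f h) x -> h \in Y) ->
      hub_losses (u |: P) (updf f u z) U' x <= #|Y|.
    move=> HY; apply: subset_leq_card; apply/subsetP=> h.
    rewrite !inE => /andP[/andP[hH /orP[/eqP->|hP]]]; first by rewrite updf_eq zx.
    by rewrite fE //; apply: HY.
  (* Only the vertex just refused by a hub has a new hub loss; [extra] grants that it had at most
     one before. *)
  have [ex|exn] := boolP ((w \in H) && (x == e2)).
    case/andP: ex => wH /eqP xe.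
    case: extra => [[_ _ _ _ /(_ wH) le1]|[_ _ [h /andP[_ hP] eh]]]; last first.
      by move: xP; rewrite xe eh fP.
    apply: leq_trans (sub (w |: [set h in H :&: P | ~~ unclaimed U (f h) x]) _) _; last first.
      by rewrite cardsU1 xe; apply: (@leq_add _ _ 1 1 (leq_b1 _) le1).
    move=> h hH hP nf; rewrite !inE hH hP /=; have [//|hw] /= := eqVneq h w.
    by apply: contra nf => Fh; apply: keep_out => //; rewrite hw.
  apply: leq_trans (ihub I xP); apply: sub => h hH hP nf; rewrite !inE hH hP /=.
  apply: contra nf => Fh; apply: keep_out => //.
  by move: exn; rewrite negb_and; have [<-|] := eqVneq h w; rewrite // hH.
- move=> v a vW ab.
  have vP := subsetP (iWP I) _ vW.
  have vw : v != w by apply: contraTneq vW => ->.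
  have [] := iW I (u := a) vW.
    by move=> b bP kb; have := ab b; rewrite in_setU1 bP orbT fE // => /(_ isT kb).
  rewrite fE // => i1 i2; split=> [/i1|/i2].
    by rewrite keep4 //; apply: special => //; rewrite vW.
  by rewrite keep4 //; apply: alt4.
- move=> v; rewrite in_setU1 => /orP[/eqP->|vP] vH.
    rewrite /losses imgE updf_eq; rewrite (_ : [set x | _] = set0) ?cards0 //.
    apply/setP=> x; rewrite !inE negb_or; apply/negP => /andP[/andP[xz xP]] /negP[].
    rewrite HU (iuu I) 1?eq_sym //= /same (negPf xz) (negPf (neq_img xP wP)) !andbF /=.
    have zw : z != f w by rewrite eq_sym neq_fz.
    case: extra => [[-> _ _ _ _]|[_ -> [h /andP[hH hP] ->]]].
      by rewrite (negPf zw) (negPf (neq_img xP wP)) andbF.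
    by rewrite (negPf (neq_img xP hP)) (negPf xz) !andbF.
  have al : 3 * ((v \in S) && ((v == r) || (par v \in P))) <= 3 * ((v \in S) && ((v == r) || (par v \in u |: P))).
    rewrite leq_pmul2l //; case: (v \in S) => //=; case: (v == r) => //=.
    by rewrite in_setU1; case: (par v \in P); rewrite ?orbT.
  have := icl I vP vH; rewrite /losses /placed_kids imgE fE //.
  set A := [set x | _]; set B := [set a in P | _]; set A' := [set x | _]; set B' := [set a in _ | _].
  have BB' : B \subset B'.
    by apply/subsetP=> a; rewrite !inE => /and3P[-> -> ->]; rewrite orbT.
  move=> le; have [vw|vw] := eqVneq v w.
    have A'A : A' \subset e2 |: A.
      apply/subsetP=> x; rewrite !inE negb_or => /andP[/andP[xz xP] nf]; rewrite xP /=.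
      have [//|xe] /= := eqVneq x e2; apply: contra nf => Fx.
      by apply: keep_out => //; rewrite xe orbT.
    have uB : u |: B \subset B'.
      by rewrite subUset BB' andbT sub1set !inE eqxx uW vw uw.
    have := subset_leq_card A'A; have := subset_leq_card uB; rewrite !cardsU1.
    have -> : u \notin B by rewrite inE (negPf uP).
    move: le al; case: (e2 \notin A) => /=; clear; lia.
  have A'A : A' \subset A.
    apply/subsetP=> x; rewrite !inE negb_or => /andP[/andP[xz xP] nf]; rewrite xP /=.
    by apply: contra nf => Fx; apply: keep_out => //; rewrite vw.
  have := subset_leq_card A'A; have := subset_leq_card BB'; move: le al; clear; lia.
- move=> y a yS; rewrite in_setU1 => /orP[/eqP E|yP].
    subst y; rewrite updf_eq pu fE // => az aw; have [ew fa] := uSrc yS.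
    have zw : z != f w by rewrite eq_sym neq_fz.
    case: extra => [[_ e2P _ e2z _]|[_ e1z _]]; last by move: zw; rewrite -ew e1z eqxx.
    rewrite HU fa //= /same ew (negPf aw) (negPf az) (negPf zw) ?andbF ?andbT /=.
    by rewrite ?andbF ?orbF ?andbT.
  have yw : y != w by apply: contraNneq wSrc => <-.
  have pyu : par y != u \/ par y = u by case: eqVneq; [right|left].
  rewrite fE // keep4 => [ay aw|]; last by apply: special => //; rewrite yS orbT.
  case: pyu => pyu; first by apply: (iSrc I) => //; rewrite /updf (negPf pyu) in aw.
  have yr : y != r \/ y = r by case: eqVneq; [right|left].
  case: yr => yr; last by have := SrcS yS; rewrite yr rS.
  by have := kidsW yP; rewrite /child yr pyu eqxx => /(_ isT) yW; have := SrcL (subsetP (iWL I) _ yW); rewrite yS.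
Qed.
End Place.

(** * Effect of settling a pending parent edge *)

Section Link.
Variables (P W : {set V}) (f alt : V -> 'I_n) (F : {set 'I_n}) (Rd U : graph n).
Hypothesis I : Inv P W f alt F Rd U.
Variables (v g : V) (c d : 'I_n) (Rd' U' : graph n).
Hypotheses (vW : v \in W) (vg : child v g) (gP : g \in P) (gW : g \notin W).
Hypothesis cd : (c = f v /\ d = alt v) \/ (c = alt v /\ d = f v).
Hypothesis HU : upd U (f g) c d U'.
Hypothesis HR : updR Rd (f g) c Rd'.

Let vP : v \in P. Proof. exact: (subsetP (iWP I)). Qed.
Let vL : v \in L. Proof. exact: (subsetP (iWL I)). Qed.
Let vH : v \notin H. Proof. by apply: contra (LS vL); apply: (subsetP HS). Qed.
Let A0 := f @: (P :\ v).
Let A0f u : u \in P -> u != v -> f u \in A0.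
Proof. by move=> uP uv; apply: imset_f; rewrite !inE uv. Qed.
Let fP : f @: P = f v |: A0.
Proof. by rewrite /A0 -imsetU1 setD1K. Qed.
Let fvA0 : f v \notin A0.
Proof.
by apply/imsetP => -[u /setD1P[uv uP] /(iinj I) E]; rewrite E ?eqxx // in uv.
Qed.
Let avA0 : alt v \notin A0.
Proof. by have := iaun I vW; rewrite fP in_setU1 negb_or => /andP[]. Qed.
Let avf : alt v != f v.
Proof. by have := iaun I vW; rewrite fP in_setU1 negb_or => /andP[]. Qed.
Let f'P : updf f v c @: P = c |: A0.
Proof. by rewrite -{1}(setD1K vP) imset_updf // !inE eqxx. Qed.
Let cA0 : c \notin A0. Proof. by case: cd => -[-> _]. Qed.
Let dA0 : d \notin A0. Proof. by case: cd => -[_ ->]. Qed.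
Let gv : g != v. Proof. by rewrite eq_sym kid_neq. Qed.
Let fgA : f g \in A0. Proof. exact: A0f. Qed.
Let free u e : e \in [:: c; d] -> (forall b, b \in P -> child b v -> u != f b) -> u != e -> unclaimed U u e.
Proof.
move=> ecd /(iW I vW)[i1 i2]; move: ecd; rewrite !inE => /orP[]/eqP->;
  by case: cd => -[E1 E2]; rewrite ?E1 ?E2.
Qed.
Let unusedb x : x \notin A0 -> forall b, b \in P -> child b v -> x != f b.
Proof. by move=> xA b bP kb; apply: contraNneq xA => ->; apply: A0f => //; apply: kid_neq. Qed.
Let fE u : u != v -> updf f v c u = f u. Proof. exact: updf_neq. Qed.
Let usedP x : x \notin c |: A0 -> x != d -> x \notin f @: P.
Proof.
rewrite fP !in_setU1 !negb_or => /andP[xc ->] xd; rewrite andbT.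
by case: cd => -[E1 E2]; [rewrite -E1|rewrite -E2].
Qed.
Let fgx x : x \notin A0 -> x != f g. Proof. by apply: contraNneq => ->. Qed.
Let finj u u' : u \in P -> u' \in P -> u != u' -> f u != f u'.
Proof. by move=> uP u'P; apply: contraNneq => /(iinj I)->. Qed.

Lemma link_step : Inv P (W :\ v) (updf f v c) alt F Rd' U'.
Proof.
have SubW u : u \in W :\ v -> u != v /\ u \in W by case/setD1P.
constructor.
- by apply: subset_trans (iWP I); apply: subD1set.
- by apply: subset_trans (iWL I); apply: subD1set.
- move=> a b aP bP; have [->|av] := eqVneq a v; have [->|bv] := eqVneq b v; rewrite ?updf_eq ?fE //.
  + by move=> E; move: cA0; rewrite E A0f.
  + by move=> E; move: cA0; rewrite -E A0f.
  + exact: (iinj I).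
- by move=> a b /SubW[_ aW] /SubW[_ bW]; apply: (iainj I).
- move=> u /SubW[uv uW]; rewrite f'P in_setU1 negb_or.
  have := iaun I uW; rewrite fP in_setU1 negb_or => /andP[auf ->]; rewrite andbT.
  case: cd => -[-> _] //; apply: contra uv => /eqP; by move/(iainj I) => ->.
- move=> x xF; have [xP xW fx] := iF I xF.
  move: (xP); rewrite fP in_setU1 negb_or => /andP[xfv xA].
  have xa : x != alt v by apply: contraNneq xW => ->; apply: imset_f.
  have xc : x != c by case: cd => -[-> _].
  have xd : x != d by case: cd => -[_ ->].
  split; first by rewrite f'P in_setU1 negb_or xc.
    by apply: contra xW; apply: subsetP; apply: imsetS; apply: subD1set.
  by move=> u ux; rewrite (upd_n HU) ?fx // fgx.
- move=> u uP ur puP uW; have [E|uv] := eqVneq u v.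
    subst u; rewrite updf_eq; case/andP: vg => _ /eqP->; rewrite fE // rdC; exact: updR_new HR.
  have {}uW : u \notin W by apply: contra uW; rewrite !inE uv.
  apply: (updR_sub HR); rewrite fE //.
  have [pv|pv] := eqVneq (par u) v; last by rewrite fE //; apply: (ired I).
  rewrite pv updf_eq; case: cd => -[-> _]; first by rewrite -pv; apply: (ired I).
  by rewrite rdC; apply: (iared I) => //; rewrite /child ur pv eqxx.
- move=> u b /SubW[uv uW] bP kb; apply: (updR_sub HR); rewrite fE; first exact: (iared I).
  by apply: contraTneq (subsetP (iWL I) _ uW) => bv; apply: (Ladj (v := b)); rewrite // bv.
- move=> a b; rewrite HR HU => /orP[/(ird I) nf|->]; first by rewrite (negPf nf).
  by rewrite andbF.
- move=> x y; rewrite f'P => xA yA xy.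
  have := xA; rewrite in_setU1 negb_or => /andP[xc xA0].
  have := yA; rewrite in_setU1 negb_or => /andP[yc yA0].
  rewrite (upd_np HU) ?fgx //.
  have [xd|xd] := eqVneq x d.
    by rewrite frC xd; apply: free; rewrite ?inE ?eqxx ?orbT // -?xd 1?eq_sym //; apply: unusedb.
  have [yd|yd] := eqVneq y d.
    by rewrite yd; apply: free; rewrite ?inE ?eqxx ?orbT //; apply: unusedb.
  by apply: (iuu I) => //; apply: usedP.
- move=> x; rewrite f'P => xA.
  have := xA; rewrite in_setU1 negb_or => /andP[xc xA0].
  have hv h : h \in H -> h != v by move=> hH; apply: contraNneq vH => <-.
  have [xd|xd] := eqVneq x d; last first.
    apply: leq_trans (ihub I (usedP xA xd)); apply: subset_leq_card; apply/subsetP=> h.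
    rewrite !inE => /andP[/andP[hH hP]]; rewrite hH hP fE ?hv //=.
    by rewrite (upd_n HU) ?fgx.
  (* The refused candidate can have lost only [g] and the children of [v], at most one of which is a
     hub. *)
  have : #|g |: [set b in H | child b v]| <= 2.
    by rewrite cardsU1; apply: (@leq_add _ _ 1 1 (leq_b1 _)); apply: LH1.
  apply: leq_trans; apply: subset_leq_card; apply/subsetP=> h.
  rewrite !inE => /andP[/andP[hH hP]]; rewrite hH fE ?hv //= => nf.
  have [//|hg] /= := eqVneq h g; apply: contraR nf => nk.
  rewrite (upd_np HU); [|exact: finj|exact: fgx].
  rewrite xd; apply: free; rewrite ?inE ?eqxx ?orbT //.
    by move=> b bP kb; apply: finj => //; apply: contraNneq nk => ->.
  by apply: contraNneq dA0 => <-; apply: A0f => //; apply: hv.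
- move=> u a /SubW[uv uW] ab.
  have uL := subsetP (iWL I) _ uW; have uP := subsetP (iWP I) _ uW.
  have {}ab b : b \in P -> child b u -> a != f b.
    move=> bP kb; have := ab b bP kb; rewrite fE //.
    by apply: contraTneq uL => bv; apply: (Ladj (v := b)); rewrite // bv.
  have [{}i1 {}i2] := iW I uW ab.
  rewrite fE //; split=> ne; [rewrite (upd_n HU) ?i1 //|rewrite (upd_n HU) ?i2 //].
  + by apply: finj => //; apply: contraNneq gW => <-.
  + case: cd => -[-> _]; first exact: finj.
    by rewrite eq_sym; apply: contraNneq (iaun I vW) => ->; apply: imset_f.
  + case: cd => -[_ ->]; last exact: finj.
    by rewrite eq_sym; apply: contraNneq (iaun I vW) => ->; apply: imset_f.
  + by apply: contraNneq (iaun I uW) => ->; apply: imset_f.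
  + case: cd => -[-> _]; first by apply: contraNneq (iaun I uW) => ->; apply: imset_f.
    by apply: contra uv => /eqP /(iainj I) ->.
  + case: cd => -[_ ->]; last by apply: contraNneq (iaun I uW) => ->; apply: imset_f.
    by apply: contra uv => /eqP /(iainj I) ->.
- move=> w wP wH; have [E|wv] := eqVneq w v.
    subst w; rewrite /losses f'P updf_eq (_ : [set x | _] = set0) ?cards0 //.
    apply/setP=> x; rewrite !inE negb_or; apply/negP => /andP[/andP[xc xA]] /negP[].
    rewrite (upd_np HU) ?fgx //.
    by rewrite frC; apply: free; rewrite ?inE ?eqxx //; apply: unusedb.
  have := icl I wP wH; rewrite /losses /placed_kids f'P fE //.
  set A := [set x | _]; set B := [set a in P | _]; set A' := [set x | _]; set B' := [set a in _ | _].
  have BB' : B \subset B'.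
    by apply/subsetP=> a; rewrite !inE => /and3P[-> -> aW]; rewrite negb_and aW orbT.
  have A'A : A' \subset d |: A.
    apply/subsetP=> x; rewrite !inE => /andP[xA nf].
    have [//|xd] /= := eqVneq x d.
    rewrite usedP ?in_setU1 //=; move: xA; rewrite negb_or => /andP[xc xA].
    by rewrite (upd_n HU) ?fgx // in nf.
  have cB := subset_leq_card BB'; have cA := subset_leq_card A'A.
  have [wg|wg] := eqVneq w g.
    have vB : v |: B \subset B' by rewrite subUset BB' andbT sub1set !inE eqxx vP wg vg.
    move: cA (subset_leq_card vB); rewrite !cardsU1.
    have -> : v \notin B by rewrite inE vW !andbF.
    by case: (d \notin A) => /=; clear; lia.
  suff : #|A'| <= #|A| by move: cB; clear; lia.
  have keepd : unclaimed U' (f w) d = unclaimed U (f w) d by apply: (upd_np HU); [exact: finj|exact: fgx].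
  have [kw|nk] := boolP (child w v); last first.
    apply: subset_leq_card; apply/subsetP=> x xA'.
    have := subsetP A'A _ xA'; rewrite in_setU1 => /orP[/eqP xd|//].
    move: xA'; rewrite inE xd keepd => /andP[_ /negP[]].
    apply: free; rewrite ?inE ?eqxx ?orbT //.
      by move=> b bP kb; apply: finj => //; apply: contraNneq nk => ->.
    by apply: contraNneq dA0 => <-; apply: A0f.
  case: (cd) => -[Ec Ed].
    apply: subset_leq_card; apply/subsetP=> x xA'.
    have := subsetP A'A _ xA'; rewrite in_setU1 => /orP[/eqP xd|//].
    by move: xA'; rewrite !inE xd keepd => /andP[_ ->]; rewrite Ed (iaun I vW).
  have cAin : c \in A.
    by rewrite inE Ec (iaun I vW) /= frC; apply: (ird I); apply: (iared I).
  have A'c : A' \subset d |: (A :\ c).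
    apply/subsetP=> x xA'; have := subsetP A'A _ xA'; rewrite !in_setU1 => /orP[->//|xA].
    rewrite in_setD1 xA andbT; move: xA'; rewrite inE => /andP[].
    by rewrite in_setU1 negb_or => /andP[-> _]; rewrite orbT.
  move: (subset_leq_card A'c); rewrite (cardsD1 c A) cAin cardsU1.
  by case: (d \notin _) => /=; clear; lia.
- move=> y a yS yP.
  have yv : y != v by apply: contraTneq yS => ->; apply: SrcL.
  have pv : par y != v by apply: contraNneq vH => <-; apply: SrcH.
  rewrite !fE // => ay ap; rewrite (upd_n HU); first exact: (iSrc I).
  + by apply: finj => //; apply: contraTneq vg => <-; apply: Srcleaf.
  + case: cd => -[-> _]; first exact: finj.
    by rewrite eq_sym; apply: contraNneq (iaun I vW) => ->; apply: imset_f.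
  + case: cd => -[_ ->]; last exact: finj.
    by rewrite eq_sym; apply: contraNneq (iaun I vW) => ->; apply: imset_f.
Qed.
End Link.

(** * Effect of producing two candidates for a link *)

Section Cand.
Variables (P W : {set V}) (f alt : V -> 'I_n) (F : {set 'I_n}) (Rd U : graph n).
Hypothesis I : Inv P W f alt F Rd U.
Variables (v b : V) (z1 w1 z2 w2 : 'I_n) (Rd' U' : graph n).
Hypotheses (vL : v \in L) (vP : v \notin P) (bP : b \in P) (bS : b \in S) (bv : child b v).
Hypothesis bu : forall b', b' \in P -> child b' v -> b' = b.
Hypotheses (z1F : z1 \in F) (w1F : w1 \in F) (z2F : z2 \in F) (w2F : w2 \in F) (z12 : z1 != z2).
Hypothesis HU : forall x y, unclaimed U' x y =
  [&& unclaimed U x y, ~~ same x y (f b) z1, ~~ same x y (f b) w1, ~~ same x y (f b) z2 & ~~ same x y (f b) w2].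
Hypothesis HR : forall x y, red_edge Rd' x y = [|| red_edge Rd x y, same x y (f b) z1 | same x y (f b) z2].

Let bW : b \notin W.
Proof. by apply: contraL bS => bW; apply: LS; apply: (subsetP (iWL I)). Qed.
Let vH : v \notin H. Proof. by apply: contra (LS vL); apply: (subsetP HS). Qed.
Let qF q : q \in [:: z1; w1; z2; w2] -> q \in F.
Proof. by rewrite !inE => /or4P[]/eqP->. Qed.
Let np x y : x != f b -> y != f b -> unclaimed U' x y = unclaimed U x y.
Proof. by move=> /negPf xb /negPf yb; rewrite HU /same xb yb !andbF !andbT. Qed.
Let nq x y : y != f b -> y \notin [:: z1; w1; z2; w2] -> unclaimed U' x y = unclaimed U x y.
Proof.
rewrite !inE !negb_or => /negPf yb /and4P[/negPf y1 /negPf y2 /negPf y3 /negPf y4].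
by rewrite HU /same yb y1 y2 y3 y4 !andbF !andbT.
Qed.
Let Fun q : q \in F -> q \notin f @: P. Proof. by case/(iF I). Qed.
Let Ffr q x : q \in F -> x != q -> unclaimed U x q. Proof. by case/(iF I) => _ _; apply. Qed.
Let Falt q : q \in F -> q \notin alt @: W. Proof. by case/(iF I). Qed.
Let un_img x u : x \notin f @: P -> u \in P -> x != f u.
Proof. by move=> xP uP; apply: contraNneq xP => ->; apply: imset_f. Qed.
Let img_q u : u \in P -> f u \notin [:: z1; w1; z2; w2].
Proof. by move=> uP; apply/negP => /qF /Fun; rewrite imset_f. Qed.
Let alt_q u : u \in W -> alt u \notin [:: z1; w1; z2; w2].
Proof. by move=> uP; apply/negP => /qF /Falt; rewrite imset_f. Qed.
Let fE u : u \in P -> updf f v z1 u = f u. Proof. exact: updf_in. Qed.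
Let vWn : v \notin W. Proof. by apply: contra vP; apply: (subsetP (iWP I)). Qed.
Let aE u : u \in W -> updf alt v z2 u = alt u. Proof. exact: updf_in. Qed.
Let fim : updf f v z1 @: (v |: P) = z1 |: f @: P. Proof. exact: imset_updf. Qed.
Let aim : updf alt v z2 @: (v |: W) = z2 |: alt @: W. Proof. exact: imset_updf. Qed.
Let finj u u' : u \in P -> u' \in P -> u != u' -> f u != f u'.
Proof. by move=> uP u'P; apply: contraNneq => /(iinj I)->. Qed.

Lemma cand_step : Inv (v |: P) (v |: W) (updf f v z1) (updf alt v z2)
  (F :\ z1 :\ w1 :\ z2 :\ w2) Rd' U'.
Proof.
have sub x y : red_edge Rd x y -> red_edge Rd' x y by rewrite HR => ->.
have nk u : u \in W -> ~~ child v u.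
  by move=> /(subsetP (iWL I)) uL; apply/negP => /(Ladj vL); rewrite uL.
constructor.
- by apply: setUS; apply: (iWP I).
- by rewrite subUset sub1set vL (iWL I).
- move=> x y; rewrite !in_setU1 => /orP[/eqP->|xP] /orP[/eqP->|yP] //; rewrite ?updf_eq ?fE //.
  + by move=> E; move: (un_img (Fun z1F) yP); rewrite E eqxx.
  + by move=> E; move: (un_img (Fun z1F) xP); rewrite E eqxx.
  + exact: (iinj I).
- move=> x y; rewrite !in_setU1 => /orP[/eqP->|xP] /orP[/eqP->|yP] //; rewrite ?updf_eq ?aE //.
  + by move=> E; move: (Falt z2F); rewrite E imset_f.
  + by move=> E; move: (Falt z2F); rewrite -E imset_f.
  + exact: (iainj I).
- move=> u; rewrite fim !in_setU1 => /orP[/eqP->|uW].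
    by rewrite updf_eq negb_or eq_sym z12 Fun.
  rewrite aE // negb_or (iaun I uW) andbT.
  by have := alt_q uW; rewrite !inE !negb_or => /and4P[].
- move=> x; rewrite !in_setD1 => /and5P[x1 x2 x3 x4 xF].
  have [xP xW fx] := iF I xF; rewrite fim aim !in_setU1 !negb_or x4 x2 xP xW; split=> // u ux.
  by rewrite nq ?fx ?(un_img xP bP) // !inE !negb_or x1 x2 x3 x4.
- move=> u; rewrite !in_setU1 => /orP[/eqP->|uP] ur; first by rewrite eqxx.
  case/orP=> [/eqP pu|puP]; rewrite negb_or => /andP[uv uW].
    rewrite (bu uP) ?/child ?ur ?pu ?eqxx //.
    have -> : par b = v by case/andP: bv => _ /eqP.
    by rewrite updf_eq fE // HR /same !eqxx /= orbT.
  by rewrite !fE //; apply: sub; apply: (ired I).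
- move=> u b'; rewrite !in_setU1 => /orP[/eqP->|uW] /orP[/eqP->|b'P] kb'.
  + by have := kid_neq kb'; rewrite eqxx.
  + by rewrite (bu b'P kb') updf_eq fE // HR /same !eqxx !orbT.
  + by rewrite (negPf (nk _ uW)) in kb'.
  + by rewrite aE // fE //; apply: sub; apply: (iared I).
- move=> x y; rewrite HR HU => /or3P[/(ird I)/negPf->|->|->] //; by rewrite ?andbF.
- move=> x y; rewrite fim !in_setU1 !negb_or => /andP[x1 xP] /andP[y1 yP] xy.
  by rewrite np ?(un_img xP bP) ?(un_img yP bP) //; apply: (iuu I).
- move=> x; rewrite fim in_setU1 negb_or => /andP[x1 xP].
  have [xq|xq] := boolP (x \in [:: z1; w1; z2; w2]); last first.
    apply: leq_trans (ihub I xP); apply: subset_leq_card; apply/subsetP=> h.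
    rewrite !inE => /andP[/andP[hH /orP[/eqP hv|hP]]]; first by move: vH; rewrite -hv hH.
    by rewrite hH hP fE //= nq // un_img.
  apply: (@leq_trans #|[set b]|); last by rewrite cards1.
  apply: subset_leq_card; apply/subsetP=> h.
  rewrite !inE => /andP[/andP[hH /orP[/eqP hv|hP]]]; first by move: vH; rewrite -hv hH.
  rewrite fE //; apply: contraR => hb; rewrite np ?(un_img xP) ?finj // Ffr ?qF //.
  by rewrite eq_sym un_img.
- move=> u a; rewrite in_setU1 => /orP[/eqP->|uW] ab.
    have ab' : a != f b by rewrite -(fE bP); apply: ab => //; rewrite in_setU1 bP orbT.
    rewrite !updf_eq; split=> nz; rewrite np ?Ffr //; apply: un_img; rewrite ?Fun //.
  have uP := subsetP (iWP I) _ uW.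
  have [|i1 i2] := iW I uW (u := a).
    by move=> b' b'P kb'; rewrite -fE //; apply: ab => //; rewrite in_setU1 b'P orbT.
  have ub : u != b by apply: contraNneq bW => <-.
  rewrite fE // aE //; split=> ne; [rewrite nq ?i1 //|rewrite nq ?i2 //].
  + exact: finj.
  + exact: img_q.
  + by apply: un_img => //; apply: (iaun I).
  + exact: alt_q.
- move=> w; rewrite in_setU1 => /orP[/eqP->|wP] wH.
    rewrite /losses fim updf_eq (_ : [set x | _] = set0) ?cards0 //.
    apply/setP=> x; rewrite !inE negb_or; apply/negP => /andP[/andP[xz xP]] /negP[].
    by rewrite np ?(un_img xP bP) ?(un_img (Fun z1F) bP) // frC Ffr.
  have := icl I wP wH; rewrite /losses /placed_kids fim fE //.
  set A := [set x | _]; set B := [set a in P | _]; set A' := [set x | _]; set B' := [set a in _ | _].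
  have BB' : B \subset B'.
    apply/subsetP=> a; rewrite !inE => /and3P[aP -> aW]; rewrite aP orbT /= negb_or aW andbT.
    by apply: contraNneq vP => <-.
  have cB := subset_leq_card BB'.
  have [wb|wb] := eqVneq w b.
    have A'A : A' \subset w1 |: (z2 |: (w2 |: A)).
      apply/subsetP=> x; rewrite !inE negb_or => /andP[/andP[xz xP] nf]; rewrite xP /=.
      have [//|n1] := eqVneq x w1; have [//|n2] := eqVneq x z2; have [//|n3] := eqVneq x w2.
      by rewrite nq ?(un_img xP bP) // in nf; rewrite !inE !negb_or xz n1 n2 n3.
    have -> : (w == r) = false by rewrite wb; case/andP: bv => /negPf.
    have -> : par w = v by rewrite wb; case/andP: bv => _ /eqP.
    rewrite (negPf vP) wb bS in_setU1 eqxx /=.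
    move: (subset_leq_card A'A) cB; rewrite !cardsU1.
    by do 3!case: (_ \notin _) => /=; clear; lia.
  have A'A : A' \subset A.
    apply/subsetP=> x; rewrite !inE negb_or => /andP[/andP[xz xP] nf]; rewrite xP /=.
    by rewrite np ?(un_img xP bP) ?finj // in nf.
  have al : 3 * ((w \in S) && ((w == r) || (par w \in P))) <= 3 * ((w \in S) && ((w == r) || (par w \in v |: P))).
    rewrite leq_pmul2l //; case: (w \in S) => //=; case: (w == r) => //=.
    by rewrite in_setU1; case: (par w \in P); rewrite ?orbT.
  by move: (subset_leq_card A'A) cB al; clear; lia.
- move=> y a yS; rewrite in_setU1 => /orP[/eqP yv|yP]; first by move: (SrcL vL); rewrite -yv yS.
  have pv : par y != v by apply: contraNneq vH => <-; apply: SrcH.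
  rewrite fE // (updf_neq _ _ pv) => ay ap; rewrite nq ?img_q //; first exact: (iSrc I).
  by apply: finj => //; apply: contraNneq (SrcS yS) => ->.
Qed.
End Cand.
End Machine.

Lemma cardsD1_ge (T : finType) (A : {set T}) x : #|A| <= #|A :\ x| + 1.
Proof. by rewrite (cardsD1 x) addnC leq_add2l leq_b1. Qed.

Lemma cardsD2_ge (T : finType) (A : {set T}) x y : #|A| <= #|A :\ x :\ y| + 2.
Proof.
apply: leq_trans (cardsD1_ge A x) _; rewrite -[2]/(1 + 1) addnA leq_add2r.
exact: cardsD1_ge.
Qed.

Lemma cardsD4_ge (T : finType) (A : {set T}) x y z w : #|A| <= #|A :\ x :\ y :\ z :\ w| + 4.
Proof.
apply: leq_trans (cardsD2_ge A x y) _; rewrite -[4]/(2 + 2) addnA leq_add2r.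
exact: cardsD2_ge.
Qed.

(** * The moves as rounds of the game *)

Section Steps.
Variable n : nat.
Variables (V : finType) (r : V) (par : V -> V) (rk : V -> nat).
Hypothesis rkP : forall v, v != r -> rk (par v) < rk v.
Variables H S L Src : {set V}.
Notation kid := (child r par).
Hypothesis rS : r \in S.
Hypothesis HS : H \subset S.
Hypothesis LS : forall v, v \in L -> v \notin S.
Hypothesis SrcL : forall v, v \in L -> v \notin Src.
Hypothesis LH1 : forall v, v \in L -> #|[set b in H | kid b v]| <= 1.
Hypothesis Ladj : forall v u, v \in L -> kid v u -> u \notin L.
Hypothesis Srcleaf : forall y v, y \in Src -> ~~ kid v y.
Hypothesis SrcH : forall y, y \in Src -> par y \in H.
Hypothesis SrcS : forall y, y \in Src -> y \notin S.

Implicit Types (P W : {set V}) (f alt : V -> 'I_n) (F : {set 'I_n}) (Rd U : graph n).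

Local Notation Inv := (@Inv n V r par H S L Src).

Lemma Inv_subF P W f alt F F' Rd U : F' \subset F -> Inv P W f alt F Rd U -> Inv P W f alt F' Rd U.
Proof. by move=> FF' [? ? ? ? ? iF ? ? ? ? ? ? ? ?]; split=> // x /(subsetP FF') /iF. Qed.

Definition St P W F Rd U := exists f alt, Inv P W f alt F Rd U.

Lemma St_subF P W F F' Rd U : F' \subset F -> St P W F Rd U -> St P W F' Rd U.
Proof. by move=> FF' [f [alt I]]; exists f, alt; apply: Inv_subF I. Qed.

Lemma force_T2 t G P W f alt F Rd U u w x y : Inv P W f alt F Rd U ->
  u \notin P -> kid u w -> w \in P -> w \notin W -> (forall v, v \in P -> kid v u -> v \in W) ->
  x \notin f @: P -> x \notin alt @: W -> y \notin f @: P -> y \notin alt @: W -> x != y ->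
  unclaimed U (f w) x -> unclaimed U (f w) y ->
  (w \in H -> (hub_losses H P f U x <= 1) && (hub_losses H P f U y <= 1)) ->
  (u \in Src -> forall a, (a != x -> unclaimed U a x) /\ (a != y -> unclaimed U a y)) ->
  (forall z q Rd' U', (z = x /\ q = y) \/ (z = y /\ q = x) -> upd U (f w) z q U' ->
     Inv (u |: P) W (updf f u z) alt (F :\ z :\ q) Rd' U' -> force t G Rd' U') ->
  force t.+1 G Rd U.
Proof.
move=> I uP uw wP wW kW xP xW yP yW xy fx fy hub src K.
apply: (force_offer fx fy xy) => z q Rd' U' zq HU HR.
apply: (K z q) => //.
have [zP zW qP qW] : [/\ z \notin f @: P, z \notin alt @: W, q \notin f @: P & q \notin alt @: W].
  by case: zq => -[-> ->].
apply: (place_step rS HS LS SrcL Srcleaf SrcS I uP uw wP wW kW zP zW _ _ HU HR).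
  left; split=> //; first by case: zq => -[-> ->] //; rewrite eq_sym.
  by move=> /hub/andP[h1 h2]; case: zq => -[_ ->].
by move=> uS; split=> // a az; have [s1 s2] := src uS a; case: zq az => -[-> _].
Qed.

Lemma force_T1 t G P W f alt F Rd U u1 u2 y : Inv P W f alt F Rd U ->
  u1 \notin P -> u2 \notin P -> u1 \notin Src -> u2 \notin Src ->
  par u1 \in H -> par u2 \in H -> par u1 \in P -> par u2 \in P -> u1 != r -> u2 != r ->
  par u1 != par u2 ->
  (forall v, v \in P -> kid v u1 || kid v u2 -> v \in W) ->
  y \notin f @: P -> y \notin alt @: W ->
  unclaimed U (f (par u1)) y -> unclaimed U (f (par u2)) y ->
  (forall u Rd' U', u = u1 \/ u = u2 ->
     Inv (u |: P) W (updf f u y) alt (F :\ y) Rd' U' -> force t G Rd' U') ->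
  force t.+1 G Rd U.
Proof.
move=> I u1P u2P u1S u2S h1 h2 p1 p2 u1r u2r p12 kW yP yW fy1 fy2 K.
have f12 : f (par u1) != f (par u2) by apply: contra p12 => /eqP /(iinj I) ->.
rewrite frC in fy1; rewrite frC in fy2.
apply: (force_offer fy1 fy2 f12) => z q Rd' U' zq HU HR.
have [u [w [uu zE qE wH wP]]] : exists u w, [/\ u = u1 \/ u = u2, z = f (par u), q = f w, w \in H & w \in P].
  by case: zq => -[-> ->]; [exists u1, (par u2)|exists u2, (par u1)]; split=> //; [left|right].
subst z q; apply: (K u) => //.
have [uP uS hu pu ur] : [/\ u \notin P, u \notin Src, par u \in H, par u \in P & u != r].
  by case: uu => ->.
have kuW : par u \notin W.
  by apply: contraL hu => /(subsetP (iWL I)) /LS; apply: contra; apply: (subsetP HS).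
have : F :\ y \subset F :\ y :\ f w.
  apply/subsetP=> x; rewrite !in_setD1 => /andP[-> xF]; rewrite xF !andbT.
  by have [xP _ _] := iF I xF; apply: contraNneq xP => ->; apply: imset_f.
move/Inv_subF; apply.
apply: (place_step rS HS LS SrcL Srcleaf SrcS (w := par u) (e1 := y) (e2 := f w) I) => //.
- by rewrite /kid ur eqxx.
- by move=> v vP kv; apply: kW => //; case: uu kv => -> ->; rewrite ?orbT.
- by right; split=> //; exists w; rewrite ?wH.
- by rewrite (negPf uS).
- move=> a b; rewrite HU; congr [&& _, ~~ _ & _].
  by rewrite /same orbC andbC [X in X || _]andbC ![(_ == y) && _]andbC; 
     rewrite /same; case: (a == y); case: (b == y); case: (a == _); case: (b == _).
- by move=> a b; rewrite HR; congr (_ || _); rewrite /same;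
  case: (a == y); case: (b == y); case: (a == _); case: (b == _).
Qed.

Lemma card_unused P W f alt F Rd U : Inv P W f alt F Rd U ->
  #|f @: P| = #|P| /\ #|alt @: W| = #|W|.
Proof. by move=> I; rewrite !card_in_imset //; [exact: (iainj I)|exact: (iinj I)]. Qed.

Lemma hcl_F P W f alt F Rd U x : Inv P W f alt F Rd U -> x \in F -> hub_losses H P f U x = 0.
Proof.
move=> I xF; have [xP _ fx] := iF I xF; apply: eq_card0 => h; rewrite !inE.
apply/negP => /andP[/andP[_ hP]] /negP[]; apply: fx.
by apply: contraNneq xP => <-; apply: imset_f.
Qed.

Lemma F_fr P W f alt F Rd U x w : Inv P W f alt F Rd U -> x \in F -> w \in P -> unclaimed U (f w) x.
Proof.
move=> I xF wP; have [xP _ fx] := iF I xF; apply: fx.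
by apply: contraNneq xP => <-; apply: imset_f.
Qed.

Lemma pick_set (T : finType) (A : {set T}) k : k <= #|A| ->
  exists s : seq T, [/\ size s = k, uniq s & {subset s <= A}].
Proof.
move=> kA; exists (take k (enum A)).
rewrite size_take_min -cardE (minn_idPl kA) take_uniq ?enum_uniq //; split=> // x /mem_take.
by rewrite mem_enum.
Qed.

Lemma St_T2fresh P W F Rd U u w : St P W F Rd U ->
  u \notin P -> kid u w -> w \in P -> w \notin W -> (forall v, v \in P -> kid v u -> v \in W) ->
  2 <= #|F| ->
  force 1 (fun Rd' U' => exists2 F' : {set 'I_n}, #|F| <= #|F'| + 2 & St (u |: P) W F' Rd' U') Rd U.
Proof.
move=> [f [alt I]] uP uw wP wW kW cF.
have [[|x [|y [|? ?]]] [] // _ /= /andP[xy _] sF] := pick_set cF.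
have xF : x \in F by apply: sF; rewrite inE eqxx.
have yF : y \in F by apply: sF; rewrite !inE eqxx orbT.
rewrite inE in xy.
have [xP xW fx] := iF I xF; have [yP yW fy] := iF I yF.
apply: (force_T2 (t := 0) I uP uw wP wW kW xP xW yP yW xy).
- exact: (F_fr I).
- exact: (F_fr I).
- by rewrite !(hcl_F I).
- by move=> _ a; split; auto.
move=> z q Rd' U' zq _ I'; apply: force_now; exists (F :\ z :\ q); last by exists (updf f u z), alt.
exact: cardsD2_ge.
Qed.

Lemma St_T2pool P W F Rd U u w : St P W F Rd U ->
  u \notin P -> u \notin Src -> kid u w -> w \in P -> w \notin W -> w \notin H ->
  (forall v, v \in P -> kid v u -> v \in W) ->
  #|P| + #|W| + #|[set v | kid v w]| + 5 <= n ->
  force 1 (fun Rd' U' => St (u |: P) W set0 Rd' U') Rd U.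
Proof.
move=> [f [alt I]] uP uS uw wP wW wH kW cP.
have [c1 c2] := card_unused I.
pose A := [set x | [&& x \notin f @: P, x \notin alt @: W & unclaimed U (f w) x]].
have cA : 2 <= #|A|.
  pose B := [set x | (x \notin f @: P) && ~~ unclaimed U (f w) x].
  have : #|[set: 'I_n]| <= #|A :|: (f @: P :|: (alt @: W :|: B))|.
    apply: subset_leq_card; apply/subsetP=> x _; rewrite !in_setU !inE.
    by case: (x \in f @: P); case: (x \in alt @: W); case: (unclaimed _ _ _).
  rewrite cardsT card_ord.
  have := (leq_card_setU A (f @: P :|: (alt @: W :|: B))).1.
  have := (leq_card_setU (f @: P) (alt @: W :|: B)).1; have := (leq_card_setU (alt @: W) B).1.
  have : #|B| <= #|[set v | kid v w]| + 3.
    apply: leq_trans (icl I wP wH) _; apply: leq_add; last by case: (_ && _).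
    by apply: subset_leq_card; apply/subsetP=> v; rewrite !inE => /and3P[_ ->].
  move: cP; rewrite c1 c2; clear; lia.
have [[|x [|y [|? ?]]] [] // _ /= /andP[xy _] sF] := pick_set cA.
have : x \in A by apply: sF; rewrite inE eqxx.
have : y \in A by apply: sF; rewrite !inE eqxx orbT.
rewrite !inE in xy *; move=> /and3P[yP yW fy] /and3P[xP xW fx].
apply: (force_T2 (t := 0) I uP uw wP wW kW xP xW yP yW xy fx fy).
- by rewrite (negPf wH).
- by rewrite (negPf uS).
move=> z q Rd' U' zq _ I'; apply: force_now; exists (updf f u z), alt.
by apply: Inv_subF I'; apply: sub0set.
Qed.

(** No child of [u] is placed yet, so one red edge to the hub completes the placement of [u]. *)
Definition placeable P (O : {set V}) := forall u, u \in O ->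
  [/\ u \notin P, u \notin Src, par u \in H, par u \in P & u != r] /\ (forall v, v \in P -> ~~ kid v u).

(** The vertex offered is taken outside [F], so the supply of untouched vertices stays intact. It
    may have lost two hubs, which are not known in advance: hence the quantification over [h1] and
    [h2]. *)
Lemma St_T1 P W F Rd U O : St P W F Rd U -> placeable P O ->
  #|P| + #|W| + #|F| < n ->
  (forall h1 h2 : V, exists u1 u2, [/\ u1 \in O, u2 \in O, par u1 != par u2,
     par u1 \notin [set h1; h2] & par u2 \notin [set h1; h2]]) ->
  force 1 (fun Rd' U' => exists2 u, u \in O & St (u |: P) W F Rd' U') Rd U.
Proof.
move=> [f [alt I]] ok lt two.
have [c1 c2] := card_unused I.
have [y yA] : exists y, y \notin f @: P :|: alt @: W :|: F.
  apply/existsP; rewrite -negb_forall; apply: contraL lt => /forallP all; rewrite -leqNgt.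
  rewrite -{1}(card_ord n) -cardsT -c1 -c2.
  have /subset_leq_card le : [set: 'I_n] \subset f @: P :|: alt @: W :|: F.
    by apply/subsetP=> y _; have := all y; rewrite ?negbK.
  apply: leq_trans le _; apply: leq_trans (leq_card_setU _ _).1 _.
  by rewrite leq_add2r (leq_card_setU _ _).1.
move: yA; rewrite !in_setU !negb_or => /andP[/andP[yP yW] yF].
have hc := ihub I yP; rewrite /hub_losses in hc.
have [h1 [h2 sub]] : exists h1 h2, [set h in H :&: P | ~~ unclaimed U (f h) y] \subset [set h1; h2].
  move: hc; rewrite leq_eqVlt ltnS leq_eqVlt ltnS leqn0 cards_eq0 => /or3P[/cards2P[h1 [h2 [_ ->]]]|/cards1P[h ->]|/eqP->].
  - by exists h1, h2.
  - by exists h, h; rewrite setUid.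
  - by exists r, r; apply: sub0set.
have [u1 [u2 [u1O u2O p12 n1 n2]]] := two h1 h2.
have [[u1P u1S pH1 pP1 u1r] k1] := ok _ u1O; have [[u2P u2S pH2 pP2 u2r] k2] := ok _ u2O.
have fry u : par u \in H -> par u \in P -> par u \notin [set h1; h2] -> unclaimed U (f (par u)) y.
  by move=> pH pP; apply: contraR => nf; apply: (subsetP sub); rewrite !inE pH pP.
apply: (force_T1 (t := 0) (y := y) I u1P u2P) => //.
- by move=> v vP; rewrite (negPf (k1 _ vP)) (negPf (k2 _ vP)).
- by apply: fry.
- by apply: fry.
move=> u Rd' U' uu I'; apply: force_now; exists u; first by case: uu => ->.
exists (updf f u y), alt; apply: Inv_subF I'; apply/subsetP=> x xF; rewrite !inE xF andbT.
by apply: contraNneq yF => <-.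
Qed.

Lemma St_T1fresh P W F Rd U O u1 u2 : St P W F Rd U -> placeable P O ->
  u1 \in O -> u2 \in O -> par u1 != par u2 -> 1 <= #|F| ->
  force 1 (fun Rd' U' => exists (u : V) (F' : {set 'I_n}), [/\ u = u1 \/ u = u2, #|F| <= #|F'| + 1 & St (u |: P) W F' Rd' U']) Rd U.
Proof.
move=> [f [alt I]] ok u1O u2O p12; rewrite card_gt0 => /set0Pn[y yF].
have [yP yW fy] := iF I yF.
have [[u1P u1S pH1 pP1 u1r] k1] := ok _ u1O; have [[u2P u2S pH2 pP2 u2r] k2] := ok _ u2O.
apply: (force_T1 (t := 0) (y := y) I u1P u2P) => //.
- by move=> v vP; rewrite (negPf (k1 _ vP)) (negPf (k2 _ vP)).
- exact: (F_fr I).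
- exact: (F_fr I).
move=> u Rd' U' uu I'; apply: force_now; exists u, (F :\ y); split=> //; last by exists (updf f u y), alt.
by rewrite (cardsD1 y F) yF addnC.
Qed.

Lemma St_P P W F Rd U O v a b : St P W F Rd U -> placeable P O ->
  v \in O -> a \in O -> b \in O -> par a != par v -> par b != par v -> par a != par b -> 2 <= #|F| ->
  force 2 (fun Rd' U' => exists (u : V) (F' : {set 'I_n}), [/\ u = a \/ u = b, #|F| <= #|F'| + 2 & St (u |: (v |: P)) W F' Rd' U']) Rd U.
Proof.
move=> [f [alt I]] ok vO aO bO av bv ab cF.
have [[|x [|y [|? ?]]] [] // _ /= /andP[xy _] sF] := pick_set cF.
have xF : x \in F by apply: sF; rewrite inE eqxx.
have yF : y \in F by apply: sF; rewrite !inE eqxx orbT.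
rewrite inE in xy.
have [xP xW fx] := iF I xF; have [yP yW fy] := iF I yF.
have [[vP vS pHv pPv vr] kv] := ok _ vO.
have [[aP aS pHa pPa ar] ka] := ok _ aO; have [[bP bS pHb pPb br] kb] := ok _ bO.
have va : v != a by apply: contraNneq av => ->.
have vb : v != b by apply: contraNneq bv => ->.
apply: (force_T2 (t := 1) I (u := v) (w := par v) (x := x) (y := y)) => //.
- by rewrite /kid vr eqxx.
- by apply: contraL pHv => /(subsetP (iWL I)) /LS; apply: contra; apply: (subsetP HS).
- by move=> c cP; rewrite (negPf (kv _ cP)).
- exact: (F_fr I).
- exact: (F_fr I).
- by rewrite !(hcl_F I).
- by rewrite (negPf vS).
move=> z q Rd' U' zq HU I'.
have [zF qF zqn] : [/\ z \in F, q \in F & q != z] by case: zq => -[-> ->]; split; rewrite // eq_sym.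
have [qP qW fq] := iF I qF; have [zP _ _] := iF I zF.
have nv c : par c \in P -> par c != v by move=> pc; apply: contraNneq vP => <-.
have frq c : par c \in P -> par c != par v -> unclaimed U' (updf f v z (par c)) q.
  move=> pc cv; rewrite updf_neq ?nv // (upd_np HU) ?(F_fr I) //.
    by apply: contra cv => /eqP /(iinj I) ->.
  by apply: contraNneq qP => ->; apply: imset_f.
apply: (force_T1 (t := 0) I' (u1 := a) (u2 := b) (y := q)) => //.
- by rewrite in_setU1 negb_or eq_sym va.
- by rewrite in_setU1 negb_or eq_sym vb.
- by rewrite in_setU1 pPa orbT.
- by rewrite in_setU1 pPb orbT.
- move=> c; rewrite in_setU1 => /orP[/eqP->|cP]; last by rewrite (negPf (ka _ cP)) (negPf (kb _ cP)).
  by rewrite /kid; case/orP=> /andP[_ /eqP E]; move: vP; [move: aP|move: bP]; rewrite -E pPv.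
- by rewrite imset_updf // in_setU1 negb_or zqn.
- by apply: frq.
- by apply: frq.
move=> u Rd'' U'' uu I''; apply: force_now.
exists u, (F :\ z :\ q :\ q); split=> //; last by exists (updf (updf f v z) u q), alt.
have -> : F :\ z :\ q :\ q = F :\ z :\ q by apply/setP=> c; rewrite !inE; case: (c == q).
exact: cardsD2_ge.
Qed.

Lemma St_link P W F Rd U v g : St P W F Rd U -> v \in W -> kid v g -> g \in P -> g \notin W ->
  force 1 (fun Rd' U' => St P (W :\ v) F Rd' U') Rd U.
Proof.
move=> [f [alt I]] vW vg gP gW.
have vP := subsetP (iWP I) _ vW.
have gv : g != v by rewrite eq_sym (kid_neq rkP vg).
have fgv : f g != f v by apply: contra gv => /eqP /(iinj I) ->.
have nb b : b \in P -> kid b v -> f g != f b.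
  move=> bP kb; have : g != b.
    case/andP: vg => vr /eqP <-; case/andP: kb => br /eqP pb.
    have := rkP br; have := rkP vr; rewrite pb => l1 l2.
    by apply: contraTneq (ltn_trans l1 l2) => ->; rewrite ltnn.
  by apply: contraNneq => /(iinj I) ->.
have [f1 f2] := iW I vW nb.
have ga : f g != alt v by apply: contraNneq (iaun I vW) => <-; apply: imset_f.
have fa : f v != alt v by apply: contraNneq (iaun I vW) => <-; apply: imset_f.
apply: (force_offer (t := 0) (f1 fgv) (f2 ga) fa) => z w Rd' U' zw HU HR; apply: force_now.
exists (updf f v z), alt.
exact: (link_step rkP HS LS SrcL LH1 Ladj Srcleaf SrcH I vW vg gP gW zw HU HR).
Qed.

Lemma St_cand P W F Rd U v b : St P W F Rd U -> v \in L -> v \notin P -> b \in P -> b \in S -> kid b v ->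
  (forall b', b' \in P -> kid b' v -> b' = b) -> 4 <= #|F| ->
  force 2 (fun Rd' U' => exists2 F' : {set 'I_n}, #|F| <= #|F'| + 4 & St (v |: P) (v |: W) F' Rd' U') Rd U.
Proof.
move=> [f [alt I]] vL vP bP bS bv bu cF.
have [[|x1 [|x2 [|x3 [|x4 [|? ?]]]]] [] // _ us sF] := pick_set cF.
have [x1F x2F x3F x4F] : [/\ x1 \in F, x2 \in F, x3 \in F & x4 \in F].
  by split; apply: sF; rewrite !inE eqxx ?orbT.
move: us; rewrite /= !inE !negb_or => /and4P[/and3P[x12 x13 x14] /andP[x23 x24] x34 _].
apply: (force_offer (t := 1) (F_fr I x1F bP) (F_fr I x2F bP) x12) => z1 w1 Rd1 U1 zw1 HU1 HR1.
have np q : q \in F -> q != f b by move=> /(iF I)[+ _ _]; apply: contraNneq => ->; apply: imset_f.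
have fr1 q : q \in F -> q != x1 -> q != x2 -> unclaimed U1 (f b) q.
  by move=> qF q1 q2; rewrite (upd_p HU1) ?(F_fr I) //; case: zw1 => -[E1 E2]; rewrite ?E1 ?E2.
apply: (force_offer (t := 0) (fr1 _ x3F _ _) (fr1 _ x4F _ _) x34); rewrite 1?eq_sym //.
move=> z2 w2 Rd2 U2 zw2 HU2 HR2; apply: force_now.
exists (F :\ z1 :\ w1 :\ z2 :\ w2).
  exact: cardsD4_ge.
exists (updf f v z1), (updf alt v z2).
have [z1F w1F] : z1 \in F /\ w1 \in F by case: zw1 => -[-> ->].
have [z2F w2F] : z2 \in F /\ w2 \in F by case: zw2 => -[-> ->].
have z12 : z1 != z2 by case: zw1 => -[-> _]; case: zw2 => -[-> _].
apply: (cand_step rkP HS LS SrcL Ladj SrcH SrcS I vL vP bP bS bv bu z1F w1F z2F w2F z12).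
  by move=> x y; rewrite HU2 HU1 -!andbA.
by move=> x y; rewrite HR2 HR1 -!orbA.
Qed.

End Steps.

(** * Phases of the embedding *)

Lemma min_rk (T : finType) (rk : T -> nat) (A : {set T}) : A != set0 ->
  exists2 u, u \in A & forall v, v \in A -> rk u <= rk v.
Proof.
case/set0Pn => a aA; case: (arg_minnP (P := fun x => x \in A) rk aA) => u uA m.
by exists u.
Qed.

Lemma le_chain a b c x y : a <= b + x -> b <= c + y -> a <= c + (x + y).
Proof. by clear; lia. Qed.

Lemma le_budget k m a b : k * m.+1 <= a -> a <= b + k -> k * m <= b.
Proof. by clear; lia. Qed.

Lemma le_chain_l n a b x y : n <= a + x -> a <= b + y -> n <= b + (y + x).
Proof. by clear; lia. Qed.

Lemma le_supply n a k m : n <= a + k -> k + m <= n -> m <= a.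
Proof. by clear; lia. Qed.

Section Phases.
Variable n : nat.
Variables (V : finType) (r : V) (par : V -> V) (rk : V -> nat).
Hypothesis cardV : #|V| = n.
Hypothesis rkP : forall v, v != r -> rk (par v) < rk v.
Variables (H S Z Src : {set V}) (tau : nat).
Notation kid := (child r par).
Definition kids (w : V) := [set v | kid v w].
Definition attached := [set v | (v \notin S) && [exists b in S, kid b v]].
(** When the reserved set is a path of the tree, its lowest role lies directly above the skeleton
    but has to stay unplaced; this is why [Z] is taken away. *)
Definition links := attached :\: Z.

Hypothesis rS : r \in S.
Hypothesis HS : H \subset S.
Hypothesis ZS : forall v, v \in Z -> v \notin S.
Hypothesis Zc : forall v, v \notin S -> par v \in Z -> v \in Z.
Hypothesis cl : forall u v w, u \notin S -> kid v u -> kid w u ->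
  v \in S :|: attached -> w \in S :|: attached -> v = w.
Hypothesis SrcS : forall y, y \in Src -> y \notin S.
Hypothesis SrcZ : forall y, y \in Src -> y \notin Z.
Hypothesis Srcleaf : forall y v, y \in Src -> ~~ kid v y.
Hypothesis SrcH : forall y, y \in Src -> par y \in H.
Hypothesis degtau : forall w, w \notin H -> #|kids w| <= tau.
Hypothesis cardZ : tau + 5 <= #|Z|.
Hypothesis cardZ60 : 60 <= #|Z|.
(** Covers the untouched vertices used before the hub phase: at most two per skeleton role, four per
    link, two per early role, where there are at most [#|S|] links and [#|S| + #|Src|] early
    roles. *)
Let N1 := 9 * #|S| + 2 * #|Src|.
Hypothesis degH : forall h, h \in H -> 3 * #|kids h| + (N1 + 100) <= n.
Hypothesis nbig : N1 + 100 <= n.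

Lemma LS v : v \in links -> v \notin S.
Proof. by rewrite !inE => /and3P[]. Qed.
Lemma LZ v : v \in links -> v \notin Z.
Proof. by rewrite !inE => /and3P[]. Qed.
Lemma Lkid v : v \in links -> exists2 b, b \in S & kid b v.
Proof. by rewrite !inE => /and3P[_ _ /existsP[b /andP[]]]; exists b. Qed.
Lemma Lup v : v \in links -> v \in attached.
Proof. by rewrite !inE => /andP[]. Qed.
Lemma SrcL v : v \in links -> v \notin Src.
Proof. by move=> /Lkid[b _ kb]; apply: contraL kb => /Srcleaf. Qed.
Lemma LH1 v : v \in links -> #|[set b in H | kid b v]| <= 1.
Proof.
move=> vL; rewrite leqNgt; apply/negP => /card_gt1P[a [b []]]; rewrite !inE.
case/andP=> aH ka /andP[bH kb] /eqP[]; apply: (cl (LS vL) ka kb); rewrite inE (subsetP HS) //.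
Qed.
Lemma Ladj v u : v \in links -> kid v u -> u \notin links.
Proof.
move=> vL kv; apply/negP => uL; have [b bS kb] := Lkid uL.
have E := cl (LS uL) kv kb; have := LS vL; rewrite E ?bS // inE ?bS //.
by rewrite (Lup vL) orbT.
Qed.
Lemma par_notZ v : v \in links -> par v \notin Z.
Proof. by move=> vL; apply: contra (LZ vL); apply: Zc; apply: LS. Qed.
Lemma notr v : v \notin S -> v != r.
Proof. by apply: contraNneq => ->. Qed.

Local Notation St := (@St n V r par H S links Src).
Implicit Types (P W X O : {set V}) (F : {set 'I_n}) (Rd U : graph n).

(** These roles get arbitrary vertices before the first round, since no parent of theirs lies in the
    skeleton. *)
Definition tops := [set b in S | (b == r) || (par b \notin S)].

Lemma phase_S m P F Rd U : tops \subset P -> P \subset S ->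
  (forall b, b \in P -> b \notin tops -> par b \in P) ->
  #|S :\: P| = m -> 2 * m <= #|F| -> St P set0 F Rd U ->
  force m (fun Rd' U' => exists2 F' : {set 'I_n}, #|F| <= #|F'| + 2 * m & St S set0 F' Rd' U') Rd U.
Proof.
elim: m P F Rd U => [|m IH] P F Rd U TP PS cl0 cm cF st.
  have E : P = S by apply/eqP; rewrite eqEsubset PS -setD_eq0 -cards_eq0 cm.
  rewrite E in st.
  by apply: force_now; exists F; rewrite ?muln0 ?addn0.
have [|u uSP umin] := @min_rk _ rk (S :\: P); first by rewrite -card_gt0 cm.
move: (uSP); rewrite inE => /andP[uP uS].
have : u \notin tops by apply: contra uP; apply: (subsetP TP).
rewrite inE uS negb_or negbK /= => /andP[ur puS].
have puP : par u \in P.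
  apply: contraT => npu; have := umin (par u); rewrite inE npu puS => /(_ isT).
  by rewrite leqNgt rkP.
have cF2 : 2 <= #|F| by apply: leq_trans cF; rewrite mulnS leq_addr.
rewrite -[m.+1]add1n; apply: force_bind.
  apply: (St_T2fresh rS HS LS SrcL Srcleaf SrcS st uP (w := par u) _ puP _ _ cF2).
  - by rewrite /child ur eqxx.
  - by rewrite inE.
  - move=> v vP /andP[vr /eqP pv].
    have : v \notin tops by rewrite inE (subsetP PS _ vP) (negPf vr) pv uS.
    by move/(cl0 _ vP); rewrite pv (negPf uP).
move=> Rd' U' [F' cF' st'].
have cm' : #|S :\: (u |: P)| = m.
  have := cardsD1 u (S :\: P); rewrite uSP cm => -[->]; apply: eq_card => v.
  by rewrite !inE negb_or andbA.
apply: force_imp (IH _ F' _ _ _ _ _ cm' _ st').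
- move=> Rd2 U2 [F2 cF2' st2]; exists F2; rewrite // mulnS; exact: (le_chain cF' cF2').
- by apply: subset_trans TP _; apply: subsetUr.
- by rewrite subUset sub1set uS.
- move=> b; rewrite !in_setU1 => /orP[/eqP->|bP bT]; first by rewrite puP orbT.
  by rewrite (cl0 _ bP bT) orbT.
- exact: (le_budget cF cF').
Qed.

Lemma phase_L m X F Rd U : X \subset links -> #|links :\: X| = m -> 4 * m <= #|F| ->
  St (S :|: X) X F Rd U ->
  force (2 * m) (fun Rd' U' => exists2 F' : {set 'I_n}, #|F| <= #|F'| + 4 * m & St (S :|: links) links F' Rd' U') Rd U.
Proof.
elim: m X F Rd U => [|m IH] X F Rd U XL cm cF st.
  have E : X = links by apply/eqP; rewrite eqEsubset XL -setD_eq0 -cards_eq0 cm.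
  by rewrite E in st; apply: force_now; exists F; rewrite ?muln0 ?addn0.
have /set0Pn[v vLX] : links :\: X != set0 by rewrite -card_gt0 cm.
move: (vLX); rewrite inE => /andP[vX vL].
have [b bS kb] := Lkid vL.
have cF2 : 4 <= #|F| by apply: leq_trans cF; rewrite mulnS leq_addr.
rewrite mulnS; apply: force_bind.
  apply: (St_cand rkP HS LS SrcL Ladj SrcH SrcS st vL _ _ bS kb _ cF2).
  - by rewrite in_setU negb_or vX LS.
  - by rewrite inE bS.
  - move=> b' b'P kb'; apply: (cl (LS vL) kb' kb); last by rewrite inE bS.
    by move: b'P; rewrite !in_setU => /orP[->//|/(subsetP XL)/Lup->]; rewrite orbT.
move=> Rd' U' [F' cF' st'].
have cm' : #|links :\: (v |: X)| = m.
  have := cardsD1 v (links :\: X); rewrite vLX cm => -[->]; apply: eq_card => u.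
  by rewrite !in_setD !in_setU1 in_set1 negb_or -!andbA.
rewrite setUCA in st'.
apply: force_imp (IH _ F' _ _ _ cm' _ st').
- move=> Rd2 U2 [F2 cF2' st2]; exists F2; rewrite // mulnS; exact: (le_chain cF' cF2').
- by rewrite subUset sub1set vL.
- exact: (le_budget cF cF').
Qed.

(** Children of hubs that are parents of links. They already have a placed child, so they are not
    [placeable] and cannot take part in the hub phase; they are placed beforehand, on untouched
    vertices. *)
Definition gates := [set g | [&& g \notin S, g \notin links, g \notin Z, par g \in H & [exists v in links, kid v g]]].
(** The source leaves are placed in the same phase, while their future vertices are untouched: this
    gives [iSrc]. *)
Definition early := gates :|: Src.
Definition core := S :|: links :|: early.

Lemma earlyP u : u \in early -> [/\ u \notin S, u \notin links, u \notin Z & par u \in H].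
Proof.
rewrite in_setU => /orP[|uS]; first by rewrite inE => /and5P[].
split; [exact: SrcS|by apply: contraL uS; apply: SrcL|exact: SrcZ|exact: SrcH].
Qed.

Lemma up1_notin u v : u \notin S -> u \notin links -> u \notin Z -> v \in S -> ~~ kid v u.
Proof.
move=> uS uL uZ vS; apply: contra uL => kv; rewrite !inE uZ uS /=.
by apply/existsP; exists v; rewrite vS.
Qed.

Lemma phase_early m X F Rd U : X \subset early -> #|early :\: X| = m -> 2 * m <= #|F| ->
  St (S :|: links :|: X) links F Rd U ->
  force m (fun Rd' U' => exists2 F' : {set 'I_n}, #|F| <= #|F'| + 2 * m & St core links F' Rd' U') Rd U.
Proof.
elim: m X F Rd U => [|m IH] X F Rd U XQ cm cF st.
  have E : X = early by apply/eqP; rewrite eqEsubset XQ -setD_eq0 -cards_eq0 cm.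
  by rewrite E in st; apply: force_now; exists F; rewrite ?muln0 ?addn0.
have /set0Pn[u uQX] : early :\: X != set0 by rewrite -card_gt0 cm.
move: (uQX); rewrite inE => /andP[uX uQ].
have [uS uL uZ pH] := earlyP uQ; have pS := subsetP HS _ pH.
have cF2 : 2 <= #|F| by apply: leq_trans cF; rewrite mulnS leq_addr.
rewrite -[m.+1]add1n; apply: force_bind.
  apply: (St_T2fresh rS HS LS SrcL Srcleaf SrcS st (u := u) (w := par u) _ _ _ _ _ cF2).
  - by rewrite !in_setU !negb_or uS uL.
  - by rewrite /child notr // eqxx.
  - by rewrite !in_setU pS.
  - by apply: contraL pS; apply: LS.
  - move=> v; rewrite !in_setU => /orP[/orP[vS|//]|/(subsetP XQ)/earlyP[_ _ _ pvH]] kv.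
      by have := up1_notin uS uL uZ vS; rewrite kv.
    by case/andP: kv uS => _ /eqP <-; rewrite (subsetP HS _ pvH).
move=> Rd' U' [F' cF' st'].
have cm' : #|early :\: (u |: X)| = m.
  have := cardsD1 u (early :\: X); rewrite uQX cm => -[->]; apply: eq_card => v.
  by rewrite !in_setD !in_setU1 in_set1 negb_or -!andbA.
rewrite setUCA in st'.
apply: force_imp (IH _ F' _ _ _ cm' _ st').
- move=> Rd2 U2 [F2 cF2' st2]; exists F2; rewrite // mulnS; exact: (le_chain cF' cF2').
- by rewrite subUset sub1set uQ.
- exact: (le_budget cF cF').
Qed.

(** Afterwards every pending link has an unplaced parent, which is what the count in [card_WP] rests
    on. *)
Lemma phase_link m P W F Rd U : W \subset links -> #|W| <= m -> St P W F Rd U ->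
  force m (fun Rd' U' => exists W', [/\ W' \subset W, forall v, v \in W' -> par v \notin P,
     (forall v, v \in W -> v \notin W' -> par v \in P) & St P W' F Rd' U']) Rd U.
Proof.
elim: m W Rd U => [|m IH] W Rd U WL cW st.
  have W0 : W = set0 by apply/eqP; rewrite -cards_eq0 -leqn0.
  by apply: force_now; exists W; rewrite W0; split=> // [v|v|]; rewrite ?inE // -W0.
have [/existsP[v /andP[vW pP]]|] := boolP [exists v, (v \in W) && (par v \in P)]; last first.
  rewrite negb_exists => /forallP none; apply: force_now; exists W; split=> // v vW.
    by have := none v; rewrite vW.
  by rewrite vW.
have vL := subsetP WL _ vW.
have kv : kid v (par v) by rewrite /child notr ?LS // eqxx.
rewrite -[m.+1]add1n; apply: force_bind.
  apply: (St_link rkP HS LS SrcL LH1 Ladj Srcleaf SrcH st vW kv pP).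
  by apply: contra (Ladj vL kv); apply: (subsetP WL).
move=> Rd' U' st'; apply: force_imp (IH _ _ _ _ _ st').
- move=> Rd2 U2 [W' [W'W n1 n2 st2]]; exists W'; split=> //.
    by apply: subset_trans W'W _; apply: subD1set.
  move=> u uW uW'; have [->//|uv] := eqVneq u v.
  by apply: n2; rewrite // !inE uv.
- by apply: subset_trans WL; apply: subD1set.
- by rewrite (cardsD1 v W) vW in cW.
Qed.

Definition hub_kids := [set u | [&& u \notin core, u \notin Z & par u \in H]].

Lemma hub_kidsP u : u \in hub_kids -> [/\ u \notin S, u \notin links, u \notin early, u \notin Z & par u \in H].
Proof. by rewrite /hub_kids inE /core 2!in_setU !negb_or => /and3P[/andP[/andP[? ?] ?] ? ?]. Qed.

Lemma ok_start : placeable r par H Src core hub_kids.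
Proof.
move=> u uO; have [uS uL uQ uZ pH] := hub_kidsP uO; have pS := subsetP HS _ pH; split.
  split; rewrite ?notr //; first by rewrite /core 2!in_setU !negb_or uS uL.
    by apply: contra uQ => uSrc; rewrite /early in_setU uSrc orbT.
  by rewrite /core 2!in_setU pS.
move=> v; rewrite /core 2!in_setU => /orP[/orP[vS|vL]|vQ].
- exact: up1_notin.
- apply: contra uQ => kv; rewrite /early in_setU /gates inE uS uL uZ pH /=; apply/orP; left.
  by apply/existsP; exists v; rewrite vL.
- have [_ _ _ pvH] := earlyP vQ; apply: contra uS => /andP[_ /eqP <-]; exact: (subsetP HS).
Qed.

Lemma ok_step P O u : placeable r par H Src P O -> u \in O -> placeable r par H Src (u |: P) (O :\ u).
Proof.
move=> ok uO v /setD1P[vu vO]; have [[vP vS pH pP vr] kv] := ok _ vO; have [[_ _ _ pPu _] _] := ok _ uO.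
split; first by split; rewrite // in_setU1 ?negb_or ?vu // pP orbT.
move=> x; rewrite in_setU1 => /orP[/eqP->|xP]; last exact: kv.
by apply: contra vP => /andP[_ /eqP <-].
Qed.

(** The second candidates occupy [#|W|] vertices besides those of [P]. Room for them is found by
    charging a pending link to its parent: the parents are unplaced, lie outside [O] and [Z], and
    are distinct, because two links with a common parent would contradict [cl]. *)
Lemma card_WP P W O : S \subset P -> W \subset links -> (forall v, v \in W -> par v \notin P) -> [disjoint P & Z] ->
  O \subset ~: (P :|: Z) -> (forall v, v \in W -> par v \notin O) ->
  #|P| + #|W| + #|O| + #|Z| <= n.
Proof.
move=> SP WL pP PZ OPZ pO.
have inj : {in W &, injective par}.
  move=> v w vW wW E.
  have [vL wL] : v \in links /\ w \in links by split; apply: (subsetP WL).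
  have kv : kid v (par v) by rewrite /child notr ?LS // eqxx.
  have kw : kid w (par v) by rewrite /child notr ?LS // E eqxx.
  have pS : par v \notin S by apply: contra (pP _ vW); apply: (subsetP SP).
  by apply: (cl pS kv kw); rewrite in_setU Lup // orbT.
rewrite -cardV -cardsT -(card_in_imset inj).
have d1 : [disjoint P & par @: W].
  by rewrite disjoint_sym disjoints_subset; apply/subsetP=> _ /imsetP[v vW ->]; rewrite inE pP.
have d2 : [disjoint P :|: par @: W & O].
  rewrite disjoint_sym disjoints_subset; apply/subsetP=> u uO; rewrite !inE negb_or.
  have := subsetP OPZ _ uO; rewrite !inE negb_or => /andP[-> _] /=.
  by apply/imsetP => -[v /pO + E]; rewrite -E uO.
have d3 : [disjoint P :|: par @: W :|: O & Z].
  rewrite disjoint_sym disjoints_subset; apply/subsetP=> u uZ; rewrite !inE !negb_or.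
  rewrite (disjointFl PZ uZ) /=; apply/andP; split.
    by apply/imsetP => -[v /(subsetP WL)/par_notZ + E]; rewrite -E uZ.
  by apply/negP => /(subsetP OPZ); rewrite !inE uZ orbT.
move: d1 d2 d3; rewrite -!leq_card_setU => /eqP d1 /eqP d2 /eqP d3.
by rewrite -d1 -d2 -d3; apply: subset_leq_card; apply: subsetT.
Qed.

Lemma dm_kids P O h F : placeable r par H Src P O -> n <= #|F| + N1 -> 3 * demand par O h + 100 <= #|F|.
Proof.
move=> ok cF; have [hH|hH] := boolP (h \in H).
  have : demand par O h <= #|kids h|.
    apply: subset_leq_card; apply/subsetP=> u; rewrite !inE /child => /andP[/ok[[_ _ _ _ ->] _]] //.
  by have := degH hH; move: cF; clear; lia.
rewrite /demand (_ : [set v in O | _] = set0) ?cards0; first by move: cF nbig; clear; lia.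
apply/setP=> u; rewrite !inE; apply/negP => /andP[/ok[[_ _ pH _ _] _] /eqP ph].
by rewrite -ph pH in hH.
Qed.

Lemma phase_good O f : good par O f -> forall P W F Rd U, placeable r par H Src P O -> f <= #|F| ->
  St P W F Rd U ->
  force #|O| (fun Rd' U' => St (P :|: O) W set0 Rd' U') Rd U.
Proof.
elim=> {O f} [f|O f v1 v2 v1O v2O v12 _ IH1 _ IH2|O f v vO _ IH|O f v a b vO aO bO av bv ab _ IHa _ IHb]
  P W F Rd U ok cF st.
- by apply: force_now; rewrite setU0; apply: St_subF st; apply: sub0set.
- rewrite (cardsD1 v1) v1O; apply: force_bind.
    by apply: (St_T1fresh rS HS LS SrcL Srcleaf SrcS st ok v1O v2O v12); apply: leq_trans cF.
  move=> Rd' U' [u [F' [uv cF' st']]].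
  have uO : u \in O by case: uv => ->.
  have -> : #|O :\ v1| = #|O :\ u|.
    by have := cardsD1 v1 O; have := cardsD1 u O; rewrite uO v1O => -> [].
  have E : P :|: O = u |: P :|: (O :\ u) by rewrite setUAC setD1K // setUC.
  rewrite E; case: uv => uE; subst u; [apply: (IH1 _ _ F')|apply: (IH2 _ _ F')] => //;
    by [apply: ok_step|move: cF cF'; clear; lia].
- have [[vP _ pH pP vr] kv] := ok _ vO.
  rewrite (cardsD1 v) vO; apply: force_bind.
    apply: (St_T2fresh rS HS LS SrcL Srcleaf SrcS st vP (w := par v) _ pP).
    + by rewrite /child vr eqxx.
    + apply: contraL pH => pW; case: st => [ff [alt I]].
      by apply: contra (LS (subsetP (iWL I) _ pW)); apply: (subsetP HS).
    + by move=> u uP ku; have := kv _ uP; rewrite ku.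
    + by apply: leq_trans cF.
  move=> Rd' U' [F' cF' st'].
  have E : P :|: O = v |: P :|: (O :\ v) by rewrite setUAC setD1K // setUC.
  rewrite E; apply: (IH _ _ F') => //; first exact: ok_step.
  by move: cF cF'; clear; lia.
- have va : v != a by apply: contraNneq av => ->.
  have vb : v != b by apply: contraNneq bv => ->.
  rewrite (cardsD1 v) vO (cardsD1 a) !inE eq_sym va aO addnA; apply: force_bind.
    apply: (St_P rS HS LS SrcL Srcleaf SrcS st ok vO aO bO av bv ab).
    by apply: leq_trans cF.
  move=> Rd' U' [u [F' [uv cF' st']]].
  have uO : u \in O :\ v by case: uv => ->; rewrite !inE eq_sym ?va ?vb.
  have aO' : a \in O :\ v by rewrite !inE eq_sym va.
  have -> : #|O :\ v :\ a| = #|O :\ v :\ u|.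
    by have := cardsD1 a (O :\ v); have := cardsD1 u (O :\ v); rewrite uO aO' => -> [].
  have E : P :|: O = u |: (v |: P) :|: (O :\ v :\ u).
    have /setD1P[_ uO'] := uO; apply/setP=> x; rewrite !inE.
    case: (eqVneq x u) => [->|xu]; first by rewrite uO' orbT.
    by case: (eqVneq x v) => [->|xv]; rewrite ?vO ?orbT.
  rewrite E; case: uv => uE; subst u; [apply: (IHa _ _ F')|apply: (IHb _ _ F')] => //;
    by [apply: ok_step => //; apply: ok_step|move: cF cF'; clear; lia].
Qed.

Lemma phase_hubs P W O F Rd U : placeable r par H Src P O -> n <= #|F| + N1 -> #|O| + 60 <= #|F| ->
  St P W F Rd U -> force #|O| (fun Rd' U' => St (P :|: O) W set0 Rd' U') Rd U.
Proof.
move=> ok cF cO st; apply: (phase_good (f := #|F|) _ ok _ st) => //.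
apply: caps_good; have D h := dm_kids h ok cF; split=> //.
- by move=> h; have := D h; clear; lia.
- by move=> h k _; have := D h; have := D k; clear; lia.
- by move=> h k l _ _ _; have := D h; have := D k; have := D l; clear; lia.
Qed.

(** The remaining children of hubs may outnumber the untouched vertices, so the caps on [#|O|] can
    fail at first. Until they hold, touched vertices are used up, which shrinks [O] but not [F]. *)
Lemma phase_O m P W O F Rd U : #|O| = m -> placeable r par H Src P O -> #|P| + #|W| + #|O| + #|Z| <= n ->
  n <= #|F| + N1 -> St P W F Rd U ->
  force m (fun Rd' U' => St (P :|: O) W set0 Rd' U') Rd U.
Proof.
elim: m P O Rd U => [|m IH] P O Rd U cO ok cn cF st.
  apply: force_now; rewrite (cards0_eq cO) setU0; apply: St_subF st; exact: sub0set.
have [le|gt] := leqP (#|O| + 60) #|F|; first by rewrite -cO; apply: (phase_hubs ok cF le st).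
rewrite -[m.+1]add1n; apply: force_bind.
  apply: (St_T1 rS HS LS SrcL Srcleaf SrcS st ok); first by move: cn gt cardZ60; clear; lia.
  move=> h1 h2.
  (* Three hubs together demand at most [#|F| - 100], which is less than [#|O|]. *)
  have pick h3 : exists2 u, u \in O & par u \notin [set h1; h2; h3].
    apply/exists_inP; rewrite -negb_forall_in; apply: contraL gt => /forall_inP all; rewrite -leqNgt.
    have : #|O| <= demand par O h1 + demand par O h2 + demand par O h3.
      apply: leq_trans (_ : #|[set v in O | par v == h1] :|: [set v in O | par v == h2] :|: [set v in O | par v == h3]| <= _).
        apply: subset_leq_card; apply/subsetP=> u uO; have := all u uO.
        by rewrite !inE uO.
      apply: leq_trans (leq_card_setU _ _).1 _; rewrite leq_add2r; exact: (leq_card_setU _ _).1.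
    have := dm_kids h1 ok cF; have := dm_kids h2 ok cF; have := dm_kids h3 ok cF.
    by clear; lia.
  have [u1 u1O n1] := pick h1; have [u2 u2O n2] := pick (par u1).
  move: n1 n2; rewrite !inE !negb_or => /andP[/andP[a1 a2] _] /andP[/andP[b1 b2] b3].
  by exists u1, u2; rewrite !inE !negb_or a1 a2 b1 b2 eq_sym b3.
move=> Rd' U' [u uO st'].
have cm' : #|O :\ u| = m by have := cardsD1 u O; rewrite uO cO => -[->].
have uP : u \notin P by have [[]] := ok _ uO.
have E : P :|: O = u |: P :|: (O :\ u) by rewrite setUAC setD1K // setUC.
rewrite E; apply: (IH _ _ _ _ cm' (ok_step ok uO) _ cF st').
rewrite cardsU1 uP cm'; move: cn; rewrite cO; clear; lia.
Qed.

(** A round lowers the number of unplaced roles outside [Z] plus the number of pending edges.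
    Pending edges are settled as soon as possible; otherwise the role of least rank is placed, whose
    parent is then placed, not pending and not a hub. *)
Lemma phase_rest m P W Rd U : core :|: hub_kids \subset P -> [disjoint P & Z] -> W \subset links ->
  (forall v, v \in P -> v \notin S -> v \notin W -> par v \in P) ->
  #|~: (P :|: Z)| + #|W| <= m -> St P W set0 Rd U ->
  force m (fun Rd' U' => St (~: Z) set0 set0 Rd' U') Rd U.
Proof.
elim: m P W Rd U => [|m IH] P W Rd U PP PZ WL pc cm st.
  have [cA cW] : #|~: (P :|: Z)| = 0 /\ #|W| = 0 by move: cm; clear; lia.
  apply: force_now; have -> : ~: Z = P; last by move/cards0_eq: cW => <-.
  apply/eqP; rewrite eqEsubset -disjoints_subset PZ andbT.
  move/cards0_eq: cA; rewrite setCU => /eqP; rewrite setI_eq0 disjoint_sym disjoints_subset.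
  by rewrite setCK.
have coreP : core \subset P by apply: subset_trans PP; apply: subsetUl.
have SP : S \subset P by apply: subset_trans coreP; rewrite /core -setUA; apply: subsetUl.
have LP : links \subset P by apply: subset_trans coreP; rewrite /core -setUA setUCA; apply: subsetUl.
have QP' : early \subset P by apply: subset_trans coreP; rewrite /core; apply: subsetUr.
have [/existsP[v /andP[vW pP]]|] := boolP [exists v, (v \in W) && (par v \in P)].
  have vL := subsetP WL _ vW.
  have kv : kid v (par v) by rewrite /child notr ?LS // eqxx.
  rewrite -[m.+1]add1n; apply: force_bind.
    apply: (St_link rkP HS LS SrcL LH1 Ladj Srcleaf SrcH st vW kv pP).
    by apply: contra (Ladj vL kv); apply: (subsetP WL).
  move=> Rd' U'; apply: IH => //.
  - by apply: subset_trans WL; apply: subD1set.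
  - move=> u uP uS; have [->//|uv] := eqVneq u v.
    by rewrite !inE uv /=; apply: pc.
  - by have := cardsD1 v W; rewrite vW; move: cm; clear; lia.
rewrite negb_exists => /forallP none.
have pW v : v \in W -> par v \notin P by move=> vW; have := none v; rewrite vW.
have [E|ne] := eqVneq (~: (P :|: Z)) set0.
  have EP : P = ~: Z.
    apply/eqP; rewrite eqEsubset -disjoints_subset PZ /=.
    by move/eqP: E; rewrite setCU setI_eq0 disjoint_sym disjoints_subset setCK.
  have EW : W = set0.
    apply/eqP; rewrite -subset0; apply/subsetP=> v vW; have := pW _ vW.
    by rewrite EP inE par_notZ // (subsetP WL).
  by apply: force_now; rewrite -EP -EW.
have [u uA umin] := min_rk rk ne.
move: (uA); rewrite !inE negb_or => /andP[uP uZ].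
have uS : u \notin S by apply: contra uP; apply: (subsetP SP).
have ur := notr uS.
have puZ : par u \notin Z by apply: contra uZ; apply: Zc.
have puP : par u \in P.
  apply: contraT => npu; have := umin (par u); rewrite !inE negb_or npu puZ => /(_ isT).
  by rewrite leqNgt rkP.
(* A pending parent of [u] would be a link with an unplaced parent outside [Z], of smaller rank than
   [u]. *)
have puW : par u \notin W.
  apply/negP => pW'; have pL := subsetP WL _ pW'; have := umin (par (par u)).
  rewrite !inE negb_or pW // par_notZ // => /(_ isT); rewrite leqNgt.
  by rewrite (ltn_trans _ (rkP ur)) // rkP // notr // LS.
have puH : par u \notin H.
  apply: contra uP => pH; have [uP1|uP1] := boolP (u \in core); first exact: (subsetP coreP).
  by apply: (subsetP PP); rewrite in_setU /hub_kids inE uP1 uZ pH orbT.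
have uL : u \notin links by apply: contra uP; apply: (subsetP LP).
rewrite -[m.+1]add1n; apply: force_bind.
  apply: (St_T2pool rS HS LS SrcL Srcleaf SrcS st uP (w := par u) _ _ puP puW puH).
  - by apply: contra uP => uSrc; apply: (subsetP QP'); rewrite in_setU uSrc orbT.
  - by rewrite /child ur eqxx.
  - move=> v vP kv; apply: contraT => vW; have [vS|vS] := boolP (v \in S).
      by have := up1_notin uS uL uZ vS; rewrite kv.
    by have := pc _ vP vS vW; case/andP: kv => _ /eqP ->; rewrite (negPf uP).
  (* The reserve provides the room: [#|Z|] is at least [tau + 5], and the non-hub [par u] has at
     most [tau] children. *)
  - have d2 : #|P| + #|W| + #|set0 : {set V}| + #|Z| <= n.
      by apply: card_WP => //; [exact: sub0set|move=> v _; rewrite inE].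
    have d1 := degtau puH; rewrite cards0 in d2; rewrite /kids in d1.
    move: d1 d2 cardZ; clear; lia.
move=> Rd' U'; apply: IH => //.
- by apply: subset_trans PP _; apply: subsetUr.
- by rewrite disjoints_subset subUset sub1set inE uZ -disjoints_subset.
- move=> v; rewrite !in_setU1 => /orP[/eqP->|vP] vS vW; first by rewrite puP orbT.
  by rewrite pc ?orbT.
- have : #|~: (P :|: Z)| = (#|~: ((u |: P) :|: Z)|).+1.
    rewrite (cardsD1 u) uA add1n; congr _.+1; apply: eq_card => v.
    by rewrite !inE !negb_or andbA.
  by move: cm; clear; lia.
Qed.

Lemma card_links : #|links| <= #|S|.
Proof.
apply: leq_trans (leq_imset_card par (mem S)); apply: subset_leq_card; apply/subsetP=> v /Lkid[b bS].
by case/andP=> _ /eqP <-; apply: imset_f.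
Qed.

Lemma card_early : #|early| <= #|S| + #|Src|.
Proof.
apply: leq_trans (leq_card_setU _ _).1 _; rewrite leq_add2r.
apply: leq_trans card_links; apply: leq_trans (leq_imset_card par (mem links)).
apply: subset_leq_card; apply/subsetP=> g; rewrite inE => /and5P[_ _ _ _ /existsP[v /andP[vL /andP[_ /eqP <-]]]].
exact: imset_f.
Qed.

Lemma fr_Kn (x y : 'I_n) : unclaimed (Kn n) x y = (x != y).
Proof. by rewrite /unclaimed inE cards2; case: (x == y). Qed.

Lemma init_St : exists2 F : {set 'I_n}, n <= #|F| + #|tops| & St tops set0 F set0 (Kn n).
Proof.
pose f v := cast_ord cardV (enum_rank v).
have finj : injective f by move=> x y /cast_ord_inj/enum_rank_inj.
exists (~: (f @: tops)).
  by have := cardsC (f @: tops); rewrite card_imset // card_ord addnC => ->.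
exists f, f; split.
- exact: sub0set.
- exact: sub0set.
- by move=> x y _ _; apply: finj.
- by move=> x y; rewrite inE.
- by move=> v; rewrite inE.
- by move=> x; rewrite inE => xT; split=> // [|u ux]; rewrite ?imset0 ?inE ?fr_Kn.
- move=> v; rewrite inE => /andP[_ pv] /negPf vr; rewrite vr /= in pv.
  by rewrite inE (negPf pv).
- by move=> v b; rewrite inE.
- by move=> a b; rewrite /red_edge inE.
- by move=> x y _ _; rewrite fr_Kn.
- move=> x xT; rewrite /hub_losses (_ : [set h in _ | _] = set0) ?cards0 //.
  apply/setP=> h; rewrite !inE fr_Kn negbK; apply/negP => /andP[/andP[_ hT] /eqP E].
  by move: xT; rewrite -E imset_f // inE.
- by move=> v u; rewrite inE.
- move=> w wT _; rewrite /losses (_ : [set h | _] = set0) ?cards0 //.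
  apply/setP=> x; rewrite !inE fr_Kn negbK; apply/negP => /andP[xT /eqP E].
  by rewrite -E imset_f in xT.
- by move=> y u /SrcS; rewrite inE => /negPf->.
Qed.

(** The excess over [n] rounds is at most [#|S|] for the skeleton, two rounds per link for the
    candidates, and again two per link reserved for settling its parent edge, once before and once
    after the hub phase. The other roles form disjoint sets and take one round each. *)
Theorem machine : force (n + 5 * #|S|)
  (fun Rd U => exists f alt, @Inv n V r par H S links Src (~: Z) set0 f alt set0 Rd U) set0 (Kn n).
Proof.
have [F0 cF0 st0] := init_St.
have topsS : tops \subset S by apply/subsetP=> b; rewrite inE => /andP[].
have cS : #|tops| + #|S :\: tops| = #|S| by rewrite -(cardsID tops S) (setIidPr topsS).
have big := nbig; rewrite /N1 in big.
have cL := card_links; have cQ := card_early.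
have dPZ : [disjoint core & Z].
  rewrite disjoint_sym disjoints_subset; apply/subsetP=> u uZ; rewrite inE /core 2!in_setU !negb_or.
  rewrite ZS //=; apply/andP; split; first by apply: contraL uZ => /LZ.
  by apply: contraL uZ => /earlyP[].
set T1 := #|S :\: tops|; set T2 := 2 * #|links|; set T3 := #|early|.
set rest := #|~: (core :|: hub_kids :|: Z)|.
have cO : #|early| + #|hub_kids| + rest <= n.
  have d1 : [disjoint early & hub_kids].
    rewrite disjoint_sym disjoints_subset; apply/subsetP=> u uO; rewrite inE.
    by have [] := hub_kidsP uO.
  have d2 : [disjoint early :|: hub_kids & ~: (core :|: hub_kids :|: Z)].
    rewrite disjoints_subset setCK; apply/subsetP=> u /setUP[uQ|uO]; apply/setUP; left.
      by apply/setUP; left; apply/setUP; right.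
    by apply/setUP; right.
  move: d1 d2; rewrite -!leq_card_setU => /eqP d1 /eqP d2.
  by rewrite /rest -d1 -d2 -[X in _ <= X]cardV -cardsT; apply: subset_leq_card; apply: subsetT.
apply: (@force_leq _ (T1 + (T2 + (T3 + (#|links| + (#|hub_kids| + (rest + #|links|))))))).
  by move: cO cL cS; rewrite /T1 /T2 /T3; clear; lia.
apply: force_bind.
  apply: (phase_S (subxx _) topsS _ _ _ st0) => //; first by move=> b ->.
  by apply: (le_supply cF0); move: cS big; clear; lia.
move=> Rd1 U1 [F1 cF1 st1]; have c1 := le_chain_l cF0 cF1; apply: force_bind.
  apply: (@phase_L _ set0 F1 _ _ (sub0set _)); rewrite ?setD0 ?setU0 //.
  by apply: (le_supply c1); move: cS big cL; rewrite /T1; clear; lia.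
move=> Rd2 U2 [F2 cF2 st2]; have c2 := le_chain_l c1 cF2; apply: force_bind.
  apply: (@phase_early _ set0 F2 _ _ (sub0set _)); rewrite ?setD0 ?setU0 //.
  by apply: (le_supply c2); move: cS big cL cQ; rewrite /T1; clear; lia.
move=> Rd3 U3 [F3 cF3 st3]; have c3 := le_chain_l c2 cF3; apply: force_bind.
  exact: (phase_link (subxx links) (leqnn _) st3).
move=> Rd4 U4 [W [WL pW pW' st4]].
have SP : S \subset core by rewrite /core -setUA; apply: subsetUl.
have HP : H \subset core by apply: subset_trans SP.
apply: force_bind.
  apply: (phase_O (erefl _) ok_start _ _ st4).
    apply: card_WP => //.
      apply/subsetP=> u; rewrite /hub_kids in_set => /and3P[a b _].
      by rewrite in_setC in_setU negb_or a b.
    move=> v vW; apply: contra (pW _ vW) => /hub_kidsP[uS uL uQ uZ pH].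
    have vL := subsetP WL _ vW; case/negP: uQ; rewrite /early in_setU /gates inE uS uL uZ pH /=.
    apply/orP; left; apply/existsP; exists v; rewrite vL /child notr ?LS //= eqxx.
  by apply: (leq_trans c3); rewrite leq_add2l; move: cS cL cQ; rewrite /T1 /N1; clear; lia.
move=> Rd5 U5 st5.
apply: (phase_rest (subxx _) _ WL _ _ st5).
- rewrite disjoint_sym disjoints_subset; apply/subsetP=> u uZ; rewrite in_setC in_setU negb_or.
  by rewrite (disjointFl dPZ uZ) /=; apply: contraL uZ => /hub_kidsP[].
- move=> v; rewrite in_setU => /orP[|/hub_kidsP[_ _ _ _ pH] _ _]; last by rewrite in_setU (subsetP HP).
  rewrite /core 2!in_setU => /orP[/orP[->//|vL]|/earlyP[_ _ _ pH]] vS vW.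
    by rewrite in_setU pW'.
  by rewrite in_setU (subsetP HP).
- by rewrite leq_add2l; apply: subset_leq_card.
Qed.

End Phases.

(** * Completing spread-out leaves *)

Section FinishLeaves.
Variable n : nat.
Variables (V : finType) (r : V) (par : V -> V) (H : {set V}).
Hypothesis cardV : #|V| = n.
Notation kid := (child r par).
Implicit Types (Zr A T : {set V}) (f g : V -> 'I_n) (I : {set 'I_n}) (Rd U : graph n).

Definition emb f Rd := injective f /\ forall v, v != r -> red_edge Rd (f v) (f (par v)).

Definition hubleaf m := [&& m != r, m \notin H, par m \in H & [forall v, ~~ kid v m]].

Lemma hubleafP m : hubleaf m -> [/\ m != r, m \notin H, par m \in H & forall v, ~~ kid v m].
Proof. by case/and4P=> ? ? ? /forallP. Qed.

Lemma hubleaf_par m v : hubleaf m -> v != r -> par v != m.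
Proof.
by case/hubleafP=> _ _ _ /(_ v) nk vr; apply: contra nk => /eqP pv; rewrite /child vr pv eqxx.
Qed.

(* [g] embeds every role outside [Z1], with image [I], moving no hub and no role of [A]. *)
Definition except Z1 A I f Rd g := [/\ {in ~: Z1 &, injective g}, g @: (~: Z1) = I,
  forall v, v \notin Z1 -> v != r -> red_edge Rd (g v) (g (par v)),
  forall h, h \in H -> g h = f h & forall y, y \in A -> g y = f y].

Definition pure A f U := forall y u, y \in A -> u != f y -> u != f (par y) -> unclaimed U u (f y).

Definition few I f U := forall x, x \notin I -> #|[set h in H | ~~ unclaimed U (f h) x]| <= 2.

(** Three is the largest number of hubs already in use when a further alternative is sought. *)
Definition spread k A := forall T, #|T| <= 3 -> k <= #|[set y in A | par y \notin T]|.

(* All the roles of [D], one per hub, can play the part of the single missing role. *)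
Definition alts k D Zr A I f Rd U := [/\ size D = k, uniq (map par D),
  (forall m, m \in D -> [/\ hubleaf m, m \notin A, m \notin Zr
     & exists g, except (m |: Zr) A I f Rd g]),
  pure A f U & few I f U].

Lemma spread_sub k A y y' : spread (k + 2) A -> spread k (A :\ y :\ y').
Proof.
move=> sp T cT; have := sp T cT.
have E : [set z in A :\ y :\ y' | par z \notin T] = [set z in A | par z \notin T] :\ y :\ y'.
  by apply/setP=> z; rewrite !inE -!andbA.
rewrite E => le; have := leq_trans le (cardsD2_ge _ y y'); by rewrite leq_add2r.
Qed.

Lemma transfer k D Zr A I f Rd U : 0 < k <= 3 ->
  (forall y, y \in A -> hubleaf y && (y \notin Zr)) -> [disjoint H & Zr] ->
  {in H :|: A &, injective f} -> (forall v, v \in H :|: A -> f v \in I) ->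
  spread 2 A -> alts k D Zr A I f Rd U ->
  force 1 (fun Rd' U' => exists D' y y', alts k.+1 D' Zr (A :\ y :\ y') I f Rd' U') Rd U.
Proof.
move=> k3 AP HZ finj fI sp [sD uD altD pA fewU].
case: D sD uD altD => [|m D] sD uD altD; first by move: k3; rewrite -sD.
have [mhl mA mZ [g [ginj gI gred gH gA]]] := altD m (mem_head _ _).
have [mr mH pmH nk] := hubleafP mhl.
have cT : #|[set h in map par (m :: D)]| <= 3.
  by rewrite cardsE; apply: leq_trans (card_size _) _; rewrite size_map sD; case/andP: k3.
have [[|y [|y' [|? ?]]] [] // _ /= /andP[yy _] sY] := pick_set (sp _ cT).
have : y \in [set y in A | par y \notin [set h in map par (m :: D)]] by apply: sY; rewrite inE eqxx.
have : y' \in [set y in A | par y \notin [set h in map par (m :: D)]] by apply: sY; rewrite !inE eqxx orbT.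
rewrite inE in yy; rewrite !inE !negb_or => /and3P[y'A y'm y'D] /and3P[yA ym yD].
have fne u v : u \in H :|: A -> v \in H :|: A -> u != v -> f u != f v.
  by move=> uH vH; apply: contraNneq => /finj->.
have inH h : h \in H -> h \in H :|: A by move=> hH; rewrite in_setU hH.
have inA a : a \in A -> a \in H :|: A by move=> hH; rewrite in_setU hH orbT.
have HAn h a : h \in H -> a \in A -> h != a.
  by move=> hH /AP/andP[/hubleafP[_ aH _ _] _]; apply: contraNneq aH => <-.
have free a : a \in A -> par a != par m -> unclaimed U (f (par m)) (f a).
  move=> aA pam; have /andP[/hubleafP[_ _ paH _] _] := AP _ aA.
  apply: pA => //; first by apply: (fne _ _ (inH _ pmH) (inA _ aA)); apply: HAn.
  by apply: (fne _ _ (inH _ pmH) (inH _ paH)); rewrite eq_sym.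
have fyy : f y != f y' by rewrite fne ?inA.
apply: (force_offer (free _ yA ym) (free _ y'A y'm) fyy) => z q Rd' U' zq HU HR.
apply: force_now.
have [y0 [q0 [zE qE y0A q0A y0q0]]] : exists y0 q0, [/\ z = f y0, q = f q0, y0 \in A, q0 \in A & y0 != q0].
  by case: zq => -[-> ->]; [exists y, y'|exists y', y]; rewrite ?(eq_sym y').
have [y0m y0D] : par y0 != par m /\ par y0 \notin map par D.
  by case: zq => -[E1 E2]; have /finj := etrans (esym zE) E1; rewrite !inA // => ->.
subst z q; exists [:: y0, m & D], y0, q0.
have /andP[y0hl y0Z] := AP _ y0A; have [y0r y0H py0H y0k] := hubleafP y0hl.
have AA x : x \in A :\ y0 :\ q0 -> [/\ x != q0, x != y0 & x \in A].
  by rewrite !in_setD1 => /and3P[].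
split.
- by rewrite -sD.
- by rewrite /= in_cons negb_or y0m y0D -[_ && _]/(uniq (map par (m :: D))).
- move=> u; rewrite in_cons => /orP[/eqP->|uD'].
    split=> //; first by rewrite !inE eqxx andbF.
    have y0nm : y0 != m by apply: contraNneq mA => <-.
    have mh h : h \in H -> h != m by move=> hH; apply: contraNneq mH => <-.
    have hm v : v \notin y0 |: Zr -> v != m -> v \notin m |: Zr.
      by rewrite !in_setU1 !negb_or => /andP[_ ->] ->.
    have gy0 : g y0 = f y0 by apply: gA.
    have y0o : y0 \in ~: (m |: Zr) by rewrite !inE negb_or y0nm.
    have gn v : v \notin y0 |: Zr -> v != m -> g v != f y0.
      move=> vZ vm; have vo := hm _ vZ vm; rewrite -gy0.
      apply: contraTneq vZ => E; rewrite (ginj v y0) ?setU11 // in_setC //.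
    exists (updf g m (f y0)); split.
    + move=> u1 u2; rewrite !in_setC => u1Z u2Z.
      have [->|n1] := eqVneq u1 m; have [->|n2] := eqVneq u2 m; rewrite ?updf_eq ?updf_neq //.
      * by move=> E; have := gn _ u2Z n2; rewrite -E eqxx.
      * by move=> E; have := gn _ u1Z n1; rewrite E eqxx.
      * by apply: ginj; rewrite in_setC hm.
    + have -> : ~: (y0 |: Zr) = m |: (~: (m |: Zr) :\ y0).
        apply/setP=> v; rewrite !inE !negb_or.
        have [->|vm] /= := eqVneq v m; first by rewrite eq_sym y0nm.
        by [].
      rewrite imset_updf; last by rewrite !inE eqxx !andbF.
      by rewrite -gI -gy0 -imsetU1 setD1K.
    + move=> v vZ vr; have pvm := hubleaf_par mhl vr; rewrite [in X in red_edge _ _ X](updf_neq _ _ pvm).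
      have [->|vm] := eqVneq v m; last by rewrite updf_neq //; apply: (updR_sub HR); apply: gred => //; apply: hm.
      by rewrite updf_eq (gH _ pmH) rdC; apply: updR_new HR.
    + by move=> h hH; rewrite updf_neq ?gH // mh.
    + by move=> x /AA[_ _ xA]; rewrite updf_neq ?gA //; apply: contraNneq mA => <-.
  have [h1 h2 h3 [g' [i1 i2 i3 i4 i5]]] := altD u uD'; split=> //.
    by apply: contra h2 => /AA[].
  exists g'; split=> //; first by move=> v vZ vr; apply: (updR_sub HR); apply: i3.
  by move=> x /AA[_ _ /i5].
- move=> x u /AA[xq xy xA] ux upx; rewrite (upd_n HU); first exact: pA.
  + by apply: (fne _ _ (inA _ xA) (inH _ pmH)); rewrite eq_sym; apply: HAn.
  + exact: (fne _ _ (inA _ xA) (inA _ y0A)).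
  + exact: (fne _ _ (inA _ xA) (inA _ q0A)).
- move=> x xI; apply: leq_trans (fewU x xI); apply: subset_leq_card; apply/subsetP=> h.
  have nx v : v \in H :|: A -> x != f v by move=> /fI; apply: contraTneq => <-.
  rewrite !inE => /andP[hH]; rewrite hH (upd_n HU) //.
  + exact: (nx _ (inH _ pmH)).
  + exact: (nx _ (inA _ y0A)).
  + exact: (nx _ (inA _ q0A)).
Qed.

Definition QInv Zr A f Rd U := [/\ (forall z, z \in Zr -> hubleaf z),
  (forall y, y \in A -> hubleaf y && (y \notin Zr)),
  except Zr A (f @: (~: Zr)) f Rd f, pure A f U & few (f @: (~: Zr)) f U].

Lemma finish_one k Zr A f Rd U : #|Zr| = k.+1 -> spread (6 * k.+1) A -> QInv Zr A f Rd U ->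
  force 4 (fun Rd' U' => exists Zr' A' f', [/\ #|Zr'| = k, spread (6 * k) A' & QInv Zr' A' f' Rd' U']) Rd U.
Proof.
move=> cZ sp [ZP AP [finj _ fred _ _] pA fewU].
have [v0 v0Z] : exists v0, v0 \in Zr by apply/set0Pn; rewrite -card_gt0 cZ.
set Z0 := Zr :\ v0; have cZ0 : #|Z0| = k by have := cardsD1 v0 Zr; rewrite v0Z cZ => -[].
have ZE : v0 |: Z0 = Zr by rewrite setD1K.
have ZZ0 z : z \in Z0 -> z \in Zr by case/setD1P.
set I := f @: (~: Zr).
have HZ : [disjoint H & Zr].
  by rewrite disjoint_sym disjoints_subset; apply/subsetP=> z /ZP/hubleafP[_ zH _ _]; rewrite inE.
have HA A' v : A' \subset A -> v \in H :|: A' -> v \notin Zr.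
  move=> A'A; rewrite in_setU => /orP[vH|/(subsetP A'A)/AP/andP[]//].
  by rewrite (disjointFr HZ vH).
have step k' D A' Rd1 U1 : A' \subset A -> 0 < k' <= 3 -> spread 2 A' -> alts k' D Z0 A' I f Rd1 U1 ->
  force 1 (fun Rd' U' => exists D' y y', alts k'.+1 D' Z0 (A' :\ y :\ y') I f Rd' U') Rd1 U1.
  move=> A'A k3 sp' al; apply: transfer k3 _ _ _ _ sp' al.
  - move=> y /(subsetP A'A)/AP/andP[-> yZ]; apply: contra yZ; exact: ZZ0.
  - by apply: disjointWr HZ; apply: subD1set.
  - by move=> u v uH vH; apply: finj; rewrite in_setC (HA A').
  - by move=> v vH; apply: imset_f; rewrite in_setC (HA A').
have spE : 6 * k.+1 = 6 * k + 2 + 2 + 2 by clear; lia.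
rewrite spE in sp.
have sp2 m A' : spread (m + 2) A' -> spread 2 A'.
  by move=> s T cT; apply: leq_trans (s T cT); rewrite leq_addl.
rewrite -[4]/(1 + (1 + (1 + 1))); apply: force_bind.
  apply: (step 1 [:: v0] A) => //; first exact: sp2 sp.
  split=> // m; rewrite inE => /eqP->; split.
  - exact: ZP.
  - by apply/negP => /AP; rewrite v0Z andbF.
  - by rewrite !inE eqxx.
  - by exists f; rewrite ZE; split.
move=> Rd1 U1 [D1 [y1 [y1' al1]]].
have sp1 := spread_sub y1 y1' sp.
have sub1 : A :\ y1 :\ y1' \subset A by do 2![apply: subset_trans (subD1set _ _) _].
apply: force_bind; first by apply: (step _ _ _ _ _ sub1 _ (sp2 _ _ sp1) al1).
move=> Rd2 U2 [D2 [y2 [y2' al2]]].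
have sp3 := spread_sub y2 y2' sp1.
have sub2 : A :\ y1 :\ y1' :\ y2 :\ y2' \subset A.
  by do 2![apply: subset_trans (subD1set _ _) _].
apply: force_bind; first by apply: (step _ _ _ _ _ sub2 _ (sp2 _ _ sp3) al2).
move=> Rd3 U3 [D3 [y3 [y3' [sD uD altD pA3 few3]]]].
have sp4 := spread_sub y3 y3' sp3.
set A3 := A :\ _ :\ _ :\ _ :\ _ :\ _ :\ _ in altD pA3 sp4.
have sub3 : A3 \subset A by do 2![apply: subset_trans (subD1set _ _) _].
have [x xI] : exists x, x \notin I.
  apply/existsP; rewrite -negb_forall; apply/negP => /forallP all.
  have : #|[set: 'I_n]| <= #|I| by apply: subset_leq_card; apply/subsetP=> x _; apply: all.
  rewrite cardsT card_ord card_in_imset // -cardV -[in X in X <= _](cardsC Zr) cZ.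
  by clear; lia.
pose bad := [set h in H | ~~ unclaimed U3 (f h) x].
have cbad : #|bad| <= 2 by apply: few3.
have [m1 [m2 [m1D m2D m12 b1 b2]]] : exists m1 m2, [/\ m1 \in D3, m2 \in D3, par m1 != par m2,
    par m1 \notin bad & par m2 \notin bad].
  have : 2 <= #|[set h in map par D3] :\: bad|.
    have := cardsID bad [set h in map par D3].
    have : #|[set h in map par D3]| = 4 by rewrite cardsE (card_uniqP uD) size_map sD.
    have : #|[set h in map par D3] :&: bad| <= 2.
      by apply: leq_trans cbad; apply: subset_leq_card; apply: subsetIr.
    by move=> a b; rewrite b; move: a; clear; lia.
  case/card_gt1P=> h1 [h2 []]; rewrite !inE => /andP[n1 /mapP[m1 m1D E1]] /andP[n2 /mapP[m2 m2D E2]] h12.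
  by exists m1, m2; rewrite -E1 -E2 m1D m2D h12 !inE n1 n2.
have hub m : m \in D3 -> [/\ par m \in H & par m \notin bad -> unclaimed U3 x (f (par m))].
  move=> mD; have [/hubleafP[_ _ pH _] _ _ _] := altD m mD; split=> // nb.
  by rewrite frC; apply: contraR nb => nf; rewrite inE pH.
have [p1H fr1] := hub _ m1D; have [p2H fr2] := hub _ m2D.
have fH h h' : h \in H -> h' \in H -> f h = f h' -> h = h'.
  by move=> hH h'H; apply: finj; rewrite in_setC (HA A) // in_setU ?hH ?h'H.
have p12 : f (par m1) != f (par m2) by apply: contra m12 => /eqP /fH ->.
apply: (force_offer (fr1 b1) (fr2 b2) p12) => z q Rd4 U4 zq HU HR; apply: force_now.
have [m [q0 [mD zE qE q0H]]] : exists m q0, [/\ m \in D3, z = f (par m), q = f q0 & q0 \in H].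
  by case: zq => -[-> ->]; [exists m1, (par m2)|exists m2, (par m1)]; split.
subst z q; have [mhl mA mZ [g [ginj gI gred gH gA]]] := altD m mD.
have [mr mH pmH nk] := hubleafP mhl.
have mE : ~: Z0 = m |: ~: (m |: Z0).
  apply/setP=> v; rewrite in_setC in_setU1 in_setC in_setU1 negb_or.
  by case: (eqVneq v m) => [->|] //=.
have mo : m \notin ~: (m |: Z0) by rewrite in_setC setU11.
have im : updf g m x @: (~: Z0) = x |: I by rewrite mE imset_updf // gI.
have gx v : v \notin m |: Z0 -> g v != x.
  by move=> vo; apply: contraNneq xI => <-; rewrite -gI; apply: imset_f; rewrite in_setC.
have vo v : v \notin Z0 -> v != m -> v \notin m |: Z0 by rewrite in_setU1 negb_or => -> ->.
have xf v : v \notin Zr -> x != f v.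
  by move=> vZ; apply: contraNneq xI => ->; apply: imset_f; rewrite in_setC.
have A3m y : y \in A3 -> y != m by move=> yA; apply: contraNneq mA => <-.
have Hm h : h \in H -> h != m by move=> hH; apply: contraNneq mH => <-.
have HZr h : h \in H -> h \notin Zr by move=> hH; rewrite (disjointFr HZ hH).
exists Z0, A3, (updf g m x); split=> //; split.
- by move=> z /ZZ0; apply: ZP.
- by move=> y /(subsetP sub3)/AP/andP[-> yZ]; apply: contra yZ; apply: ZZ0.
- split.
  + move=> u v; rewrite !in_setC => uZ vZ.
    have [->|um] := eqVneq u m; have [->|vm] := eqVneq v m; rewrite ?updf_eq ?updf_neq //.
    * by move=> E; have := gx _ (vo _ vZ vm); rewrite -E eqxx.
    * by move=> E; have := gx _ (vo _ uZ um); rewrite E eqxx.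
    * by apply: ginj; rewrite in_setC vo.
  + by [].
  + move=> v vZ vr; have pvm := hubleaf_par mhl vr; rewrite [in X in red_edge _ _ X](updf_neq _ _ pvm).
    have [->|vm] := eqVneq v m; first by rewrite updf_eq (gH _ pmH); apply: updR_new HR.
    by rewrite updf_neq //; apply: (updR_sub HR); apply: gred => //; apply: vo.
  + by [].
  + by [].
- move=> y u yA; have yA' := subsetP sub3 _ yA.
  have /andP[/hubleafP[_ yH pyH _] yZ] := AP _ yA'.
  have ne h : h \in H -> f y != f h.
    move=> hH; apply: contraNneq yH => E; rewrite (_ : y = h) //.
    by apply: finj; rewrite // in_setC // HZr.
  have -> : updf g m x y = f y by rewrite updf_neq ?gA // A3m.
  have -> : updf g m x (par y) = f (par y) by rewrite updf_neq ?gH // Hm.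
  move=> u1 u2; rewrite (upd_n HU) ?pA3 //.
  + by rewrite eq_sym xf.
  + exact: ne.
  + exact: ne.
- move=> x'; rewrite im in_setU1 negb_or => /andP[x'x x'I].
  apply: leq_trans (few3 _ x'I); apply: subset_leq_card; apply/subsetP=> h.
  rewrite !inE => /andP[hH]; rewrite hH updf_neq ?Hm // gH // (upd_np HU) //.
  by rewrite eq_sym xf // HZr.
Qed.

Lemma finish_leaves k Zr A f Rd U : #|Zr| = k -> spread (6 * k) A -> QInv Zr A f Rd U ->
  force (4 * k) (fun Rd' _ => exists f', emb f' Rd') Rd U.
Proof.
elim: k Zr A f Rd U => [|k IH] Zr A f Rd U cZ sp Q.
  apply: force_now; exists f; move: Q; rewrite (cards0_eq cZ) => -[_ _ [finj _ fred _ _] _ _].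
  by split=> [u v|v vr]; [apply: finj; rewrite !inE|apply: fred; rewrite ?inE].
rewrite mulnS; apply: force_bind; first exact: finish_one cZ sp Q.
by move=> Rd' U' [Z' [A' [f' [cZ' sp' Q']]]]; apply: IH cZ' sp' Q'.
Qed.
End FinishLeaves.

(** * Completing a bare path *)

Section TwoPaths.
Variable n : nat.
Implicit Types (p q : seq 'I_n) (Rd U : graph n).
Variables (s t : 'I_n) (Un B : {set 'I_n}).
Hypotheses (st : s != t) (sUn : s \notin Un) (tUn : t \notin Un) (BUn : B \subset Un).

Definition rest p q := [set x in Un | x \notin p ++ q].

(* Red paths [s :: p] and [t :: q] inside [Un]; the reserve [B] stays away from the first
   eight vertices of [p], which will serve for the final rotation. *)
Record two_paths p q Rd U : Prop := TwoPaths {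
  tp_uniq : uniq (p ++ q);
  tp_Un : {subset p ++ q <= Un};
  tp_p : path (red_edge Rd) s p;
  tp_q : path (red_edge Rd) t q;
  tp_rest : forall x y, x \in rest p q -> y \in rest p q -> x != y -> unclaimed U x y;
  tp_ep : forall x, x \in rest p q -> unclaimed U (last s p) x;
  tp_eq : forall x, x \in rest p q -> unclaimed U (last t q) x;
  tp_B : forall y, y \in take 8 p -> y \notin B /\ forall b, b \in B -> unclaimed U y b;
  tp_far : (9 <= size p) || all [predC B] (p ++ q) }.

Lemma rest_rconsl p q z : rest (rcons p z) q = rest p q :\ z.
Proof. by apply/setP=> x; rewrite !inE cat_rcons !mem_cat inE orbCA negb_or andbCA. Qed.

Lemma rest_rconsr p q z : rest p (rcons q z) = rest p q :\ z.
Proof. by apply/setP=> x; rewrite !inE !mem_cat mem_rcons inE orbCA negb_or andbCA. Qed.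

Section Grow.
Variables (p q : seq 'I_n) (Rd U : graph n).
Hypothesis TP : two_paths p q Rd U.
Variables (z : 'I_n) (Rd' U' : graph n).
Hypotheses (zr : z \in rest p q) (zB : (9 <= size p) || (z \notin B)).
Hypothesis Rsub : forall a b, red_edge Rd a b -> red_edge Rd' a b.
Hypothesis K2 : forall y b, y \in take 8 p -> b \in B -> unclaimed U y b -> unclaimed U' y b.

Let zn : [/\ z \in Un, z \notin p & z \notin q].
Proof. by move: zr; rewrite inE mem_cat negb_or => /and3P[]. Qed.

Let inr x a : a \in rest p q -> a \in x |: rest p q.
Proof. by move=> h; rewrite in_setU1 h orbT. Qed.

Let far_z : (9 <= size p) || all [predC B] (z :: p ++ q).
Proof. by have := tp_far TP; case: (9 <= size p) zB => //= zB' ->; rewrite zB'. Qed.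

Lemma grow_p : red_edge Rd' (last s p) z ->
  (forall a b, a \in last t q |: rest p q -> b \in rest p q :\ z -> unclaimed U a b -> unclaimed U' a b) ->
  two_paths (rcons p z) q Rd' U'.
Proof.
move=> red K1; have [zU zp zq] := zn.
constructor; rewrite ?rest_rconsl.
- have := tp_uniq TP; rewrite cat_rcons !cat_uniq /= zq (negPf zp) /=.
  by case/and3P=> -> -> ->.
- by move=> x; rewrite cat_rcons mem_cat inE orbCA -mem_cat => /orP[/eqP->//|/(tp_Un TP)].
- by rewrite rcons_path red andbT; apply: sub_path (tp_p TP).
- exact: sub_path (tp_q TP).
- move=> x y /setD1P[xz xr] yr xy; apply: K1 => //; first exact: inr.
  by apply: (tp_rest TP) => //; case/setD1P: yr.
- move=> x xr; rewrite last_rcons; apply: K1 => //; first exact: inr.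
  by case/setD1P: xr => xz xr; apply: (tp_rest TP); rewrite // eq_sym.
- move=> x xr; apply: K1 => //; first by rewrite setU11.
  by case/setD1P: xr => _; apply: (tp_eq TP).
- have old y : y \in take 8 p -> y \notin B /\ forall b, b \in B -> unclaimed U' y b.
    by move=> yp; have [yB yb] := tp_B TP yp; split=> // b bB; apply: K2 => //; apply: yb.
  move=> y; rewrite -cats1 take_cat; case: ltnP => [s8|s8]; first exact: old.
  have s9 : (9 <= size p) = false by rewrite ltnNge s8.
  have /andP[zB' /allP dB] : all [predC B] (z :: p ++ q) by have := far_z; rewrite s9.
  rewrite mem_cat => /orP[yp|/mem_take]; first by apply: old; rewrite take_oversize.
  rewrite inE => /eqP->.
  split=> // b bB; have bz : b != z by apply: contraNneq zB' => <-.
  have br : b \in rest p q.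
    by rewrite inE (subsetP BUn) //=; apply: contraTN bB => /dB.
  by apply: K1; [apply: inr|rewrite in_setD1 bz|apply: (tp_rest TP); rewrite // eq_sym].
- have := far_z; rewrite size_rcons => /orP[s9|dB]; first by rewrite (leq_trans s9).
  by rewrite (eq_all_r (_ : _ =i z :: p ++ q)) ?dB ?orbT // => x; rewrite cat_rcons mem_cat !inE mem_cat orbCA.
Qed.

Lemma grow_q : red_edge Rd' (last t q) z ->
  (forall a b, a \in last s p |: rest p q -> b \in rest p q :\ z -> unclaimed U a b -> unclaimed U' a b) ->
  two_paths p (rcons q z) Rd' U'.
Proof.
move=> red K1; have [zU zp zq] := zn.
constructor; rewrite ?rest_rconsr.
- have := tp_uniq TP; rewrite !cat_uniq rcons_uniq has_rcons (negPf zp) zq /=.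
  by case/and3P=> -> -> ->.
- move=> x; rewrite mem_cat mem_rcons inE orbCA -mem_cat => /orP[/eqP->//|/(tp_Un TP)//].
- exact: sub_path (tp_p TP).
- by rewrite rcons_path red andbT; apply: sub_path (tp_q TP).
- move=> x y /setD1P[xz xr] yr xy; apply: K1 => //; first exact: inr.
  by apply: (tp_rest TP) => //; case/setD1P: yr.
- move=> x xr; apply: K1 => //; first by rewrite setU11.
  by case/setD1P: xr => _; apply: (tp_ep TP).
- move=> x xr; rewrite last_rcons; apply: K1 => //; first exact: inr.
  by case/setD1P: xr => xz xr; apply: (tp_rest TP); rewrite // eq_sym.
- by move=> y yp; have [yB yb] := tp_B TP yp; split=> // b bB; apply: K2 => //; apply: yb.
- have := far_z => /orP[->//|dB].
  rewrite (eq_all_r (_ : _ =i z :: p ++ q)) ?dB ?orbT // => x.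
  by rewrite mem_cat mem_rcons !inE mem_cat orbCA.
Qed.
End Grow.

Lemma last_neq_rest (a : 'I_n) p x : a \notin Un -> x \in Un -> x \notin p -> x != last a p.
Proof.
move=> aU xU xp; suff : x \notin a :: p by apply: contraNneq => ->; apply: mem_last.
by rewrite inE negb_or xp andbT; apply: contraNneq aU => <-.
Qed.

Section Steps.
Variables (p q : seq 'I_n) (Rd U : graph n) (G : graph n -> graph n -> Prop).
Hypothesis TP : two_paths p q Rd U.

Let e := last s p.
Let e' := last t q.

Let p_e' y : y \in p -> y != e'.
Proof.
move=> yp; have := mem_last t q; rewrite inE -/e' => /orP[/eqP->|e'q].
  by apply: contraNneq tUn => <-; apply: (tp_Un TP); rewrite mem_cat yp.
have := tp_uniq TP; rewrite cat_uniq => /and3P[_ + _]; apply: contraNneq => E.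
by apply/hasP; exists e' => //; rewrite -E.
Qed.

Lemma ends_neq : e != e'.
Proof.
have := mem_last s p; rewrite inE -/e => /orP[/eqP->|/p_e'//].
have := mem_last t q; rewrite inE -/e' => /orP[/eqP->//|e'q].
by apply: contraNneq sUn => ->; apply: (tp_Un TP); rewrite mem_cat e'q orbT.
Qed.

Let rP x : x \in rest p q -> [/\ x \in Un, x \notin p, x \notin q, x != e & x != e'].
Proof.
rewrite inE mem_cat negb_or => /and3P[xU xp xq]; split=> //; exact: last_neq_rest.
Qed.

Let take_p y : y \in take 8 p -> (9 <= size p) -> y != e.
Proof.
move=> yp s9; have := tp_uniq TP; rewrite cat_uniq => /andP[up _].
have eE : e = last (last s (take 8 p)) (drop 8 p) by rewrite -last_cat cat_take_drop.
have : size (drop 8 p) != 0 by rewrite size_drop subn_eq0 -ltnNge.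
move: up; rewrite -{1}(cat_take_drop 8 p) cat_uniq => /and3P[_ h _].
rewrite eE; case: (drop 8 p) h => // a d h _ /=; apply: contraNneq h => E; apply/hasP.
by exists y => //; rewrite E; apply: (mem_last a d).
Qed.

Let pq_neq y x : y \in p -> x \in rest p q -> y != x.
Proof. by move=> yp /rP[_ xp _ _ _]; apply: contraNneq xp => <-. Qed.

Lemma extend_p m x y : x \in rest p q -> y \in rest p q -> x != y ->
  (9 <= size p) || ((x \notin B) && (y \notin B)) ->
  (forall z Rd' U', z \in [:: x; y] -> two_paths (rcons p z) q Rd' U' -> force m G Rd' U') ->
  force m.+1 G Rd U.
Proof.
move=> xr yr xy sB K; apply: (force_offer (tp_ep TP xr) (tp_ep TP yr) xy) => z w Rd' U' zw HU HR.
have [zr wr zi zB] : [/\ z \in rest p q, w \in rest p q, z \in [:: x; y]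
    & (9 <= size p) || ((z \notin B) && (w \notin B))].
  by case: zw => -[-> ->]; split; rewrite // ?mem_head ?in_cons ?eqxx ?orbT // andbC.
apply: (K z) => //; apply: (grow_p TP zr).
- by move: zB; case: (9 <= _) => //= /andP[].
- by move=> a b; apply: updR_sub HR.
- move=> a b ap bB; have [ap' ] := (mem_take ap, tp_B TP ap) => -[aB _].
  have [az aw] := (pq_neq ap' zr, pq_neq ap' wr).
  case/orP: zB => [s9|/andP[zB wB]].
    by rewrite frC [in X in _ -> X]frC (upd_n HU) ?take_p.
  rewrite (upd_nzw HU) //; [by apply: contraNneq zB => <-|by apply: contraNneq wB => <-].
- exact: updR_new HR.
- move=> a b /setU1P[->|ar] /setD1P[bz br]; rewrite (upd_np HU) // -?/e -?/e'.
  + by rewrite eq_sym ends_neq.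
  + by case: (rP br).
  + by case: (rP ar).
  + by case: (rP br).
Qed.

Lemma extend_q m x y : x \in rest p q -> y \in rest p q -> x != y ->
  (9 <= size p) || ((x \notin B) && (y \notin B)) ->
  (forall z Rd' U', z \in [:: x; y] -> two_paths p (rcons q z) Rd' U' -> force m G Rd' U') ->
  force m.+1 G Rd U.
Proof.
move=> xr yr xy sB K; apply: (force_offer (tp_eq TP xr) (tp_eq TP yr) xy) => z w Rd' U' zw HU HR.
have [zr wr zi zB] : [/\ z \in rest p q, w \in rest p q, z \in [:: x; y]
    & (9 <= size p) || ((z \notin B) && (w \notin B))].
  by case: zw => -[-> ->]; split; rewrite // ?mem_head ?in_cons ?eqxx ?orbT // andbC.
apply: (K z) => //; apply: (grow_q TP zr).
- by move: zB; case: (9 <= _) => //= /andP[].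
- by move=> a b; apply: updR_sub HR.
- move=> a b ap bB; have ap' := mem_take ap.
  by rewrite frC [in X in _ -> X]frC (upd_n HU b (p_e' ap') (pq_neq ap' zr) (pq_neq ap' wr)).
- exact: updR_new HR.
- move=> a b /setU1P[->|ar] /setD1P[bz br]; rewrite (upd_np HU) // -?/e -?/e'.
  + exact: ends_neq.
  + by case: (rP br).
  + by case: (rP ar).
  + by case: (rP br).
Qed.

(** Serves for the last vertex of a batch, when there is no second vertex to offer along with it;
    Client decides which path grows. *)
Lemma extend_either m x : x \in rest p q -> (9 <= size p) || (x \notin B) ->
  (forall Rd' U', two_paths (rcons p x) q Rd' U' \/ two_paths p (rcons q x) Rd' U' -> force m G Rd' U') ->
  force m.+1 G Rd U.
Proof.
move=> xr sB K; have [xU xp xq xe xe'] := rP xr.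
have xe1 : unclaimed U x e by rewrite frC; apply: (tp_ep TP).
have xe2 : unclaimed U x e' by rewrite frC; apply: (tp_eq TP).
apply: (force_offer xe1 xe2 ends_neq) => z w Rd' U' zw HU HR.
have Rsub a b : red_edge Rd a b -> red_edge Rd' a b by apply: updR_sub HR.
have K2 y b : y \in take 8 p -> b \in B -> unclaimed U y b -> unclaimed U' y b.
  move=> yp bB; have yp' := mem_take yp; have [ye' yx] := (p_e' yp', pq_neq yp' xr).
  case/orP: sB => [s9|xB].
    have ye := take_p yp s9.
    by rewrite frC [in X in _ -> X]frC (upd_n HU) //; case: zw => -[E1 E2]; rewrite ?E1 ?E2.
  by rewrite (upd_np HU) //; apply: contraNneq xB => <-.
have K1 a b : b \in rest p q :\ x -> unclaimed U a b -> unclaimed U' a b.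
  by case/setD1P=> bx /rP[_ _ _ be be']; rewrite (upd_n HU) //; case: zw => -[E1 E2]; rewrite ?E1 ?E2.
apply: K; case: zw => -[E _]; [left; apply: (grow_p TP xr)|right; apply: (grow_q TP xr)] => //;
  try (by move=> a b _; apply: K1); by rewrite rdC -?/e -?/e' -E; apply: updR_new HR.
Qed.
End Steps.

Lemma path_rev Rd x y c : path (red_edge Rd) x (rev (y :: c)) = red_edge Rd x (last y c) && path (red_edge Rd) y c.
Proof.
rewrite lastI rev_rcons /= rev_path; congr (_ && _).
by apply: eq_path => a b; apply: rdC.
Qed.

Lemma rotate Rd a x y c q : path (red_edge Rd) s (a ++ x :: y :: c) -> path (red_edge Rd) t q ->
  red_edge Rd x (last y c) -> red_edge Rd y (last t q) ->
  path (red_edge Rd) s (rcons (a ++ x :: rev (y :: c) ++ rev q) t).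
Proof.
rewrite cat_path /= => /and4P[pa ax xy yc] tq xc yt.
rewrite rcons_cat /= cat_path pa /= ax rcons_cat -rev_cons cat_path path_rev xc yc /=.
by rewrite rev_cons last_rcons path_rev yt.
Qed.

Definition linked Rd := exists w, [/\ uniq w, w =i Un & path (red_edge Rd) s (rcons w t)].

(** Both ends lie in [B], so they have all their edges to the first eight vertices of [p]. Two
    rounds give the end of [p] a chord to [x 0] or [x 2] and one to [x 4] or [x 6]; in the third
    round the end of [q] is offered the successors of these two neighbours. The indices are spaced
    so that all vertices involved are distinct. Either answer permits a rotation. *)
Lemma close_paths p q Rd U : two_paths p q Rd U -> rest p q = set0 -> 9 <= size p ->
  last s p \in B -> last t q \in B -> force 3 (fun Rd' _ => linked Rd') Rd U.
Proof.
move=> TP r0 s9 eB e'B; set e := last s p in eB; set e' := last t q in e'B.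
have ee' : e != e' := ends_neq TP.
pose x i := nth s p i.
have xt i : i < 8 -> x i \in take 8 p.
  by move=> i8; rewrite /x -(nth_take s i8) mem_nth // size_take_min leq_min i8 (leq_trans i8 (ltnW s9)).
have xe b i : i < 8 -> b \in B -> x i != b.
  by move=> i8 bB; have [xB _] := tp_B TP (xt i i8); apply: contraNneq xB => ->.
have fx b i : i < 8 -> b \in B -> unclaimed U b (x i).
  by move=> i8 bB; rewrite frC; have [_ ->] := tp_B TP (xt i i8).
have xx i j : i < 8 -> j < 8 -> i != j -> x i != x j.
  move=> i8 j8 ij; have up : uniq p by have := tp_uniq TP; rewrite cat_uniq => /andP[].
  by rewrite nth_uniq // (leq_trans _ (ltnW s9)).
apply: (force_offer (p := e) (x := x 0) (y := x 2)); rewrite ?fx ?xx //.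
move=> z1 w1 Rd1 U1 zw1 HU1 HR1.
have [i [i8 iE r1]] : exists i, [/\ i < 3, z1 = x i & red_edge Rd1 (x i) e].
  have := updR_new HR1; case: zw1 => -[E _]; rewrite E rdC => h; [by exists 0|by exists 2].
have fr1 j : 3 < j < 8 -> unclaimed U1 e (x j).
  case/andP=> j3 j8; rewrite (upd_p HU1) ?fx //;
    by case: zw1 => -[E1 E2]; rewrite ?E1 ?E2 xx // gtn_eqF // (leq_trans _ j3).
apply: (force_offer (p := e) (x := x 4) (y := x 6)); rewrite ?fr1 ?xx //.
move=> z2 w2 Rd2 U2 zw2 HU2 HR2.
have [j [j8 jE r2]] : exists j, [/\ 3 < j < 7, z2 = x j & red_edge Rd2 (x j) e].
  have := updR_new HR2; case: zw2 => -[E _]; rewrite E rdC => h; [by exists 4|by exists 6].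
have fr2 k : k < 8 -> unclaimed U2 e' (x k).
  by move=> k8; rewrite (upd_np HU2) ?(upd_np HU1) ?fx ?xe // eq_sym.
have [i8' [j4 j8']] : i.+1 < 8 /\ i.+1 < j.+1 /\ j.+1 < 8 by move: i8 j8; clear; lia.
apply: (force_offer (p := e') (x := x i.+1) (y := x j.+1)); rewrite ?fr2 ?xx ?ltn_eqF //.
move=> z3 w3 Rd3 U3 zw3 HU3 HR3; apply: force_now.
have [k [k7 r3 r4]] : exists k, [/\ k < 7, red_edge Rd3 (x k) e & red_edge Rd3 (x k.+1) e'].
  have := updR_new HR3; case: zw3 => -[E _]; rewrite E rdC => h.
    have i7 := leq_trans i8 (isT : 3 <= 7).
    by exists i; split=> //; exact: (updR_sub HR3 (updR_sub HR2 r1)).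
  case/andP: j8 => _ j7; by exists j; split=> //; apply: (updR_sub HR3).
have pE : p = take k p ++ x k :: x k.+1 :: drop k.+2 p.
  rewrite -drop_nth; last by rewrite (leq_ltn_trans _ s9) // ltnW.
  by rewrite -drop_nth ?cat_take_drop // (leq_trans _ s9) // ltnW // ltnW.
have eE : e = last (x k.+1) (drop k.+2 p) by rewrite /e {1}pE last_cat.
exists (take k p ++ x k :: rev (x k.+1 :: drop k.+2 p) ++ rev q).
have pq : perm_eq (take k p ++ x k :: rev (x k.+1 :: drop k.+2 p) ++ rev q) (p ++ q).
  rewrite {3}pE -catA perm_cat2l /= perm_cons -(cat_cons (x k.+1)) perm_cat //.
    by rewrite perm_rev.
  by rewrite perm_rev.
split.
- by rewrite (perm_uniq pq) (tp_uniq TP).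
- move=> y; rewrite (perm_mem pq); apply/idP/idP => [/(tp_Un TP)//|yU].
  have : y \notin rest p q by rewrite r0 inE.
  by rewrite inE yU negbK.
- have RR a b : red_edge Rd a b -> red_edge Rd3 a b.
    by move=> h; apply: (updR_sub HR3); apply: (updR_sub HR2); apply: (updR_sub HR1).
  apply: rotate; rewrite -?pE -?eE //.
    by apply: sub_path (tp_p TP).
  by apply: sub_path (tp_q TP).
Qed.

(** The refused vertex loses only its edge to the old end of [p], so it stays available for the new
    end. One vertex is left over, since an offer needs two. *)
Lemma exhaust (C : {set 'I_n}) k p q Rd U : two_paths p q Rd U -> #|rest p q :&: C| = k.+1 ->
  (9 <= size p) || (C == ~: B) ->
  force k (fun Rd' U' => exists p', [/\ two_paths p' q Rd' U', size p' = size p + k,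
    #|rest p' q :&: C| = 1, rest p' q :\: C = rest p q :\: C & (0 < k) || (last s p \in C) -> last s p' \in C]) Rd U.
Proof.
elim: k p Rd U => [|k IH] p Rd U TP cC pC.
  by apply: force_now; exists p; split; rewrite ?addn0.
have [x [y [/setIP[xr xC] /setIP[yr yC] xy]]] : exists x y,
    [/\ x \in rest p q :&: C, y \in rest p q :&: C & x != y].
  by apply/card_gt1P; rewrite cC.
apply: (extend_p TP xr yr xy).
  by case/orP: pC xC yC => [->//|/eqP->]; rewrite !in_setC => -> ->; rewrite orbT.
move=> z Rd' U' zxy TP'.
have [zr zC] : z \in rest p q /\ z \in C by move: zxy; rewrite !in_cons orbF => /orP[]/eqP->.
have E : rest (rcons p z) q :&: C = (rest p q :&: C) :\ z by rewrite rest_rconsl setIDAC.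
have E' : rest (rcons p z) q :\: C = rest p q :\: C.
  by rewrite rest_rconsl; apply/setP=> u; rewrite !in_setD in_set1; case: eqP => // ->; rewrite zC.
have cz : #|rest (rcons p z) q :&: C| = k.+1.
  by apply: succn_inj; rewrite E -cC (cardsD1 z (_ :&: _)) in_setI zr zC.
have pz : (9 <= size (rcons p z)) || (C == ~: B).
  by case/orP: pC => [h|->]; rewrite ?orbT // size_rcons ltnW.
apply: (force_imp _ (IH _ _ _ TP' cz pz)) => Rd2 U2 [p' [h1 h2 h3 h4 h5]].
exists p'; split=> //; rewrite ?h4 ?h2 ?size_rcons ?addSnnS //.
by move=> _; apply: h5; rewrite last_rcons zC orbT.
Qed.

(** Besides the [k] rounds outside [B]: one for the vertex left over there, one to let [q] end in
    [B], four to extend [p] through [B], one for the last vertex, which may go to either path, and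
    three to close. Saving [B] for the end is what brings both ends into it. *)
Lemma force_linked_from p q Rd U k : two_paths p q Rd U -> B \subset rest p q -> #|B| = 6 ->
  #|rest p q :\: B| = k.+1 -> 9 <= size p + k ->
  force (k + 10) (fun Rd' _ => linked Rd') Rd U.
Proof.
move=> TP Br cB ck sk; apply: force_bind.
  apply: (exhaust TP (C := ~: B)); rewrite ?eqxx ?orbT //.
  by rewrite -setDE.
move=> Rd1 U1 [p1 [TP1 s1 c1 r1 _]].
have r1B : rest p1 q :&: B = B.
  have := r1; rewrite !setDE setCK => ->; exact/setIidPr.
have {}s1 : 9 <= size p1 by rewrite s1.
move/eqP: c1 => /cards1P[x xE].
have xr : x \in rest p1 q :&: ~: B by rewrite xE set11.
case/setIP: xr => xr xB.
have E1 : rest p1 q :\ x = B by rewrite -xE -setDE setDDr setDv set0U.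
rewrite -[10]/(9.+1); apply: (extend_either TP1 xr); first by rewrite s1.
move=> Rd2 U2 TP2.
have [p2 [q2 [{}TP2 s2 r2]]] : exists p2 q2, [/\ two_paths p2 q2 Rd2 U2, 9 <= size p2 & rest p2 q2 = B].
  case: TP2 => TP2; [exists (rcons p1 x), q|exists p1, (rcons q x)]; split=> //.
  - by rewrite size_rcons ltnW.
  - by rewrite rest_rconsl.
  - by rewrite rest_rconsr.
have [y [z [yB zB yz]]] : exists x y, [/\ x \in B, y \in B & x != y].
  by apply/card_gt1P; rewrite cB.
apply: (extend_q TP2 _ _ yz); rewrite ?r2 ?s2 // => w Rd3 U3 wyz TP3.
have wB : w \in B by move: wyz; rewrite !in_cons orbF => /orP[]/eqP->.
have r3 : rest p2 (rcons q2 w) :&: B = B :\ w by rewrite rest_rconsr r2; apply/setIidPl/subD1set.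
have c3 : #|rest p2 (rcons q2 w) :&: B| = 5.
  by apply: succn_inj; rewrite r3 -cB (cardsD1 w B) wB.
rewrite -[8]/(4 + 4); apply: force_bind; first by apply: (exhaust TP3 c3); rewrite s2.
move=> Rd4 U4 [p4 [TP4 s4 c4 r4 /(_ isT) l4]].
have s4' : 9 <= size p4 by rewrite s4 (leq_trans s2) ?leq_addr.
have r4B : rest p4 (rcons q2 w) \subset B.
  rewrite -setD_eq0 r4 setD_eq0 rest_rconsr r2; exact: subD1set.
move/eqP: c4; rewrite (setIidPl r4B) => /cards1P[v vE].
have vr : v \in rest p4 (rcons q2 w) by rewrite vE set11.
apply: (extend_either TP4 vr); first by rewrite s4'.
have vB : v \in B := subsetP r4B v vr.
have r5 : rest p4 (rcons q2 w) :\ v = set0 by rewrite vE setDv.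
move=> Rd5 U5 [TP5|TP5]; apply: (close_paths TP5); rewrite ?last_rcons ?size_rcons //.
- by rewrite rest_rconsl.
- exact: ltnW.
- by rewrite rest_rconsr.
Qed.
End TwoPaths.

(** A path through [Un] needs [#|Un| + 1] edges; [s] takes its first step to a vertex it has not
    lost, and from there on no edge to the rest has been claimed. The second path starts at [t]
    itself, which has lost nothing. The bound 30 is ample for the six vertices of [B], the four lost
    ones and the first eight vertices of [p]. *)
Lemma force_linked n (s t : 'I_n) (Un : {set 'I_n}) Rd U : s != t -> s \notin Un -> t \notin Un ->
  30 <= #|Un| -> (forall x y, x \in Un -> y \in Un -> x != y -> unclaimed U x y) ->
  (forall x, x \in Un -> unclaimed U t x) -> #|[set x in Un | ~~ unclaimed U s x]| <= 4 ->
  force (#|Un| + 3) (fun Rd' _ => linked s t Un Rd') Rd U.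
Proof.
move=> st sU tU cU uu tu su.
have [bs [sbs ubs bsU]] := pick_set (leq_trans (isT : 6 <= 30) cU).
pose B := [set x in bs].
have cB : #|B| = 6 by rewrite cardsE (card_uniqP ubs).
have BU : B \subset Un by apply/subsetP=> b; rewrite inE => /bsU.
have cUB : #|Un :\: B| = #|Un| - 6 by rewrite cardsD (setIidPr BU) cB.
have [x [y [xX yX xy]]] : exists x y, [/\ x \in (Un :\: B) :\: [set x in Un | ~~ unclaimed U s x],
    y \in (Un :\: B) :\: [set x in Un | ~~ unclaimed U s x] & x != y].
  apply/card_gt1P; rewrite cardsD.
  have : #|(Un :\: B) :&: [set x in Un | ~~ unclaimed U s x]| <= 4.
    by apply: leq_trans su; apply: subset_leq_card; apply: subsetIr.
  by rewrite cUB; move: cU; clear; lia.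
have P z : z \in (Un :\: B) :\: [set x in Un | ~~ unclaimed U s x] -> [/\ z \in Un, z \notin B & unclaimed U s z].
  by rewrite !in_setD => /and3P[+ -> zU]; rewrite inE zU negbK.
have [[xU xB xf] [yU yB yf]] := (P x xX, P y yX).
have -> : #|Un| + 3 = ((#|Un| - 8) + 10).+1 by move: cU; clear; lia.
apply: (force_offer xf yf xy) => z w Rd' U' zw HU HR.
have [zU zB] : z \in Un /\ z \notin B by case: zw => -[-> _].
have ns v : v \in Un -> v != s by apply: contraTneq => ->.
have rE : rest Un [:: z] [::] = Un :\ z by apply/setP=> v; rewrite !inE andbC.
have st' : t != s by rewrite eq_sym.
have TP : two_paths s t Un B [:: z] [::] Rd' U'.
  constructor; rewrite ?rE //=.
  - by move=> v; rewrite inE => /eqP->.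
  - by rewrite (updR_new HR).
  - move=> a b /setD1P[_ aU] /setD1P[_ bU] ab; rewrite (upd_np HU) ?ns //; exact: uu.
  - by move=> a /setD1P[az aU]; rewrite (upd_np HU) ?ns //; apply: uu; rewrite // eq_sym.
  - by move=> a /setD1P[az aU]; rewrite (upd_np HU st' (ns _ aU)); apply: tu.
  - move=> a; rewrite inE => /eqP->; split=> // b bB; have bU := subsetP BU _ bB.
    by rewrite (upd_np HU) ?ns //; apply: uu => //; apply: contraNneq zB => ->.
  - by rewrite zB.
apply: (force_linked_from st sU tU BU TP) => //; rewrite ?rE.
- by apply/subsetP=> b bB; rewrite !inE (subsetP BU) // andbT; apply: contraNneq zB => <-.
- rewrite setDDl setUC -setDDl; have := cardsD1 z (Un :\: B); rewrite in_setD zB zU cUB /=.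
  by move: cU; move: #|Un :\: B :\ z| #|Un| => k m; clear; lia.
- by move: cU; rewrite /=; clear; lia.
Qed.

Lemma force_mono n t G (Rd U : graph n) : force t G Rd U ->
  force t (fun Rd' U' => G Rd' U' /\ Rd \subset Rd') Rd U.
Proof.
elim: t Rd U => [|t IH] Rd U; first by split.
case=> [g|[e1 [e2 [e1U e2U e12 K]]]]; first by left; split.
right; exists e1, e2; split=> // d /K /IH; apply: force_imp => Rd' U' [g sub]; split=> //.
exact: subset_trans (subsetUr _ _) sub.
Qed.

Section FinishChain.
Variable n : nat.
Variables (V : finType) (r : V) (par : V -> V).
Variables H S L Src Z : {set V}.
Notation kid := (child r par).
Hypothesis cardV : #|V| = n.
Variables (c top : V) (zs : seq V).
Hypotheses (zsu : uniq zs) (zsZ : zs =i Z) (chain : path (fun a b => par a == b) c (rcons zs top)).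
Hypotheses (cZ : c \notin Z) (topZ : top \notin Z) (ctop : c != top) (rZ : r \notin Z).
Hypothesis parZ : forall v, v != r -> par v \in Z -> (v == c) || (v \in Z).
Hypotheses (cH : c \notin H) (kidc : #|[set v | kid v c]| <= 1).
Hypotheses (topH : top \notin H) (topS : top \notin S) (kidtop : forall v, kid v top -> v \in Z).

(** The ends are [f c] and [f top]. By [icl], [f c] has lost at most one vertex for its only child
    plus 3, whereas [f top] has lost none: [top] is outside [S] and all its children are
    reserved. *)
Lemma finish_chain (f alt : V -> 'I_n) Rd U : 30 <= #|Z| -> Inv r par H S L Src (~: Z) set0 f alt set0 Rd U ->
  force (#|Z| + 3) (fun Rd' _ => exists f' : V -> 'I_n, emb r par f' Rd') Rd U.
Proof.
move=> Z30 I; pose Un := ~: (f @: (~: Z)).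
have UnP x : (x \in Un) = (x \notin f @: (~: Z)) by rewrite in_setC.
have fUn v : v \notin Z -> f v \notin Un by move=> vZ; rewrite UnP negbK imset_f // in_setC.
have cUn : #|Un| = #|Z|.
  have := cardsC (f @: (~: Z)); rewrite card_ord (card_in_imset (iinj I)) -/Un.
  have := cardsC Z; rewrite cardV; move: #|Z| #|Un| #|~: Z| => a b d; clear; lia.
have Vt : f c != f top.
  by apply: contra ctop => /eqP /(iinj I) -> //; rewrite in_setC.
have Tt x : x \in Un -> unclaimed U (f top) x.
  move=> xU; have := icl I (w := top); rewrite in_setC topZ => /(_ isT topH).
  rewrite (negPf topS) /= muln0 addn0 (_ : placed_kids _ _ _ _ _ = 0); last first.
    apply/eqP; rewrite cards_eq0; apply/eqP/setP=> v; rewrite !inE; apply/negP=> /and3P[vZ /kidtop].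
    by rewrite (negPf vZ).
  rewrite leqn0 cards_eq0 => /eqP E; apply: contraTT xU => nf; rewrite UnP.
  by have := in_set0 x; rewrite -E inE nf andbT => ->.
have Ts : #|[set x in Un | ~~ unclaimed U (f c) x]| <= 4.
  have := icl I (w := c); rewrite in_setC cZ => /(_ isT cH) h.
  have kc : placed_kids r par (~: Z) set0 c <= 1.
    apply: leq_trans kidc; apply: subset_leq_card; apply/subsetP=> v.
    by rewrite !inE => /and3P[].
  apply: leq_trans (leq_trans h (leq_add kc (leq_mul (leqnn 3) (leq_b1 _)))).
  by apply: subset_leq_card; apply/subsetP=> x; rewrite !inE.
rewrite -cUn; apply: (force_imp _ (force_mono (force_linked _ Vt _ _ _ _ Tt Ts))).
- move=> Rd' U' [[w [wu wUn wp]] sub].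
  pose f' v := if v \in Z then nth (f top) w (index v zs) else f v.
  have f'n v : v \notin Z -> f' v = f v by rewrite /f' => /negPf->.
  have szw : size w = size zs.
    by rewrite -(card_uniqP wu) -(card_uniqP zsu) (eq_card wUn) cUn; apply: eq_card => v; rewrite zsZ.
  have f'k k : k <= size zs -> f' (nth c (rcons zs top) k) = nth (f top) (rcons w (f top)) k.
    rewrite leq_eqVlt => /orP[/eqP->|ks].
      by rewrite nth_rcons ltnn eqxx f'n // -szw nth_rcons ltnn eqxx.
    by rewrite !nth_rcons szw ks /f' -zsZ mem_nth // index_uniq.
  have f'Z v : v \in Z -> f' v \in Un.
    move=> vZ; rewrite /f' vZ -wUn mem_nth // szw index_mem zsZ //.
  exists f'; split=> [u v|v vr].
    have [uZ|uZ] := boolP (u \in Z); have [vZ|vZ] := boolP (v \in Z).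
    - rewrite /f' uZ vZ => /eqP; rewrite nth_uniq ?szw ?index_mem ?zsZ // => /eqP E.
      by rewrite -(nth_index c (_ : u \in zs)) ?zsZ // E nth_index ?zsZ.
    - by move=> E; have := f'Z _ uZ; rewrite E f'n // (negPf (fUn _ vZ)).
    - by move=> E; have := f'Z _ vZ; rewrite -E f'n // (negPf (fUn _ uZ)).
    - by rewrite !f'n // => /(iinj I) -> //; rewrite in_setC.
  have ch k := pathP c chain k; have re k := pathP (f top) wp k; rewrite !size_rcons in ch re.
  have [vZ|vZ] := boolP (v \in Z).
    have vi : index v zs < size zs by rewrite index_mem zsZ.
    have vE : v = nth c (rcons zs top) (index v zs) by rewrite nth_rcons vi nth_index ?zsZ.
    have := ch (index v zs).+1 vi; rewrite /= -vE => /eqP->.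
    have := re (index v zs).+1; rewrite szw => /(_ vi) /=.
    by rewrite -!f'k -?vE // ltnW.
  have [pZ|pZ] := boolP (par v \in Z).
    have /orP[/eqP vc|] := parZ vr pZ; last by rewrite (negPf vZ).
    rewrite vc f'n //; have := ch 0 isT; rewrite /= => /eqP->; rewrite f'k //.
    exact: re 0 isT.
  rewrite !f'n //; apply: (subsetP sub); apply: (ired I); rewrite ?in_setC ?in_set0 //.
- exact: fUn.
- exact: fUn.
- by rewrite cUn.
- by move=> x y; rewrite !UnP; apply: (iuu I).
Qed.
End FinishChain.

(** * Choosing the skeleton *)

Section Forest.
Variables (V : finType) (r : V) (par : V -> V) (rk : V -> nat).
Hypothesis rkP : forall v, v != r -> rk (par v) < rk v.
Notation kid := (child r par).
Notation kids := (kids r par).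
Implicit Types (M X : {set V}).

Lemma sum_kids X : \sum_v #|[set u in X | kid u v]| = #|X :\ r|.
Proof.
transitivity (\sum_v \sum_(u in X | kid u v) 1).
  by apply: eq_bigr => v _; rewrite -sum1_card; apply: eq_bigl => u; rewrite inE.
rewrite (exchange_big_dep (mem X)) /=; last by move=> v u _ /andP[].
rewrite -sum1_card (bigID (fun u => u != r)) /= [X in _ + X]big1 ?addn0.
  rewrite [RHS](eq_bigl (fun u => (u \in X) && (u != r))); last by move=> u; rewrite in_setD1 andbC.
  apply: eq_bigr => u /andP[uX ur]; rewrite (eq_bigl (pred1 (par u))) ?big_pred1_eq // => v.
  by rewrite uX /child ur /= eq_sym.
move=> u /andP[_ /negPn/eqP->]; apply: big1 => v.
by rewrite /child eqxx andbF.
Qed.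

Definition anc M := [set v | [exists m in M, connect kid m v]].
Definition branch M := [set u | 2 <= #|[set v in anc M | kid v u]|].
Definition skeleton M := r |: (M :|: branch M).

Lemma anc_self M m : m \in M -> m \in anc M.
Proof. by move=> mM; rewrite inE; apply/existsP; exists m; rewrite mM connect0. Qed.

Lemma anc_up M v u : v \in anc M -> kid v u -> u \in anc M.
Proof.
rewrite !inE => /existsP[m /andP[mM mv]] vu; apply/existsP; exists m.
by rewrite mM (connect_trans mv) // connect1.
Qed.

Lemma anc_down M u : u \in anc M -> u \notin M -> 0 < #|[set v in anc M | kid v u]|.
Proof.
rewrite inE => /existsP[m /andP[mM /connectP[p]]]; case/lastP: p => [_ ->|p x].
  by rewrite mM.
rewrite rcons_path last_rcons => /andP[pp lx] -> _; apply/card_gt0P.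
exists (last m p); rewrite inE lx andbT inE; apply/existsP; exists m; rewrite mM.
by apply/connectP; exists p.
Qed.

Lemma branch_anc M : branch M \subset anc M.
Proof.
apply/subsetP=> u; rewrite inE => /ltnW /card_gt0P[v]; rewrite inE => /andP[va].
exact: anc_up.
Qed.

(** In the forest of ancestors of [M], a role outside [M] has at least one child, a branching one at
    least two, and there are no more children than roles. Hence at most [#|M|] branching roles lie
    outside [M]. *)
Lemma card_skeleton M : #|skeleton M| <= 2 * #|M| + 1.
Proof.
have : #|branch M :\: M| <= #|M|.
  have : \sum_(v in anc M) #|[set u in anc M | kid u v]| <= #|anc M|.
    apply: leq_trans (_ : #|anc M :\ r| <= _); last by apply: subset_leq_card; apply: subD1set.
    by rewrite -sum_kids [X in _ <= X](bigID (mem (anc M))) leq_addr.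
  have : \sum_(v in anc M) ((v \notin M) + ((v \in branch M) && (v \notin M)))
     <= \sum_(v in anc M) #|[set u in anc M | kid u v]|.
    apply: leq_sum => v va; case: (boolP (v \in M)) => vM; rewrite ?andbF //= andbT.
    have := anc_down va vM; case: (boolP (v \in branch M)) => //.
    by rewrite inE.
  rewrite big_split /= -!big_mkcondr /= !sum1_card => a b.
  have := leq_trans a b; rewrite -(cardsID M (anc M)).
  have -> : #|[pred v in anc M | v \notin M]| = #|anc M :\: M|.
    by apply: eq_card => v; rewrite !inE andbC.
  have -> : #|[pred v in anc M | (v \in branch M) && (v \notin M)]| = #|branch M :\: M|.
    apply: eq_card => v; rewrite inE in_setD; have := subsetP (branch_anc M) v.
    by case: (v \in branch M) => [->//|_]; rewrite ?andbF //= andbC.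
  rewrite addnC leq_add2r => h; apply: leq_trans h _; apply: subset_leq_card; exact: subsetIr.
move=> h; apply: leq_trans (_ : 1 + (#|M| + #|branch M :\: M|) <= _).
  rewrite /skeleton cardsU1; apply: leq_add; first by case: (_ \notin _).
  rewrite -(cardsID M (_ :|: _)) setDUl setDv set0U.
  by rewrite leq_add2r; apply: subset_leq_card; apply: subsetIr.
by move: h; clear; lia.
Qed.

Lemma skeletonP M v : v != r -> v \notin M -> #|kids v| <= 1 -> v \notin skeleton M.
Proof.
move=> vr vM k1; rewrite !in_setU1 in_setU !negb_or vr vM inE -leqNgt /=.
by apply: leq_trans k1; apply: subset_leq_card; apply/subsetP=> u; rewrite !inE => /andP[].
Qed.

(** Both children lie in [anc M]; if they were different, their parent would be a branching role. *)
Lemma skeleton_cl M u v w : u \notin skeleton M -> kid v u -> kid w u ->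
  v \in skeleton M :|: attached r par (skeleton M) -> w \in skeleton M :|: attached r par (skeleton M) -> v = w.
Proof.
have A x y : kid x y -> x \in skeleton M -> x \in anc M.
  move=> /andP[xr _]; rewrite in_setU1 in_setU (negPf xr) /= => /orP[/anc_self//|].
  exact: (subsetP (branch_anc M)).
have A' x y : kid x y -> x \in skeleton M :|: attached r par (skeleton M) -> x \in anc M.
  move=> xy; rewrite in_setU => /orP[/(A _ _ xy)//|].
  by rewrite inE => /andP[_ /existsP[b /andP[bS bx]]]; apply: anc_up (A _ _ bx bS) bx.
move=> uS vu wu /(A' _ _ vu) va /(A' _ _ wu) wa; apply/eqP; apply: contraNT uS => vw.
rewrite !in_setU1 in_setU [u \in branch M]inE; apply/orP; right; apply/orP; right.
by apply/card_gt1P; exists v, w; rewrite !inE; move: va wa; rewrite !inE vu wu => -> ->.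
Qed.

Definition leaf v := (v != r) && (kids v == set0).

Lemma leafP v : leaf v -> v != r /\ forall u, ~~ kid u v.
Proof.
case/andP=> vr /eqP k0; split=> // u; apply/negP => uv.
by have := in_set0 u; rewrite -k0 inE uv.
Qed.

Lemma sum_fibres (A T : {set V}) :
  \sum_(p in T) #|[set y in A | par y == p]| = #|[set y in A | par y \in T]|.
Proof.
rewrite -sum1_card [RHS](partition_big par (fun p => p \in T)) /=; last by move=> y; rewrite inE => /andP[].
apply: eq_bigr => p pT; rewrite -sum1_card; apply: eq_bigl => y.
by rewrite !inE -andbA; case: eqP => [->|]; rewrite ?andbF // pT.
Qed.

(** Greedy choice: while fewer than [4 * mu] leaves are chosen, at most three parents have reached
    their quota [mu], and some leaf below another parent is still free. *)
Lemma spread_leaves mu k : (forall T : {set V}, #|T| <= 3 -> 4 * mu <= #|[set v | leaf v & par v \notin T]|) ->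
  k <= 4 * mu ->
  exists A : {set V}, [/\ #|A| = k, (forall y, y \in A -> leaf y) & forall p : V, #|[set y in A | par y == p]| <= mu].
Proof.
move=> many; elim: k => [_|k IH k4].
  exists set0; split; rewrite ?cards0 //; [by move=> y; rewrite inE|move=> p].
  by rewrite (_ : [set y in set0 | par y == p] = set0) ?cards0 //; apply/setP=> y; rewrite !inE.
have [A [cA lA fA]] := IH (ltnW k4).
pose T := [set p | #|[set y in A | par y == p]| == mu].
have cT : #|T| <= 3.
  have : #|T| * mu <= k.
    rewrite -cA -sum_nat_const; apply: leq_trans (_ : #|[set y in A | par y \in T]| <= _).
      by rewrite -sum_fibres; apply: leq_sum => p; rewrite inE => /eqP->.
    by apply: subset_leq_card; apply/subsetP=> y; rewrite inE => /andP[].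
  by move: k4; clear; case: (#|T|) => [|[|[|[|m]]]] //; rewrite ?mulSn; lia.
have [y [yl yA]] : exists y, y \in [set v | leaf v & par v \notin T] /\ y \notin A.
  have /subsetPn[y yl yA] : ~~ ([set v | leaf v & par v \notin T] \subset A).
    apply/negP => /subset_leq_card; rewrite cA => h; have := leq_trans (many _ cT) h.
    by rewrite leqNgt k4.
  by exists y.
move: yl; rewrite !inE => /andP[ly pyT].
exists (y |: A); split.
- by rewrite cardsU1 yA cA.
- by move=> v /setU1P[->|/lA].
- move=> p; have [pp|pp] := eqVneq p (par y).
    apply: leq_trans (_ : (#|[set v in A | par v == p]|).+1 <= _).
      rewrite -add1n -(cards1 y); apply: leq_trans (leq_card_setU _ _).
      by apply: subset_leq_card; apply/subsetP=> v; rewrite !inE; case: (v == y).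
    by rewrite ltn_neqAle fA andbT pp.
  apply: leq_trans (fA p); apply: subset_leq_card; apply/subsetP=> v; rewrite !inE.
  by case: eqVneq => [->|] //=; rewrite eq_sym (negPf pp).
Qed.

(** * The two kinds of trees *)

Section Cases.
Variable n : nat.
Hypothesis cardV : #|V| = n.
Implicit Types (U : graph n).

Lemma many_leaves q m : 0 < q -> q + 5 <= m -> 60 <= m ->
  (forall T : {set V}, #|T| <= 3 -> 4 * (7 * m) <= #|[set v | leaf v & par v \notin T]|) ->
  (forall v, 3 * #|kids v| + (9 * (2 * (n %/ q + 28 * m) + 1) + 2 * (28 * m) + 100) <= n) ->
  force (n + 5 * (2 * (n %/ q + 28 * m) + 1) + 4 * m)
    (fun Rd _ => exists f : V -> 'I_n, emb r par f Rd) set0 (Kn n).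
Proof.
move=> q0 qm m60 many deg.
have [A [cA lA fA]] := spread_leaves many (leqnn _).
have [zs [szs uzs zsA]] : exists s : seq V, [/\ size s = m, uniq s & {subset s <= A}].
  by apply: pick_set; rewrite cA; clear; lia.
pose Z := [set z in zs]; pose Src := A :\: Z.
have cZ : #|Z| = m by rewrite cardsE (card_uniqP uzs).
have ZA : Z \subset A by apply/subsetP=> z; rewrite inE => /zsA.
have cSrc : #|Src| <= 28 * m.
  by apply: leq_trans (subset_leq_card (subsetDl _ _)) _; rewrite cA mulnA.
(* The parents of the chosen leaves count as hubs whatever their degree, so that all leaves of [A]
   hang from hubs; there are at most [n %/ q] roles in [big]. *)
pose big := [set v | q < #|kids v|]; pose H := big :|: par @: A.
have cH : #|H| <= n %/ q + 28 * m.
  apply: leq_trans (leq_card_setU _ _) (leq_add _ _); last first.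
    by apply: leq_trans (leq_imset_card _ _) _; rewrite cA mulnA.
  rewrite leq_divRL // -sum_nat_const -cardV -cardsT.
  apply: leq_trans (_ : #|[set: V] :\ r| <= _); last by apply: subset_leq_card; apply: subD1set.
  rewrite -sum_kids [X in _ <= X](bigID (mem big)) /=; apply: leq_trans (leq_addr _ _).
  apply: leq_sum => v; rewrite inE => /ltnW /leq_trans; apply; apply: subset_leq_card.
  by apply/subsetP=> u; rewrite !inE.
pose S := skeleton H.
have HS : H \subset S by apply/subsetP=> h hH; rewrite in_setU1 in_setU hH orbT.
have cS : #|S| <= 2 * (n %/ q + 28 * m) + 1.
  by apply: leq_trans (card_skeleton _) _; rewrite leq_add2r leq_mul2l cH orbT.
have AH y : y \in A -> y \notin H.
  move=> /lA/leafP[_ ly]; rewrite in_setU negb_or inE (_ : kids y = set0) ?cards0 //=; last first.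
    by apply/setP=> u; rewrite !inE (negPf (ly u)).
  apply/imsetP => -[z /lA/leafP[zr _] yE]; have := ly z.
  by rewrite /child zr yE eqxx.
have AS y : y \in A -> y \notin S.
  move=> yA; have /leafP[yr ly] := lA _ yA; apply: skeletonP; rewrite ?AH //.
  by rewrite (_ : kids y = set0) ?cards0 //; apply/setP=> u; rewrite !inE (negPf (ly u)).
have pH y : y \in A -> par y \in H by move=> yA; rewrite in_setU imset_f ?orbT.
have N1 : 9 * #|S| + 2 * #|Src| + 100 <= 9 * (2 * (n %/ q + 28 * m) + 1) + 2 * (28 * m) + 100.
  by rewrite leq_add2r leq_add // leq_mul2l /= ?cS ?cSrc.
apply: (force_leq (s := n + 5 * #|S| + 4 * m)).
  by rewrite leq_add2r leq_add2l leq_mul2l cS.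
apply: force_bind.
  apply: (@machine n V r par rk cardV rkP H S Z Src q).
  - exact: setU11.
  - exact: HS.
  - by move=> v /(subsetP ZA)/AS.
  - move=> v vS pv; have [_ /(_ v)] := leafP (lA _ (subsetP ZA _ pv)).
    rewrite /child eqxx andbT negbK => /eqP vr; by move: vS; rewrite vr setU11.
  - exact: skeleton_cl.
  - by move=> y /setDP[/AS].
  - by move=> y /setDP[].
  - by move=> y v /setDP[/lA/leafP[_ ->]].
  - by move=> y /setDP[/pH].
  - by move=> w; rewrite in_setU negb_or inE -leqNgt => /andP[].
  - by rewrite cZ.
  - by rewrite cZ.
  - by move=> h _; apply: leq_trans (deg h); rewrite leq_add2l.
  - by apply: leq_trans N1 (leq_trans _ (deg r)); rewrite leq_addl.
move=> Rd U [f [alt I]].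
have hl y : y \in A -> hubleaf r par H y.
  move=> yA; have [yr ly] := leafP (lA _ yA).
  by apply/and4P; split; rewrite ?AH ?pH //; apply/forallP.
apply: (finish_leaves (H := H) cardV cZ (A := Src) (f := f)).
(* Origin of the 7: from the [28 * m] leaves of [A], three hubs take at most [21 * m] and [Z] takes
   [m], which leaves the [6 * m] that the completion asks for. *)
- move=> T cT; have : #|[set y in A | par y \in T]| <= 3 * (7 * m).
    apply: leq_trans (leq_mul cT (leqnn _)).
    by rewrite -sum_nat_const -sum_fibres; apply: leq_sum => p _; apply: fA.
  have : #|A| <= #|[set y in A | par y \in T]| + #|[set y in Src | par y \notin T]| + #|Z|.
    apply: leq_trans (leq_trans (leq_card_setU _ _) (leq_add (leq_card_setU _ _) (leqnn _))).
    apply: subset_leq_card; apply/subsetP=> y yA; rewrite !inE yA /=.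
    by case: (_ \in T); case: (_ \in zs).
  by rewrite cA cZ; move: (#|[set y in A | _]|) (#|[set y in Src | _]|) => a b; clear; lia.
- split.
  + by move=> z /(subsetP ZA)/hl.
  + by move=> y /setDP[yA yZ]; rewrite hl.
  + split=> //; first exact: (iinj I).
    move=> v vZ vr; apply: (ired I); rewrite ?in_setC ?in_set0 //.
    by apply/negP => /(subsetP ZA)/lA/leafP[_ /(_ v)]; rewrite /child vr eqxx.
  + by move=> y u /setDP[yA yZ]; apply: (iSrc I); rewrite ?in_setC // in_setD yZ yA.
  + move=> x /(ihub I); apply: leq_trans; apply: subset_leq_card; apply/subsetP=> h.
    rewrite !inE => /andP[hH ->]; rewrite andbT hH /=.
    by apply/negP => hz; have := AH h (zsA _ hz); rewrite in_setU inE hH.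
Qed.

Section FewLeaves.
Variables (B : {set V}) (l D : nat).
Hypotheses (cB : #|B| <= 3) (degD : forall v, #|kids v| <= D).
Hypothesis few_l : #|[set v | leaf v & par v \notin B]| <= l.

(** [N] collects the candidates for inner roles of a bare path. [X] omits the leaves below [B], at
    most [3 * D] roles; children of roles outside [B] stay in [X], which allows counting them
    there. *)
Let N := [set v | [&& v != r, v \notin B & #|kids v| == 1]].
Let N2 := [set v | (v \notin B) && (2 <= #|kids v|)].
Let X := ~: [set v | leaf v & par v \in B].

Let kidX u v : kid u v -> v \notin B -> u \in X.
Proof. by move=> /andP[_ /eqP <-] pB; rewrite !inE negb_and pB orbT. Qed.

Let cX : n <= #|X| + 3 * D.
Proof.
rewrite -cardV -(cardsC X) leq_add2l; apply: leq_trans (leq_mul cB (leqnn D)).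
rewrite setCK -sum_nat_const; apply: leq_trans (_ : \sum_(b in B) #|kids b| <= _); last first.
  by apply: leq_sum => b _; apply: degD.
have -> : [set v | leaf v & par v \in B] = [set v in [set u | leaf u] | par v \in B].
  by apply/setP=> v; rewrite !inE.
rewrite -sum_fibres; apply: leq_sum => b _; apply: subset_leq_card; apply/subsetP=> v.
by rewrite !inE => /andP[/andP[vr _]] pv; rewrite /child vr.
Qed.

Let XN : #|X :\: N| <= 4 + l + #|N2|.
Proof.
apply: leq_trans (_ : #|(r |: B) :|: ([set v | leaf v & par v \notin B] :|: N2)| <= _).
  apply: subset_leq_card; apply/subsetP=> v; rewrite !inE /leaf.
  rewrite -cards_eq0; case: (v == r); case: (v \in B); case: (par v \in B) => //;
    by case: #|kids v| => [|[|d]].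
apply: leq_trans (leq_card_setU _ _) _; rewrite -addnA; apply: leq_add.
  by rewrite cardsU1; apply: (@leq_add _ _ 1 3) => //; case: (_ \notin _).
by apply: leq_trans (leq_card_setU _ _) _; rewrite leq_add2r.
Qed.

Let sumX : #|N| + \sum_(v in N2) #|kids v| <= #|X|.
Proof.
apply: leq_trans (_ : #|X :\ r| <= _); last by apply: subset_leq_card; apply: subD1set.
have -> : #|N| = \sum_(v in N) #|kids v|.
  by rewrite -sum1_card; apply: eq_bigr => v; rewrite inE => /and3P[_ _ /eqP].
have dN : [disjoint N & N2].
  rewrite disjoints_subset; apply/subsetP=> v; rewrite !inE => /and3P[_ _ /eqP->].
  by rewrite andbF.
rewrite -sum_kids -bigU //= big_mkcond /=.
apply: leq_sum => v _; case: ifP => // vN; apply: subset_leq_card; apply/subsetP=> u uk.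
have uv : kid u v by rewrite inE in uk.
rewrite in_set uv andbT; apply: kidX uv _.
by move: vN; rewrite !inE => /orP[/and3P[]|/andP[]].
Qed.

(** Few leaves mean little branching: [X] has at least as many roles as [N] and [N2] have children,
    but at most [#|N| + 4 + l + #|N2|], the 4 standing for the root and [B]. *)
Let sumN2 : \sum_(v in N2) (#|kids v|).-1 <= 4 + l.
Proof.
have : #|X| <= #|N| + #|X :\: N|.
  by rewrite -(cardsID N X) leq_add2r; apply: subset_leq_card; apply: subsetIr.
have : \sum_(v in N2) #|kids v| = \sum_(v in N2) (#|kids v|).-1 + #|N2|.
  rewrite -sum1_card -big_split; apply: eq_bigr => v; rewrite inE /= => /andP[_].
  by case: #|kids v| => // d _; rewrite addn1.
move: sumX XN; move: (\sum_(v in N2) _) (\sum_(v in N2) _) #|X| #|N| #|N2| #|_ :\: _| => a b c d e f.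
by clear; lia.
Qed.

Lemma deg_few v : v \notin B -> #|kids v| <= l + 5.
Proof.
move=> vB; case: (leqP 2 #|kids v|) => [k2|]; last by move: #|kids v| => k; clear; lia.
have vN : v \in N2 by rewrite inE vB.
move: sumN2; rewrite (bigD1 v) //= => h; have := leq_trans (leq_addr _ _) h.
by move: k2; clear; lia.
Qed.

Let XN' : #|X :\: N| <= 2 * l + 8.
Proof.
have : #|N2| <= 4 + l.
  apply: leq_trans sumN2; rewrite -sum1_card; apply: leq_sum => v; rewrite inE => /andP[_].
  by case: #|kids v| => [|[|]].
by move: XN; move: #|N2| #|_ :\: _| => a b; clear; lia.
Qed.

Let descend u : u \in N -> exists w j, [/\ w \in X :\: N, w != r, 0 < j, iter j par w = u &
  forall i, 0 < i <= j -> iter i par w \in N].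
Proof.
pose M := \max_v rk v; have rkM v : rk v <= M by apply: leq_bigmax.
have [e] := ubnP (M - rk u); elim: e u => // e IH u; rewrite ltnS => le uN.
have := uN; rewrite inE => /and3P[ur uB /cards1P[v vE]].
have vu : kid v u by have := set11 v; rewrite -vE inE.
have [vr /eqP pv] := andP vu.
have [vN|vN] := boolP (v \in N).
  have lt : M - rk v < e.
    apply: leq_trans le; have := rkP vr; rewrite pv; have := rkM v.
    by clear; lia.
  have [w [j [wX wr j0 jE jN]]] := IH v lt vN.
  exists w, j.+1; split=> //; first by rewrite iterS jE.
  move=> i /andP[i0]; rewrite leq_eqVlt => /orP[/eqP->|ij]; first by rewrite iterS jE pv.
  by apply: jN; rewrite i0.
exists v, 1; split=> //; first by rewrite in_setD vN (kidX vu).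
by move=> [|[|i]] // _; rewrite /= pv.
Qed.

(** Going down from a role of [N] through only children, one arrives at a role of [X :\: N]. If
    every chain above such a role left [N] within [k] steps, [N] would have at most [k] roles for
    each of them, and [X] would be too small. *)
Lemma long_chain k : 3 * D + (2 * l + 8) * k.+1 < n ->
  exists w, w != r /\ forall i, 0 < i <= k -> iter i par w \in N.
Proof.
move=> big; case: (pickP (fun w => (w != r) && [forall i : 'I_k, iter i.+1 par w \in N])) => [w /andP[wr /forallP h]|none].
  by exists w; split=> // -[//|i] ik; apply: (h (Ordinal ik)).
have : #|N| <= #|setX (X :\: N) [set: 'I_k]|.
  apply: leq_trans (leq_imset_card (fun wj : V * 'I_k => iter wj.2.+1 par wj.1) (mem (setX (X :\: N) setT))).
  apply: subset_leq_card; apply/subsetP=> u /descend[w [j [wX wr j0 jE jN]]].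
  have jk : j < k.
    rewrite ltnNge; apply/negP => kj; have := none w; rewrite wr /= => /negbT/forallPn[i].
    by case/negP; apply: (jN i.+1); rewrite (leq_trans (ltn_ord i)).
  case: j j0 jE jk {jN} => // j _ <- jk; apply/imsetP; exists (w, Ordinal (ltnW jk)) => //.
  by rewrite inE /= wX inE.
rewrite cardsX cardsT card_ord => h.
have : #|X| <= #|N| + #|X :\: N|.
  by rewrite -(cardsID N X) leq_add2r; apply: subset_leq_card; apply: subsetIr.
have := leq_mul XN' (leqnn k); move: h cX XN' big; rewrite mulnS.
move: #|X| #|N| #|_ :\: _| => a b c; move: (c * k) (_ * k) => x y; clear; lia.
Qed.

(** On the chain above [w], the role [x 1] joins the skeleton, the next [m] roles form [Z], and
    [x m.+2] is [top]. With [x 1] in the skeleton, everything below the gap can be placed although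
    the gap stays open. The skeleton has at most [2 * 4 + 1 = 9] roles, hence [45 = 5 * 9] and
    [181 = 9 * 9 + 100]. *)
Lemma few_leaves m : 30 + l + 30 <= m -> 3 * D + (2 * l + 8) * m.+3 < n -> 3 * D + 181 <= n ->
  force (n + 45 + (m + 3)) (fun Rd _ => exists f : V -> 'I_n, emb r par f Rd) set0 (Kn n).
Proof.
move=> lm big degn; have [w [wr wN]] := long_chain big.
pose x j := iter j par w.
have xN j : 0 < j <= m.+2 -> [/\ x j != r, x j \notin B & #|kids (x j)| = 1].
  by move=> /wN; rewrite inE => /and3P[-> -> /eqP].
have xk j : j < m.+2 -> kid (x j) (x j.+1).
  case: j => [|j] jm; first by rewrite /child wr /x /= eqxx.
  by have [? _ _] := xN j.+1 (ltnW jm); apply/andP; split.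
have xkid j v : 0 < j <= m.+2 -> kid v (x j) -> v = x j.-1.
  case: j => // j /= jm vx; have [_ _ /eqP /cards1P[a aE]] := xN j.+1 jm.
  have : v \in kids (x j.+1) by rewrite inE.
  have : x j \in kids (x j.+1) by rewrite inE xk.
  by rewrite aE !inE => /eqP-> /eqP.
have rkx i j : i < j -> j <= m.+2 -> rk (x j) < rk (x i).
  elim: j => // j IH; rewrite ltnS => ij jm.
  have [xr _] := andP (xk j jm); have lt : rk (x j.+1) < rk (x j) by apply: rkP.
  move: ij; rewrite leq_eqVlt => /orP[/eqP->//|ij]; apply: ltn_trans lt (IH ij (ltnW jm)).
have xinj i j : i <= m.+2 -> j <= m.+2 -> x i = x j -> i = j.
  move=> im jm E; apply/eqP; case: (ltngtP i j) => // h.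
    by have := rkx _ _ h jm; rewrite E ltnn.
  by have := rkx _ _ h im; rewrite E ltnn.
pose c := x 1; pose top := x m.+2; pose zs := traject par (x 2) m.
pose Z := [set z in zs].
have ZP z : reflect (exists2 j, 1 < j < m.+2 & z = x j) (z \in Z).
  rewrite inE; apply: (iffP trajectP) => [[i im ->]|[j /andP[j1 jm] ->]].
    by exists (i + 2); [rewrite addn2|rewrite /x iterD].
  by exists (j - 2); [move: j1 jm; clear; lia|rewrite /x -iterD subnK].
have uzs : uniq zs.
  apply/(uniqP (x 2)) => i j; rewrite !inE size_traject => im jm; rewrite /zs.
  rewrite !nth_traject // -!iterD => E; apply: (@addIn 2); apply: xinj E; by rewrite addn2 !ltnS ltnW.
have cZ : #|Z| = m by rewrite cardsE (card_uniqP uzs) size_traject.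
have H1 : 0 < 1 <= m.+2 by [].
have Ht : 0 < m.+2 <= m.+2 by rewrite leqnn.
have [cr cB' ck] := xN 1 H1; have [tr tB tk] := xN _ Ht.
have nZ j : j <= m.+2 -> ~~ (1 < j < m.+2) -> x j \notin Z.
  by move=> jm jn; apply/negP => /ZP[i im /xinj E]; move: jn; rewrite E // ?im // ltnW //; case/andP: im.
have czZ : c \notin Z by apply: nZ.
have tZ : top \notin Z by apply: nZ; rewrite ?ltnn ?andbF.
have ct : c != top by apply/eqP => /xinj E; have := E isT (leqnn _).
have ZN z : z \in Z -> [/\ z != r, z \notin B, #|kids z| = 1 & z != c].
  move=> zZ; have := zZ => /ZP[j /andP[j1 jm] zE].
  have [? ? ?] := xN j (introT andP (conj (ltnW j1) (ltnW jm))).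
  by rewrite zE; split=> //; rewrite -zE; apply: contraNneq czZ => <-.
pose S := skeleton (c |: B).
have cS : #|S| <= 9.
  apply: leq_trans (card_skeleton _) _; rewrite (leq_add2r 1 _ 8) (leq_mul2l 2 _ 4) /=.
  by rewrite cardsU1 cB'.
have BS : B \subset S by apply/subsetP=> b bB; rewrite in_setU1 in_setU in_setU1 bB !orbT.
have nS v : v != r -> v \notin B -> v != c -> #|kids v| = 1 -> v \notin S.
  by move=> vr vB vc vk; apply: skeletonP; rewrite ?vk // in_setU1 negb_or vc.
have parZ v : v != r -> par v \in Z -> (v == c) || (v \in Z).
  move=> vr /ZP[j /andP[j1 jm] pE].
  have -> : v = x j.-1 by apply: xkid; [rewrite (ltnW j1) ltnW|rewrite /child vr pE eqxx].
  case: j j1 jm {pE} => // -[//|[|j]] _ jm; first by rewrite eqxx.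
  by rewrite orbC; apply/orP; left; apply/ZP; exists j.+2; rewrite ?(ltn_trans _ jm).
apply: (force_leq (s := n + 5 * #|S| + (#|Z| + 3))).
  by rewrite cZ leq_add2r leq_add2l (leq_mul2l 5 _ 9) cS.
have N1 : 9 * #|S| + 2 * #|set0 : {set V}| + 100 <= 181.
  by rewrite cards0 muln0 addn0 (leq_add2r 100 _ 81) (leq_mul2l 9 _ 9) cS.
apply: force_bind.
  apply: (@machine n V r par rk cardV rkP B S Z set0 (l + 5)).
  - exact: setU11.
  - exact: BS.
  - by move=> v /ZN[vr vB vk vc]; apply: nS.
  - move=> v vS pv; have vr : v != r by apply: contraNneq vS => ->; apply: setU11.
    have /orP[/eqP vc|//] := parZ v vr pv.
    by move: vS; rewrite vc in_setU1 in_setU setU11 orbT.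
  - exact: skeleton_cl.
  - by move=> y; rewrite inE.
  - by move=> y; rewrite inE.
  - by move=> y v; rewrite inE.
  - by move=> y; rewrite inE.
  - exact: deg_few.
  - by rewrite cZ; move: lm; clear; lia.
  - by rewrite cZ; move: lm; clear; lia.
  - move=> h _; apply: leq_trans degn; apply: leq_add N1; by rewrite leq_mul2l degD orbT.
  - by apply: leq_trans N1 (leq_trans _ degn); rewrite leq_addl.
move=> Rd U [f [alt I]].
apply: (@finish_chain n V r par B S _ set0 Z cardV c top zs) I => //.
- by move=> z; rewrite inE.
- have -> : rcons zs top = traject par (par c) m.+1.
    by rewrite trajectSr -[par c]/(x 2) /top /zs /x -iterD addn2.
  exact: (fpath_traject par c m.+1).
- by rewrite -[[set v | _]]/(kids c) ck.
- by apply: nS => //; rewrite eq_sym.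
- move=> v vt; have -> : v = x m.+1 by apply: xkid vt.
  apply/ZP; exists m.+1; rewrite ?leqnn ?andbT //.
  by move: lm; clear; lia.
- by rewrite cZ; move: lm; clear; lia.
Qed.
End FewLeaves.
End Cases.
End Forest.

(** * The theorem *)

(** Five rounds for each skeleton role, two skeleton roles for each hub and
    [n %/ q <= 4 * N ^ 2 * q] give [40 * N ^ 2]; the 700 absorbs all terms linear in [q]. *)
Definition rate N := 40 * N ^ 2 + 700.

(** The path and the leaves to be excluded cost about [2000 * q ^ 2] roles, at most [2000 * n / N],
    while the degree condition leaves [3000 * n / N] to spare. *)
Lemma few_leaves_arith n N q D : 0 < N -> N <= q -> 600 <= q -> N ^ 2 * q ^ 2 <= n ->
  N * (3 * D) + 3000 * n <= N * n -> let l := 28 * (q + 60) in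
  [/\ 3 * D + (2 * l + 8) * (l + 60).+3 < n, 3 * D + 181 <= n &
      n + 45 + (l + 60 + 3) <= n + rate N * q].
Proof.
move=> N0 Nq q60 Nqn deg l.
have e : (2 * l + 8) * (l + 60).+3 <= 2000 * q ^ 2.
  have a : 2 * l + 8 <= 62 * q by rewrite /l; move: q60; clear; lia.
  have b : (l + 60).+3 <= 31 * q by rewrite /l; move: q60; clear; lia.
  by apply: leq_trans (leq_mul a b) _; rewrite mulnACA mulnn leq_mul2r orbT.
have f : N * (2000 * q ^ 2) <= 2000 * n.
  by apply: leq_trans (_ : 2000 * (N ^ 2 * q ^ 2) <= _); [nia|rewrite leq_mul2l].
have g : 181 <= 2000 * q ^ 2 by nia.
have n0 : 0 < n by nia.
have h : 3 * D + 2000 * q ^ 2 < n.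
  rewrite -(ltn_pmul2l N0) mulnDr; apply: leq_ltn_trans (leq_add (leqnn _) f) _.
  by apply: leq_trans deg; rewrite ltn_add2l ltn_mul2r n0.
split; [exact: leq_ltn_trans (leq_add (leqnn _) e) h| |].
  by apply: leq_trans (ltnW h); rewrite leq_add2l.
by rewrite /l /rate; move: q60; move: (N ^ 2) => M; clear; nia.
Qed.

(** After multiplication by [N], each of [n %/ q] and [q] is at most [n], so the lower-order terms
    fit into the spare [3000 * n]. *)
Lemma many_leaves_arith n N q D : 0 < N -> N <= q -> 600 <= q -> N ^ 2 * q ^ 2 <= n ->
  n < N ^ 2 * q.+1 ^ 2 -> N * (3 * D) + 3000 * n <= N * n -> let m := q + 60 in
  3 * D + (9 * (2 * (n %/ q + 28 * m) + 1) + 2 * (28 * m) + 100) <= n /\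
  n + 5 * (2 * (n %/ q + 28 * m) + 1) + 4 * m <= n + rate N * q.
Proof.
move=> N0 Nq q60 Nqn nN deg m.
have hq : (n %/ q) * q <= n by apply: leq_divM.
have hN : n %/ q <= 4 * N ^ 2 * q.
  have q0 : 0 < q by apply: leq_trans q60.
  rewrite -(leq_pmul2r q0); apply: leq_trans (leq_trans hq (ltnW nN)) _.
  have : q.+1 ^ 2 <= 4 * q ^ 2 by move: q0; clear; nia.
  move=> h; apply: leq_trans (leq_mul (leqnn (N ^ 2)) h) _.
  by rewrite mulnCA -mulnn !mulnA.
have m2 : m <= 2 * q by rewrite /m; move: q60; clear; lia.
have Nh : N * (n %/ q) <= n by apply: leq_trans hq; rewrite mulnC leq_mul2l Nq orbT.
have NQ : N * q <= n by apply: leq_trans Nqn; rewrite -expnMn -mulnn leq_pmull // muln_gt0 N0 (leq_trans _ q60).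
split; last first.
  by rewrite /rate; move: hN m2 q60; move: (n %/ q) (N ^ 2) => h M; clear; nia.
rewrite -(leq_pmul2l N0) mulnDr.
apply: leq_trans (leq_trans deg (leqnn _)); rewrite leq_add2l.
have : N * m <= 2 * (N * q) by rewrite mulnCA leq_mul2l m2 orbT.
have : 600 * N <= N * q by rewrite mulnC leq_mul2l q60 orbT.
have -> : N * (9 * (2 * (n %/ q + 28 * m) + 1) + 2 * (28 * m) + 100)
    = 18 * (N * (n %/ q)) + 560 * (N * m) + 109 * N.
  by clear; move: (n %/ q) m => h k; nia.
by move: Nh NQ; move: (N * (n %/ q)) (N * m) (N * q) => a b d; clear; lia.
Qed.

Section Tree.
Variables (n : nat) (T : graph n) (rt : rooting T).
Let r := rt_root rt.
Let par := rt_par rt.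

Lemma card_kids v : #|kids r par v| <= maxdeg T.
Proof.
apply: leq_trans (leq_bigmax v); apply: subset_leq_card; apply/subsetP=> u.
by rewrite !inE => /andP[ur /eqP <-]; apply: rt_edge.
Qed.

Lemma emb_copy f (Rd : graph n) : emb r par f Rd -> contains_copy T Rd.
Proof.
case=> finj fe; exists f; split=> // e /(rt_all rt)[v vr ->].
by rewrite imsetU1 imset_set1; apply: fe.
Qed.

Lemma tree_force N q : 0 < N -> N <= q -> 600 <= q -> N ^ 2 * q ^ 2 <= n < N ^ 2 * q.+1 ^ 2 ->
  N * (3 * maxdeg T) + 3000 * n <= N * n ->
  force (n + rate N * q) (fun Rd _ => contains_copy T Rd) set0 (Kn n).
Proof.
move=> N0 Nq q60 /andP[Nqn nN] deg.
have cV : #|'I_n| = n := card_ord n.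
(* The threshold is the number of leaves that [many_leaves] requires outside any three vertices. *)
set l := 28 * (q + 60).
case: (pickP (fun B : {set 'I_n} => (#|B| <= 3) && (#|[set v | leaf r par v & par v \notin B]| <= l))).
  move=> B /andP[cB few]; have [a1 a2 a3] := few_leaves_arith N0 Nq q60 Nqn deg.
  have l60 : 30 + l + 30 <= l + 60 by rewrite addnAC addnC addnA.
  have F := few_leaves (@rt_rkP _ _ rt) cV cB card_kids few l60 a1 a2.
  by apply: (force_leq a3 (force_imp _ F)) => Rd _ [f]; apply: emb_copy.
move=> none; have [a1 a2] := many_leaves_arith N0 Nq q60 Nqn nN deg.
have q0 : 0 < q by apply: leq_trans q60.
have many (B : {set 'I_n}) : #|B| <= 3 -> 4 * (7 * (q + 60)) <= #|[set v | leaf r par v & par v \notin B]|.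
  move=> cB; have := none B; rewrite cB /= => /negbT; rewrite -ltnNge => /ltnW.
  by rewrite /l mulnA.
have degv v : 3 * #|kids r par v|
    + (9 * (2 * (n %/ q + 28 * (q + 60)) + 1) + 2 * (28 * (q + 60)) + 100) <= n.
  by apply: leq_trans a1; rewrite leq_add2r leq_mul2l card_kids orbT.
have F := many_leaves (@rt_rkP _ _ rt) cV q0 _ _ many degv.
apply: (force_leq a2 (force_imp _ (F _ _))) => [Rd _ [f]| |]; first exact: emb_copy.
  by rewrite leq_add2l.
by rewrite leq_addl.
Qed.
End Tree.

Lemma leq_sqr_scale N q : 0 < N -> q <= N ^ 2 * q ^ 2.
Proof.
move=> N0; rewrite -expnMn; apply: leq_trans (leq_pmull q N0) _.
by case: (N * q) => // k; rewrite -mulnn leq_pmull.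
Qed.

(** [q] is the integer part of [sqrt n / N]. *)
Lemma scale_exists N n : 0 < N -> exists q, N ^ 2 * q ^ 2 <= n < N ^ 2 * q.+1 ^ 2.
Proof.
move=> N0; have ex : exists q, N ^ 2 * q ^ 2 <= n by exists 0; rewrite muln0.
have bd q : N ^ 2 * q ^ 2 <= n -> q <= n.
  exact: leq_trans (leq_sqr_scale q N0).
case: (ex_maxnP ex bd) => q le mx; exists q; rewrite le ltnNge.
by apply/negP => /mx; rewrite ltnn.
Qed.

Local Open Scope ring_scope.

Theorem theorem1p2 (R : realType) (eps : R) :
  0 < eps -> eps < 3^-1 ->
  exists (b : R) (n0 : nat), 0 < b /\ (0 < n0)%N /\
    forall (n : nat) (T : graph n),
      (n0 <= n)%N -> is_tree T ->
      (maxdeg T)%:R < (3^-1 - eps) * n%:R ->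
      waiter_wins T /\
      exists t : nat, t%:R <= n%:R + b * Num.sqrt (n%:R) /\ waiter_wins_within T t.
Proof.
(* With [1000 < N * eps], the slack [3 * eps * n] in three times the degree bound is at least
   [3000 * n / N]. *)
move=> eps0 _; pose N := Num.bound (1000 / eps).
have Neps : 1000 < N%:R * eps.
  by rewrite -ltr_pdivrMr // archi_boundP // divr_ge0 // ltW.
have N0 : (0 < N)%N.
  by case: N Neps => //; rewrite mul0r ltNge ler0n.
(* The first summand of [n0] forces [q] to be at least [N + 600]; the second ensures that the whole
   game has at least [n + C * q] rounds. *)
pose C := rate N; pose n0 := (N ^ 2 * (N + 600) ^ 2 + (8 * C + 100))%N.
exists C%:R, n0; split; first by rewrite ltr0n /C /rate addn_gt0 orbT.
split; first by rewrite /n0 !addn_gt0 orbT.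
move=> n T nn0 /tree_rooting[rt] deg.
have [q /andP[qn nq]] := scale_exists n N0.
have qbig : (N + 600 <= q)%N.
  rewrite -ltnS ltnNge; apply/negP => le.
  have : (N ^ 2 * q.+1 ^ 2 <= N ^ 2 * (N + 600) ^ 2)%N by rewrite leq_mul2l leq_sqr le orbT.
  move=> h; have := leq_trans nq h; rewrite ltnNge => /negP[].
  by apply: leq_trans nn0; rewrite /n0 leq_addr.
have degN : (N * (3 * maxdeg T) + 3000 * n <= N * n)%N.
  have n00 : 0 <= n%:R :> R by [].
  rewrite -(ler_nat R) natrD !natrM.
  have h : 3 * (maxdeg T)%:R <= n%:R - 3 * eps * n%:R :> R.
    have := ltW deg; rewrite -(ler_pM2l (_ : 0 < 3)) //; move/le_trans; apply.
    by rewrite mulrA mulrBr divff ?pnatr_eq0 // mulrBl mul1r.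
  apply: le_trans (lerD (ler_wpM2l _ h) (lexx _)) _ => //.
  rewrite mulrBr -lerBrDl opprB addrC subrK.
  rewrite !mulrA (mulrC N%:R) -(mulrA 3) ler_wpM2r //.
  have -> : 3000 = 3 * 1000 :> R by rewrite -natrM.
  by rewrite ler_pM2l // ltW.
have F := tree_force rt N0 (leq_trans (leq_addr _ _) qbig) (leq_trans (leq_addl _ _) qbig) (introT andP (conj qn nq)) degN.
split.
  apply: force_waiter; apply: force_leq F.
  have -> : #|Kn n| = 'C(n, 2) by rewrite -[X in 'C(X, 2)](card_ord n) -card_draws.
  have qlen : (q <= n)%N.
    exact: leq_trans (leq_sqr_scale q N0) qn.
  have Cn : (8 * C + 100 <= n)%N by apply: leq_trans nn0; rewrite /n0 leq_addl.
  rewrite bin2 -divn2 -divnMA leq_divRL // -/C.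
  have : (C * q <= C * n)%N by rewrite leq_mul2l qlen orbT.
  have : ((8 * C + 100) * n <= n * n)%N by rewrite leq_mul2r Cn orbT.
  by clear; move: C => k; nia.
exists (n + rate N * q)%N; split; last exact: force_waiter F.
rewrite natrD natrM lerD2l ler_wpM2l //.
have -> : q%:R = Num.sqrt (q%:R ^+ 2) :> R by rewrite sqrtr_sqr ger0_norm.
rewrite -natrX ler_wsqrtr // ler_nat.
by apply: leq_trans qn; rewrite leq_pmull // expn_gt0 N0.
Qed.
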